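(* Let $\Omega\subset\mathbb{P}(\mathbb{R}^d)$ be a properly convex domain and suppose an infinite order element $\gamma\in\mathrm{Aut}(\Omega)$ acts by a translation along a projective geodesic $\ell_\gamma\subset\Omega$. Then the following are equivalent: (1) $\gamma$ is a rank one automorphism. (2) The geodesic $\ell_\gamma$ is Morse (equivalently, $\ell_\gamma$ is contracting). If, in addition, there is a discrete group $\Gamma\subseteq\mathrm{Aut}(\Omega)$ such that $\Gamma$ divides $\Omega$ and $\gamma\in\Gamma$, then each of the two conditions ''$\gamma$ is a rank one automorphism'' and ''$\ell_\gamma$ is Morse'' is equivalent to: (3) $\gamma$ is biproximal, i.e. a matrix representing $\gamma$ has unique eigenvalues of maximum and minimum modulus.
   Context: A properly convex domain $\Omega\subset\mathbb{P}(\mathbb{R}^d)$ is a nonempty open convex set whose closure is a bounded convex subset of some affine chart. $\mathrm{Aut}(\Omega)\subset\mathrm{PGL}(d,\mathbb{R})$ is the group of projective transformations preserving $\Omega$; a discrete subgroup $\Gamma\subseteq\mathrm{Aut}(\Omega)$ divides $\Omega$ if it acts cocompactly on $\Omega$. The Hilbert metric is $d_\Omega(x,y)=\frac12\log\frac{|a-y||b-x|}{|a-x||b-y|}$, where $a,b\in\partial\Omega$ are the points where the projective line through $x,y$ meets $\partial\Omega$, ordered $a,x,y,b$. For $x,y\in\overline\Omega$, $[x,y]\subset\overline\Omega$ is the closed projective segment joining them and $(x,y)$ the open one. Here $\ell_\gamma=(x,z)\subset\Omega$ with $x,z\in\partial\Omega$ is a bi-infinite projective geodesic, and $\gamma$ acting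 by a translation along it means $\gamma$ preserves $\ell_\gamma$ and acts on it as a translation by a positive amount. $\ell_\gamma=(x,z)$ is contained in a half triangle in $\Omega$ if there is $y\in\partial\Omega$ with $[x,y]\cup[y,z]\subset\partial\Omega$. An infinite order $\gamma\in\mathrm{Aut}(\Omega)$ is a rank one automorphism if it acts by a translation along a projective geodesic $\ell_\gamma\subset\Omega$ and $\ell_\gamma$ is not contained in any half triangle. A geodesic $\ell$ is Morse if there is a function $M:\mathbb{R}_{\ge0}\times\mathbb{R}_{\ge0}\to\mathbb{R}_{\ge0}$ such that every $(\lambda,a)$-quasi-geodesic with endpoints on $\ell$ lies in the $M(\lambda,a)$-neighborhood of $\ell$. It is contracting if there is $D>0$ such that for every open metric ball $B$ disjoint from $\ell$ the set $\bigcup_{p\in B}\{q\in\ell:d_\Omega(p,q)=d_\Omega(p,\ell)\}$ has diameter at most $D$. ''Unique eigenvalues of maximum and minimum modulus'' means that there is exactly one eigenvalue (counted with algebraic multiplicity) of maximal modulus and exactly one of minimal modulus. *)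

(* Defs.v *)
From HB Require Import structures.
From mathcomp Require Import all_boot all_order all_fingroup all_algebra.
From mathcomp Require Import all_classical all_reals all_analysis.
From mathcomp Require Import complex.

Set Implicit Arguments.
Unset Strict Implicit.
Unset Printing Implicit Defensive.

Import Order.TTheory GRing.Theory Num.Theory.
Import numFieldNormedType.Exports.

Local Open Scope classical_set_scope.
Local Open Scope ring_scope.

Definition pspace (R : realType) (d : nat) : Type :=
  {L : {vspace 'cV[R]_d} | \dim L == 1%N}.

HB.instance Definition _ (R : realType) (d : nat) := Choice.on (pspace R d).

Section ProjectiveSpace.
Context {R : realType} {d : nat}.
Implicit Types (p x y z : pspace R d) (v w : 'cV[R]_d) (S : set (pspace R d)).

Definition lifts p : set 'cV[R]_d := [set v | v != 0 /\ v \in val p].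

Definition cone S : set 'cV[R]_d := [set v | exists2 p, S p & lifts p v].

Lemma lifts_ex p : exists v, lifts p v.
Proof.
have := svalP p => /eqP dp; exists (vpick (val p)); split.
  by rewrite vpick0 -dimv_eq0 dp.
exact: memv_pick.
Qed.

Lemma lifts_val p v : lifts p v -> val p = <[v]>%VS.
Proof.
move=> [v0 vp]; apply/esym/eqP; rewrite eqEdim -memvE vp /=.
by rewrite (eqP (svalP p)) dim_vline v0.
Qed.

Lemma lifts_inj p x v : lifts p v -> lifts x v -> p = x.
Proof. by move=> /lifts_val pv /lifts_val xv; apply: val_inj; rewrite pv. Qed.

Lemma lifts_line v : v != 0 -> exists p, lifts p v.
Proof.
move=> v0; have dv : \dim <[v]> == 1%N by rewrite dim_vline v0.
by exists (exist _ <[v]>%VS dv); split => //; exact: memv_line.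
Qed.

Lemma cone_setT : cone setT = [set v | v != 0].
Proof.
apply/seteqP; split => v /=; first by move=> [p _ []].
by move=> /lifts_line[p pv]; exists p.
Qed.

Lemma cone_setI S S' : cone (S `&` S') = cone S `&` cone S'.
Proof.
apply/seteqP; split => v; first by move=> [p [Sp S'p] pv]; split; exists p.
move=> [[p Sp pv] [q Sq qv]]; exists p => //; split => //.
by rewrite (lifts_inj pv qv).
Qed.

Lemma cone_bigcup (I : Type) (F : I -> set (pspace R d)) :
  cone (\bigcup_i F i) = \bigcup_i cone (F i).
Proof.
apply/seteqP; split => v; first by move=> [p [i _ Fp] pv]; exists i => //; exists p.
by move=> [i _ [p Fp pv]]; exists p => //; exists i.
Qed.

(* The quotient topology from R^d \ {0}, which is open in R^d. *)
Definition pspace_open S : Prop := open (cone S).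

Fact pspace_openT : pspace_open setT.
Proof.
rewrite /pspace_open cone_setT.
have -> : [set v : 'cV[R]_d | v != 0] = ~` [set 0].
  by apply/seteqP; split => v /=; [move/eqP|move=> v0; apply/eqP].
apply: closed_openC; exact: (@accessible_closed_set1 _ (@hausdorff_accessible _ (@norm_hausdorff _ _))).
Qed.

Fact pspace_openI : setI_closed pspace_open.
Proof. by move=> S S' oS oS'; rewrite /pspace_open cone_setI; exact: openI. Qed.

Fact pspace_open_bigU (I : Type) (F : I -> set (pspace R d)) :
  (forall i, pspace_open (F i)) -> pspace_open (\bigcup_i F i).
Proof. by move=> oF; rewrite /pspace_open cone_bigcup; apply: bigcup_open => i _; exact: oF. Qed.

End ProjectiveSpace.

HB.instance Definition _ (R : realType) (d : nat) :=
  @isOpenTopological.Build (pspace R d) pspace_open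
    pspace_openT pspace_openI (@pspace_open_bigU R d).

Section Induces.
Context {R : realType} {d : nat}.
Implicit Types (A B : 'M[R]_d) (g h : pspace R d -> pspace R d).
Implicit Types (p : pspace R d) (v : 'cV[R]_d).

Definition induces A g : Prop :=
  A \in unitmx /\ forall p v, v \in val p -> A *m v \in val (g p).

Lemma induces_lifts A g p v : induces A g -> lifts p v -> lifts (g p) (A *m v).
Proof.
move=> [Au Ag] [v0 vp]; split; last exact: Ag.
by apply: contra_neq v0 => Av0; rewrite -(mulKmx Au v) Av0 mulmx0.
Qed.

Lemma induces_inj A g h : induces A g -> induces A h -> g = h.
Proof.
move=> Ag Ah; apply/funext => p; have [v pv] := lifts_ex p.
exact: lifts_inj (induces_lifts Ag pv) (induces_lifts Ah pv).
Qed.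

Lemma induces1 : induces 1%:M id.
Proof. by split; [exact: unitmx1|move=> p v; rewrite mul1mx]. Qed.

Lemma inducesM A B g h : induces A g -> induces B h -> induces (A *m B) (g \o h).
Proof.
move=> [Au Ag] [Bu Bh]; split; first by rewrite unitmx_mul Au.
by move=> p v vp; rewrite -mulmxA; apply: Ag; exact: Bh.
Qed.

Lemma induces_ex A : A \in unitmx -> exists g, induces A g.
Proof.
move=> Au; suff /choice[g Hg] : forall p, exists q : pspace R d,
    forall v, v \in val p -> A *m v \in val q.
  by exists g; split.
move=> p; have [v pv] := lifts_ex p.
have Av0 : A *m v != 0.
  by apply: contra_neq pv.1 => Av0; rewrite -(mulKmx Au v) Av0 mulmx0.
have [q [_ qv]] := lifts_line Av0; exists q => w.
rewrite (lifts_val pv) => /vlineP[k ->].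
by rewrite -scalemxAr memvZ.
Qed.

Lemma inducesV A g : induces A g ->
  exists h, [/\ induces (invmx A) h, h \o g = id & g \o h = id].
Proof.
move=> Ag; have Au := Ag.1.
have [h Ah] : exists h, induces (invmx A) h.
  by apply: induces_ex; rewrite unitmx_inv.
exists h; split => //; apply: induces_inj induces1.
  by rewrite -(mulVmx Au); exact: inducesM.
by rewrite -(mulmxV Au); exact: inducesM.
Qed.

End Induces.

(* PGL(d, R), as the group of transformations of P(R^d) induced by GL(d, R);
   two matrices induce the same transformation iff they are proportional. *)
Record PGL (R : realType) (d : nat) := MkPGL {
  pgl_fun :> pspace R d -> pspace R d ;
  pglP : exists A, induces A pgl_fun }.

Lemma det_continuous (R : realType) (d : nat) :
  continuous (fun A : 'M[R]_d => \det A).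
Proof.
rewrite /determinant.
have ca : continuous (fun x : R * R => x.1 + x.2) by exact: add_continuous.
have cm : continuous (fun x : R * R => x.1 * x.2) by exact: mul_continuous.
apply: (@continuous_big R (perm_type 'I_d) _ 0 xpredT ca _ (index_enum _)
  (fun s (A : 'M[R]_d) => (-1) ^+ s * \prod_i A i (s i))) => s _ A.
have cp : continuous (fun A : 'M[R]_d => \prod_i A i (s i)).
  apply: (@continuous_big R 'I_d _ 1 xpredT cm _ (index_enum _)
    (fun i (A : 'M[R]_d) => A i (s i))) => i _.
  exact: coord_continuous.
exact: (@cvgM R _ _ _ (fun=> (-1) ^+ s) _ _ _ (cvg_cst _) (cp A)).
Qed.

Section PGLGroup.
Context {R : realType} {d : nat}.
Implicit Types (g h k : PGL R d).

Lemma pgl_ext g h : pgl_fun g = pgl_fun h -> g = h.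
Proof.
case: g h => [g gP] [h hP] /= gh; move: hP; rewrite -gh => hP.
by congr MkPGL; exact: Prop_irrelevance.
Qed.

HB.instance Definition _ := gen_eqMixin (PGL R d).
HB.instance Definition _ := gen_choiceMixin (PGL R d).

Definition pgl_one : PGL R d := @MkPGL R d id (ex_intro _ 1%:M induces1).

Fact pgl_mul_subproof g h : exists A, induces A (g \o h).
Proof.
by have [[A Ag] [B Bh]] := (pglP g, pglP h); exists (A *m B); exact: inducesM.
Qed.

Definition pgl_mul g h : PGL R d := MkPGL (pgl_mul_subproof g h).

Fact pgl_inv_subproof g : exists h, pgl_mul h g = pgl_one /\ pgl_mul g h = pgl_one.
Proof.
have [A /inducesV[h [Ah hg gh]]] := pglP g.
by exists (@MkPGL R d h (ex_intro _ (invmx A) Ah)); split; exact: pgl_ext.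
Qed.

Definition pgl_inv g : PGL R d := projT1 (cid (pgl_inv_subproof g)).

Fact pgl_mulA : associative pgl_mul.
Proof. by move=> g h k; exact: pgl_ext. Qed.

Fact pgl_mul1g : left_id pgl_one pgl_mul.
Proof. by move=> g; exact: pgl_ext. Qed.

Fact pgl_mulg1 : right_id pgl_one pgl_mul.
Proof. by move=> g; exact: pgl_ext. Qed.

Fact pgl_mulVg : left_inverse pgl_one pgl_inv pgl_mul.
Proof. by move=> g; rewrite /pgl_inv; case: cid => h /= []. Qed.

Fact pgl_mulgV : right_inverse pgl_one pgl_inv pgl_mul.
Proof. by move=> g; rewrite /pgl_inv; case: cid => h /= []. Qed.

HB.instance Definition _ := isGroup.Build (PGL R d)
  pgl_mulA pgl_mul1g pgl_mulg1 pgl_mulVg pgl_mulgV.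

(* The quotient topology from GL(d, R), which is open in 'M[R]_d. *)
Definition pgl_open (U : set (PGL R d)) : Prop :=
  open [set A : 'M[R]_d | exists2 g, U g & induces A g].

Fact pgl_openT : pgl_open setT.
Proof.
rewrite /pgl_open.
have -> : [set A | exists2 g : PGL R d, setT g & induces A g] =
    [set A : 'M[R]_d | \det A != 0].
  apply/seteqP; split => A /=.
    by move=> [g _ [+ _]]; rewrite unitmxE unitfE.
  rewrite -unitfE -unitmxE => /induces_ex[g Ag].
  by exists (@MkPGL R d g (ex_intro _ A Ag)).
have -> : [set A : 'M[R]_d | \det A != 0] = determinant @^-1` [set r : R | r != 0].
  by [].
by apply: open_comp => [A _|]; [exact: det_continuous|exact: open_neq].
Qed.

Fact pgl_openI : setI_closed pgl_open.
Proof.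
move=> U V oU oV; rewrite /pgl_open.
suff -> : [set A : 'M[R]_d | exists2 g, (U `&` V) g & induces A g] =
    [set A | exists2 g, U g & induces A g] `&`
    [set A | exists2 g, V g & induces A g] by exact: openI.
apply/seteqP; split => A /=.
  by move=> [g [Ug Vg] Ag]; split; exists g.
move=> [[g Ug Ag] [h Vh Ah]]; exists g => //; split => //.
by rewrite (pgl_ext (induces_inj Ag Ah)).
Qed.

Fact pgl_open_bigU (I : Type) (F : I -> set (PGL R d)) :
  (forall i, pgl_open (F i)) -> pgl_open (\bigcup_i F i).
Proof.
move=> oF; rewrite /pgl_open.
suff -> : [set A : 'M[R]_d | exists2 g, (\bigcup_i F i) g & induces A g] =
    \bigcup_i [set A | exists2 g, F i g & induces A g].
  by apply: bigcup_open => i _; exact: oF.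
apply/seteqP; split => A /=.
  by move=> [g [i _ Fg] Ag]; exists i => //; exists g.
by move=> [i _ [g Fg Ag]]; exists g => //; exists i.
Qed.

HB.instance Definition _ := isOpenTopological.Build (PGL R d)
  pgl_openT pgl_openI pgl_open_bigU.

End PGLGroup.

Section HilbertGeometry.
Context {R : realType} {d : nat}.
Implicit Types (Omega S l : set (pspace R d)) (p q x y z : pspace R d).
Implicit Types (f : 'rV[R]_d) (g : PGL R d) (Gamma : set (PGL R d)).

(* A linear form f gives the affine chart of all [v] with f(v) <> 0, identified
   with the affine hyperplane f = 1. *)
Definition in_chart f S : Prop := forall v, cone S v -> (f *m v) 0 0 != 0.

Definition trace f S : set 'cV[R]_d := cone S `&` [set v | (f *m v) 0 0 = 1].

Definition properly_convex Omega : Prop :=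
  [/\ Omega !=set0, open Omega &
   exists f, [/\ in_chart f (closure Omega), convex_set (trace f Omega),
     convex_set (trace f (closure Omega)) &
     bounded_set (trace f (closure Omega))]].

Definition boundary S : set (pspace R d) := closure S `\` S^°.

(* Two distinct points are joined by two projective segments, obtained from
   lifts u, v and u, - v; [x, y] is the one contained in the closure of Omega. *)
Definition closed_segment Omega x y : set (pspace R d) :=
  [set p | exists u v, [/\ lifts x u, lifts y v,
    forall s : R, 0 <= s <= 1 ->
      cone (closure Omega) ((1 - s) *: u + s *: v) &
    exists2 t : R, 0 <= t <= 1 & lifts p ((1 - t) *: u + t *: v)]].

Definition open_segment Omega x y : set (pspace R d) :=
  closed_segment Omega x y `\` [set x; y].

(* The points a, x, y, b are taken in an affine chart containing the closure of
   Omega. Since they are collinear, the cross-ratio depends neither on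
   the chart nor on the norm (here the sup norm) used to measure lengths. *)
Definition is_hilbert_dist Omega x y (r : R) : Prop :=
  exists f a b u v, [/\ in_chart f (closure Omega),
    trace f (boundary Omega) a /\ trace f (boundary Omega) b,
    lifts x u /\ lifts y v,
    exists s t : R, [/\ 0 < s, s <= t, t < 1, u = (1 - s) *: a + s *: b &
      v = (1 - t) *: a + t *: b] &
    r = 2^-1 * ln ((`|a - v| * `|b - u|) / (`|a - u| * `|b - v|))].

(* Only meaningful for points of Omega. The default value 0 is
   reached there only if d = 1, when Omega is a point. *)
Definition hilbert_dist Omega x y : R := xget 0 (is_hilbert_dist Omega x y).

Definition hilbert_dist_set Omega p l : R :=
  inf [set hilbert_dist Omega p q | q in l].

Definition hilbert_ball Omega p (r : R) : set (pspace R d) :=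
  [set q | Omega q /\ hilbert_dist Omega p q < r].

Definition Aut Omega : set (PGL R d) := [set g | g @` Omega = Omega].

Definition discrete_subgroup Gamma : Prop :=
  group_closed [in Gamma] /\ Gamma `<=` isolated Gamma.

Definition divides Gamma Omega : Prop :=
  exists K : set (pspace R d), [/\ compact K, K `<=` Omega &
    Omega `<=` \bigcup_(g in Gamma) (g @` K)].

Definition infinite_order g : Prop := forall n, (0 < n)%N -> (g ^+ n)%g <> 1%g.

Definition projective_geodesic Omega x z : Prop :=
  [/\ boundary Omega x, boundary Omega z, x <> z &
   open_segment Omega x z `<=` Omega].

Definition acts_by_translation Omega g l : Prop :=
  g @` l = l /\
  exists (c : R -> pspace R d) (tau : R), [/\ 0 < tau, range c = l,
    forall s t, hilbert_dist Omega (c s) (c t) = `|s - t| &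
    forall s, g (c s) = c (s + tau)].

Definition translates_along Omega g x z : Prop :=
  projective_geodesic Omega x z /\
  acts_by_translation Omega g (open_segment Omega x z).

Definition in_half_triangle Omega x z : Prop :=
  exists2 y, boundary Omega y &
    closed_segment Omega x y `|` closed_segment Omega y z `<=` boundary Omega.

Definition rank_one Omega g : Prop :=
  [/\ Aut Omega g, infinite_order g &
   exists x z, translates_along Omega g x z /\ ~ in_half_triangle Omega x z].

Definition quasi_geodesic Omega (lambda e a b : R) (c : R -> pspace R d) : Prop :=
  [/\ 1 <= lambda, 0 <= e, a <= b, forall t, a <= t <= b -> Omega (c t) &
   forall s t, a <= s <= b -> a <= t <= b ->
     lambda^-1 * `|s - t| - e <= hilbert_dist Omega (c s) (c t)
       <= lambda * `|s - t| + e].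

Definition morse Omega l : Prop :=
  exists M : {nonneg R} -> {nonneg R} -> {nonneg R},
  forall (lambda e : {nonneg R}) (a b : R) (c : R -> pspace R d),
    quasi_geodesic Omega lambda%:num e%:num a b c -> l (c a) -> l (c b) ->
    forall t, a <= t <= b ->
      hilbert_dist_set Omega (c t) l < (M lambda e)%:num.

Definition nearest_points Omega p l : set (pspace R d) :=
  [set q | l q /\ hilbert_dist Omega p q = hilbert_dist_set Omega p l].

Definition contracting Omega l : Prop :=
  exists2 D : R, 0 < D &
  forall p0 (r : R), Omega p0 -> 0 < r ->
    let B := hilbert_ball Omega p0 r in
    B `&` l = set0 ->
    forall q q', (\bigcup_(p in B) nearest_points Omega p l) q ->
      (\bigcup_(p in B) nearest_points Omega p l) q' ->
      hilbert_dist Omega q q' <= D.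

Definition complex_mx (A : 'M[R]_d) : 'M[R[i]]_d := map_mx (real_complex R) A.

Definition unique_max_modulus (A : 'M[R]_d) : Prop :=
  exists2 lam : R[i], mup lam (char_poly (complex_mx A)) = 1%N &
    forall mu, eigenvalue (complex_mx A) mu -> mu != lam -> `|mu| < `|lam|.

Definition unique_min_modulus (A : 'M[R]_d) : Prop :=
  exists2 lam : R[i], mup lam (char_poly (complex_mx A)) = 1%N &
    forall mu, eigenvalue (complex_mx A) mu -> mu != lam -> `|lam| < `|mu|.

Definition biproximal g : Prop :=
  exists A, [/\ induces A g, unique_max_modulus A & unique_min_modulus A].

End HilbertGeometry.

(* Main.v *)
(* Work in the cone over Omega, ordered by [u <= v] iff [v - u] lies in the closed
   cone K. Normalise a lift T of g so that T x = x and T z = mu z with 0 < mu < 1;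
   as x + z is an order unit, the powers of T are bounded.

   Without half triangles, a limit point of T^n has image the line of x: if w in
   its image is not in K, the last point x + t w in K is the vertex of a half
   triangle. So T^n accumulates at x phi and, symmetrically, mu^n T^-n at z psi;
   moreover phi + psi > 0 on K \ 0. By compactness, v and phi(v) x + psi(v) z
   control each other, and two points with projections at distance s >> 0 are at
   distance s plus their distances to the axis, up to a constant. This gives
   contraction and the Morse property. Conversely, over a half triangle x, y, z the
   span of x, y, z contains uniform quasi-geodesics and balls far above the axis.

   The limits x phi and z psi exist iff the eigenvalues 1 and mu of T are simple
   and the only ones of maximal and minimal modulus. If they exist and y is the
   vertex of a half triangle, then phi y = psi y = 0, and summing y over an orbit
   of T one may assume that T y and T^-1 y are dominated by y. The points
   p_n = x + z + n y are then displaced by T by a bounded amount. If g lies in a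
   discrete group dividing Omega, elements h_n of it bring p_n back to a compact
   set, so that h_n^-1 g h_n takes some value infinitely often; hence the
   corresponding p_n are images of a compact set under maps commuting with T,
   which contradicts that they move away from the axis. *)
From mathcomp Require Import all_boot all_order all_algebra.
From mathcomp Require Import all_classical all_reals all_analysis.
From mathcomp Require Import complex ring lra zify.
Require Import Defs.

Set Implicit Arguments.
Unset Strict Implicit.
Unset Printing Implicit Defensive.

Import Order.TTheory GRing.Theory Num.Theory.
Import numFieldNormedType.Exports.

Local Open Scope classical_set_scope.
Local Open Scope ring_scope.

(** [rank_one] asks for some axis without half triangles, while the Morse and contracting conditions
    concern the given one. The two are matched through eigenvectors: if one axis carries no half
    triangle, the extreme eigenvalues are simple, which makes the fixed endpoints unique
    ([axis_unique], [rank_one_axis]).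

    The third condition needs the group. In the plane, the cone of all a x + b y + c z with a, c > 0
    and b > - sqrt(a c) is invariant under the biproximal diag(4, 2, 1), yet x, y, z form a half
    triangle over its axis. Such a y is killed by both phi and psi; what excludes it is the
    cocompact action.

    The Hilbert metric is traded for gauges because an upper bound on a distance then amounts to
    exhibiting two elements of [K], and a lower bound to bounding all [k] with [k *: v - u] in [K].
    Cross-ratios occur only where the two descriptions are compared, in [is_hilbert_dist_unique] and
    [is_hilbert_dist_exists]. Many estimates treat only one end of the axis; [mu *: invmx T]
    exchanges x and z and gives the other end. *)

Section LinearEntries.
Context {R : pzRingType} {m n : nat}.
Implicit Types A B : 'M[R]_(m, n).

Lemma addmxE A B i j : (A + B) i j = A i j + B i j. Proof. by rewrite mxE. Qed.
Lemma oppmxE A i j : (- A) i j = - A i j. Proof. by rewrite mxE. Qed.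
Lemma scalemxE a A i j : (a *: A) i j = a * A i j. Proof. by rewrite mxE. Qed.
Lemma zeromxE i j : (0 : 'M[R]_(m, n)) i j = 0. Proof. by rewrite mxE. Qed.
Definition linmxE := (addmxE, oppmxE, scalemxE, zeromxE).

End LinearEntries.

(* Identities of linear combinations, all other matrix terms being opaque. *)
Ltac vring := apply/matrixP => ? ?; rewrite !linmxE; ring.
Ltac vfield := apply/matrixP => ? ?; rewrite !linmxE; field; try (by []); rewrite ?gt_eqF //.
Ltac veq H := let h := fresh in have h := H; move: h;
  match goal with |- ?P ?a -> ?Q ?b => rewrite (_ : a = b); [exact id | vring] end.

(** * Linear forms, the sup norm, and cluster points of sequences of matrices *)

Definition pair {R : pzRingType} {d : nat} (f : 'rV[R]_d) (v : 'cV[R]_d) : R :=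
  (f *m v) 0 0.

Section Pairing.
Context {R : realType} {d : nat}.
Implicit Types (f : 'rV[R]_d) (u v : 'cV[R]_d) (a : R).

Lemma pairD f u v : pair f (u + v) = pair f u + pair f v.
Proof. by rewrite /pair mulmxDr mxE. Qed.

Lemma pairZ f a v : pair f (a *: v) = a * pair f v.
Proof. by rewrite /pair -scalemxAr mxE. Qed.

Lemma pairN f v : pair f (- v) = - pair f v.
Proof. by rewrite /pair mulmxN mxE. Qed.

Lemma pairB f u v : pair f (u - v) = pair f u - pair f v.
Proof. by rewrite pairD pairN. Qed.

Lemma pair0 f : pair f 0 = 0.
Proof. by rewrite /pair mulmx0 mxE. Qed.

Lemma pairM f (A : 'M[R]_d) v : pair f (A *m v) = pair (f *m A) v.
Proof. by rewrite /pair mulmxA. Qed.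

Lemma pairZl a f v : pair (a *: f) v = a * pair f v.
Proof. by rewrite /pair -scalemxAl mxE. Qed.

Lemma mulmx_pair (x : 'cV[R]_d) f v : x *m f *m v = pair f v *: x.
Proof.
rewrite -mulmxA [f *m v]mx11_scalar /pair; apply/matrixP => i j.
by rewrite mul_mx_scalar.
Qed.

Lemma exists_entry_neq0 (x : 'cV[R]_d) : x != 0 -> exists i, x i 0 != 0.
Proof.
move=> /eqP x0; apply: contrapT => nx; apply: x0; apply/colP => i; rewrite mxE.
by apply: contrapT => xi; apply: nx; exists i; apply/eqP.
Qed.

Lemma exists_pair1 (x : 'cV[R]_d) : x != 0 -> exists phi, pair phi x = 1.
Proof.
move=> /exists_entry_neq0[i xi].
by exists ((x i 0)^-1 *: delta_mx 0 i); rewrite pairZl /pair -rowE mxE mulVf.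
Qed.

Lemma mx_norm_entry m n (A : 'M[R]_(m, n)) i j : `|A i j| <= `|A|.
Proof. by rewrite [leRHS](_ : _ = mx_norm A) // mx_normrE; apply/bigmax_geP; right; exists (i, j). Qed.

Lemma mx_norm_le m n (A : 'M[R]_(m, n)) c :
  0 <= c -> (forall i j, `|A i j| <= c) -> `|A| <= c.
Proof.
by move=> c0 Ac; rewrite [leLHS](_ : _ = mx_norm A) // mx_normrE; apply/bigmax_leP; split => // -[].
Qed.

Lemma mulmx_norm m n p (A : 'M[R]_(m, n)) (B : 'M[R]_(n, p)) :
  `|A *m B| <= n%:R * `|A| * `|B|.
Proof.
apply: mx_norm_le => [|i j]; first by rewrite !mulr_ge0.
rewrite mxE; apply: le_trans (ler_norm_sum _ _ _) _.
apply: (@le_trans _ _ (\sum_(k < n) `|A| * `|B|)).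
  by apply: ler_sum => k _; rewrite normrM ler_pM ?mx_norm_entry.
by rewrite sumr_const card_ord -[leLHS]mulr_natl mulrA.
Qed.

Lemma mulmx_norm_lt m n (A : 'M[R]_(m, n)) (v : 'cV[R]_n) (e : R) :
  `|A| < e / (n%:R * `|v| + 1) -> `|A *m v| < e.
Proof.
rewrite ltr_pdivlMr ?ltr_wpDl ?mulr_ge0 //; apply: le_lt_trans.
apply: le_trans (mulmx_norm _ _) _.
by rewrite mulrDr mulr1 mulrCA mulrA ler_wpDr.
Qed.

Lemma delta_norm_le1 n (j : 'I_n) : `|delta_mx j 0 : 'cV[R]_n| <= 1.
Proof. by apply: mx_norm_le => // i k; rewrite mxE; case: (_ && _); rewrite ?normr1 ?normr0. Qed.

Lemma mx_norm_le_col m n (A : 'M[R]_(m, n)) c :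
  0 <= c -> (forall j, `|A *m (delta_mx j 0 : 'cV[R]_n)| <= c) -> `|A| <= c.
Proof.
move=> c0 Ac; apply: mx_norm_le => // i j; apply: le_trans (Ac j).
by have := mx_norm_entry (A *m delta_mx j 0) i (0 : 'I_1); rewrite -colE mxE.
Qed.

Lemma pair_norm f v : `|pair f v| <= d%:R * `|f| * `|v|.
Proof. by apply: le_trans (mulmx_norm f v); exact: mx_norm_entry. Qed.

End Pairing.

(** Bolzano-Weierstrass, with matrices flattened by [mxvec] to use the compactness of boxes of row
    vectors. Arbitrarily late terms near [S] stand for a convergent subsequence. *)
Lemma bounded_seq_cluster (R : realType) m n (u : nat -> 'M[R]_(m, n)) B :
  (forall k, `|u k| <= B) ->
  exists S : 'M[R]_(m, n), forall (e : R) N, 0 < e -> exists2 k, (N <= k)%N & `|u k - S| < e.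
Proof.
move=> uB; pose w k : 'rV[R]_(m * n) := mxvec (u k).
have cpt : compact [set v : 'rV[R]_(m * n) | forall i, `[(- B), B]%classic (v ord0 i)].
  by apply: (@rV_compact _ _ (fun=> `[(- B), B]%classic)) => _; exact: segment_compact.
have wA k : [set v : 'rV[R]_(m * n) | forall i, `[(- B), B]%classic (v ord0 i)] (w k).
  move=> i /=; rewrite in_itv /= -ler_norml.
  case/mxvec_indexP: i => i j; rewrite /w mxvecE.
  exact: le_trans (mx_norm_entry _ _ _) (uB k).
have [s [_ sclu]] := cpt (w @ \oo) _ (filterE _ wA).
exists (vec_mx s) => e N e0.
have wN : (w @ \oo) [set w k | k in [set k | (N <= k)%N]].
  by exists N => // k /= Nk; exists k.
have [_ [[k Nk <-] kb]] := sclu _ (ball s e) wN (nbhsx_ballx s e e0).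
exists k => //; move: kb; rewrite mx_norm_ball /ball_ /= => kb.
rewrite distrC; apply: le_lt_trans kb; apply: mx_norm_le => // i j.
rewrite -[u k]mxvecK -linearB /= mxE; exact: mx_norm_entry.
Qed.

(** * Cones and gauges *)

(* K is the closed cone over a properly convex domain and C the open one. *)
Record proper_cone (R : realType) (d : nat) (K C : set 'cV[R]_d) (f : 'rV[R]_d) :
    Prop := ProperCone {
  cone0 : K 0 ;
  cone_add : forall u v, K u -> K v -> K (u + v) ;
  cone_scale : forall a v, 0 <= a -> K v -> K (a *: v) ;
  cone_int : forall v, C v -> K v ;
  cone_addint : forall u v, C u -> K v -> C (u + v) ;
  cone_scaleint : forall a v, 0 < a -> C v -> C (a *: v) ;
  cone_open : forall u, C u -> exists2 e : R, 0 < e & forall v, `|v| < e -> C (u + v) ;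
  cone_closed : forall v, (forall e : R, 0 < e -> exists2 u, K u & `|u - v| < e) -> K v ;
  cone_bound : exists2 c : R, 0 < c & forall v, K v -> `|v| <= c * pair f v ;
  cone_int0 : ~ C 0 }.

(** Birkhoff's M(u/v), the least [k] with u <= k v in the order of [K]. For [u] in [K] and [v] in
    [C] the infimum is attained, see [gauge_mem]. *)
Definition gauge (R : realType) (d : nat) (K : set 'cV[R]_d) (u v : 'cV[R]_d) : R :=
  inf [set k | K (k *: v - u)].

(* By Birkhoff's formula, the Hilbert metric of the domain. *)
Definition hd (R : realType) (d : nat) (K : set 'cV[R]_d) (u v : 'cV[R]_d) : R :=
  2^-1 * ln (gauge K u v * gauge K v u).

Section Cone.
Context {R : realType} {d : nat} (K C : set 'cV[R]_d) (f : 'rV[R]_d).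
Hypothesis KC : proper_cone K C f.
Implicit Types (u v w e : 'cV[R]_d) (a k s t : R).

Lemma cone_pair_ge0 v : K v -> 0 <= pair f v.
Proof.
have [c c0 cb] := cone_bound KC => /cb /(le_trans (normr_ge0 _)).
by rewrite pmulr_rge0.
Qed.

Lemma cone_pair_gt0 v : K v -> v != 0 -> 0 < pair f v.
Proof.
have [c c0 cb] := cone_bound KC => Kv v0; have := cb _ Kv; move/lt_le_trans.
by move=> /(_ 0); rewrite normr_gt0 v0 pmulr_rgt0 // => ->.
Qed.

Lemma cone_salient v : K v -> K (- v) -> v = 0.
Proof.
move=> Kv Kv'; apply/eqP/negP => /negP v0; have := cone_pair_gt0 Kv v0.
by have := cone_pair_ge0 Kv'; rewrite pairN; lra.
Qed.

Lemma int_neq0 u : C u -> u != 0.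
Proof. by move=> Cu; apply/eqP => u0; apply: (cone_int0 KC); rewrite -u0. Qed.

Lemma int_pair_gt0 v : C v -> 0 < pair f v.
Proof. by move=> Cv; apply: cone_pair_gt0; [exact: cone_int KC _ Cv|exact: int_neq0]. Qed.

Lemma int_addl u v : K u -> C v -> C (u + v).
Proof. by move=> Ku Cv; rewrite addrC; exact: cone_addint KC _ _ _ _. Qed.

Lemma int_of_sub u e t : C e -> 0 < t -> K (u - t *: e) -> C u.
Proof.
move=> Ce t0 /int_addl /(_ (cone_scaleint KC t0 Ce)).
by rewrite subrK.
Qed.

Lemma cone_le_trans u v w : K (v - u) -> K (w - v) -> K (w - u).
Proof. by move=> h1 h2; have := cone_add KC h1 h2; rewrite addrC addrA subrK. Qed.

(** A ball of some radius [r] around [e] lies in [C]; moving from [e] by half of that radius against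
    [v] gives the constant [2 / r]. *)
Lemma int_unit e : C e -> exists2 k : R, 0 < k & forall v, K ((k * `|v|) *: e - v).
Proof.
move=> Ce; have [r r0 rb] := cone_open KC Ce; exists (2 / r); first by rewrite divr_gt0.
move=> v; have [->|v0] := eqVneq v 0.
  by rewrite normr0 mulr0 scale0r subr0; exact: cone0 KC.
have nv : 0 < `|v| by rewrite normr_gt0.
have rv : C (e + - (r / 2 / `|v|) *: v).
  apply: rb; rewrite normrZ normrN ger0_norm; last by rewrite !divr_ge0 ?ltW.
  by rewrite divfK ?gt_eqF //; lra.
rewrite (_ : _ - v = (2 / r * `|v|) *: (e + - (r / 2 / `|v|) *: v)).
  apply: (cone_scale KC); last exact: cone_int KC _ rv.
  by rewrite mulr_ge0 // divr_ge0 // ltW.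
by apply/matrixP => i j; rewrite !mxE; field; rewrite !gt_eqF.
Qed.

Lemma int_unit1 e v : C e -> exists2 k : R, 0 < k & K (k *: e - v).
Proof.
move=> Ce; have [k k0 kb] := int_unit Ce; exists (k * (`|v| + 1)).
  by rewrite mulr_gt0 // ltr_wpDl.
rewrite mulrDr mulr1 scalerDl addrAC; apply: (cone_add KC) => //.
by apply: (cone_scale KC (ltW k0)); exact: cone_int KC _ Ce.
Qed.

Lemma int_line u w : C u -> exists2 s : R, 0 < s & C (u + s *: w).
Proof.
move=> Cu; have [k k0 kb] := int_unit1 (- w) Cu; exists (2 * k)^-1.
  by rewrite invr_gt0 mulr_gt0.
apply: (int_of_sub Cu (t := 2^-1)) => //.
rewrite (_ : _ - _ = (2 * k)^-1 *: (k *: u - - w)).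
  by apply: (cone_scale KC) => //; rewrite invr_ge0 mulr_ge0 // ltW.
by apply/matrixP => i j; rewrite !mxE; field; rewrite gt_eqF.
Qed.

(** On [K] the norm is controlled by [f], and [f] is monotone for the order. *)
Lemma cone_normal : exists2 N : R, 0 < N & forall u v, K u -> K (v - u) -> `|u| <= N * `|v|.
Proof.
have [c c0 cb] := cone_bound KC; exists (c * (d%:R * `|f| + 1)).
  by rewrite mulr_gt0 // ltr_wpDl // mulr_ge0.
move=> u v Ku Kvu; apply: le_trans (cb _ Ku) _; rewrite -mulrA ler_pM2l //.
apply: (@le_trans _ _ (pair f v)).
  by have := cone_pair_ge0 Kvu; rewrite pairB subr_ge0.
apply: le_trans (ler_norm _) _; apply: le_trans (pair_norm _ _) _.
by rewrite ler_wpM2r // lerDl.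
Qed.

Lemma cone_closed_line u w t : (forall e : R, 0 < e -> exists2 s, `|s - t| < e & K (u + s *: w)) ->
  K (u + t *: w).
Proof.
move=> h; apply: (cone_closed KC) => e e0.
have [|s st Ks] := h (e / (`|w| + 1)); first by rewrite divr_gt0 // ltr_wpDl.
exists (u + s *: w) => //.
rewrite (_ : _ - _ = (s - t) *: w); last vring.
rewrite normrZ; move: st; rewrite ltr_pdivlMr ?ltr_wpDl // mulrDr mulr1.
by apply: le_lt_trans; rewrite lerDl.
Qed.

(** Were the parameters unbounded, the points [s^-1 *: (u + s *: w)] of [K] would converge to [w].
    The last point of a ray in [K] later provides vertices of half triangles, heights above an axis
    and endpoints of chords. *)
Lemma cone_ray_max u w : K u -> ~ K w ->
  exists t, [/\ 0 <= t, K (u + t *: w) & forall s, t < s -> ~ K (u + s *: w)].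
Proof.
move=> Ku Kw; pose S := [set s | 0 <= s /\ K (u + s *: w)].
have S0 : S 0 by split => //; rewrite scale0r addr0.
have bS : has_ubound S.
  apply: contrapT => nb; apply: Kw; apply: (cone_closed KC) => e e0.
  have [s [s0 Ks] sb] : exists2 s, S s & (`|u| + 1) / e < s.
    apply: contrapT => ns; apply: nb; exists ((`|u| + 1) / e) => s Ss.
    by rewrite leNgt; apply/negP => ?; apply: ns; exists s.
  have sp : 0 < s by apply: le_lt_trans sb; rewrite divr_ge0 ?ltW // ltr_wpDl.
  exists (s^-1 *: (u + s *: w)); first by apply: (cone_scale KC) => //; rewrite invr_ge0.
  rewrite scalerDr scalerA mulVf ?gt_eqF // scale1r addrK normrZ gtr0_norm ?invr_gt0 //.
  rewrite mulrC ltr_pdivrMr //; move: sb; rewrite ltr_pdivrMr // => sb.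
  by rewrite mulrC; apply: lt_trans sb; rewrite ltrDl.
have hS : has_sup S by split => //; exists 0.
exists (sup S); split.
- exact: ub_le_sup.
- apply: cone_closed_line => e e0; have [s [s0 Ks] es] := sup_adherent e0 hS.
  exists s => //; have : s <= sup S by apply: ub_le_sup.
  by move=> sS; rewrite ler0_norm ?subr_le0 //; lra.
- move=> s ss Ks; have : s <= sup S.
    by apply: ub_le_sup => //; split => //; apply: le_trans (ltW ss); exact: ub_le_sup.
  lra.
Qed.

Lemma dominating_ge0 u v k : K u -> C v -> K (k *: v - u) -> 0 <= k.
Proof.
move=> Ku Cv Kk; rewrite leNgt; apply/negP => k0.
have h : C ((- k) *: v + u).
  by apply: (cone_addint KC) => //; apply: (cone_scaleint KC) => //; lra.
have /eqP := int_neq0 h; case; apply: cone_salient; first exact: cone_int KC _ h.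
by rewrite (_ : - _ = k *: v - u) //; vring.
Qed.

Lemma gauge_has_inf u v : K u -> C v -> has_inf [set k | K (k *: v - u)].
Proof.
move=> Ku Cv; split; first by have [k k0 kb] := int_unit1 u Cv; exists k.
by exists 0 => k /=; exact: dominating_ge0.
Qed.

Lemma gauge_le u v k : K u -> C v -> K (k *: v - u) -> gauge K u v <= k.
Proof. by move=> Ku Cv Kk; apply: ge_inf => //; have [] := gauge_has_inf Ku Cv. Qed.

Lemma gauge_mem u v : K u -> C v -> K (gauge K u v *: v - u).
Proof.
move=> Ku Cv; rewrite addrC; apply: cone_closed_line => e e0.
have [k /= Kk ek] := inf_adherent e0 (gauge_has_inf Ku Cv).
exists k; last by rewrite addrC.
have := gauge_le Ku Cv Kk; rewrite -/(gauge K u v) in ek * => h.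
by rewrite ger0_norm ?subr_ge0 //; lra.
Qed.

Lemma gauge_ge u v a : K u -> C v -> (forall k, K (k *: v - u) -> a <= k) -> a <= gauge K u v.
Proof. by move=> Ku Cv; apply; exact: gauge_mem. Qed.

Lemma gauge_ge0 u v : K u -> C v -> 0 <= gauge K u v.
Proof. by move=> Ku Cv; apply: dominating_ge0 (gauge_mem Ku Cv). Qed.

Lemma gauge_gt0 u v : K u -> u != 0 -> C v -> 0 < gauge K u v.
Proof.
move=> Ku u0 Cv; rewrite lt_neqAle gauge_ge0 // andbT eq_sym; apply/eqP => g0.
have := gauge_mem Ku Cv; rewrite g0 scale0r sub0r => /(cone_salient Ku)/eqP.
exact/negP.
Qed.

Lemma gauge_trans u v w : C u -> C v -> C w ->
  gauge K u w <= gauge K u v * gauge K v w.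
Proof.
move=> Cu Cv Cw; have Ku := cone_int KC Cu; have Kv := cone_int KC Cv.
apply: gauge_le => //; apply: (@cone_le_trans _ (gauge K u v *: v)); first exact: gauge_mem.
rewrite -scalerA -scalerBr; apply: (cone_scale KC); first exact: gauge_ge0.
exact: gauge_mem.
Qed.

Lemma gaugexx u : C u -> gauge K u u = 1.
Proof.
move=> Cu; have Ku := cone_int KC Cu; apply/eqP; rewrite eq_le; apply/andP; split.
  by apply: gauge_le => //; rewrite scale1r subrr; exact: cone0 KC.
apply: gauge_ge => // k; rewrite -{2}(scale1r u) -scalerBl => h; rewrite leNgt.
apply/negP => k1; have /eqP := int_neq0 Cu; case; apply: cone_salient => //.
rewrite (_ : - u = (1 - k)^-1 *: ((k - 1) *: u)).
  by apply: (cone_scale KC) => //; rewrite invr_ge0; lra.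
rewrite scalerA -[k - 1]opprB [_ * - _]mulrN mulVf ?scaleN1r //.
by apply/eqP; lra.
Qed.

(** Together with [hd_ge] this is the usual way to estimate distances below: two dominations bound
    them from above, lower bounds on all dominations from below. *)
Lemma hd_le u v a b : C u -> C v -> K (a *: v - u) -> K (b *: u - v) ->
  hd K u v <= 2^-1 * ln (a * b).
Proof.
move=> Cu Cv Ka Kb; rewrite /hd ler_pM2l ?invr_gt0 //.
have [Ku Kv] := (cone_int KC Cu, cone_int KC Cv).
have ga := gauge_le Ku Cv Ka; have gb := gauge_le Kv Cu Kb.
have pa := gauge_gt0 Ku (int_neq0 Cu) Cv; have pb := gauge_gt0 Kv (int_neq0 Cv) Cu.
rewrite ler_ln ?posrE ?mulr_gt0 //; last 2 first.
- exact: lt_le_trans ga.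
- exact: lt_le_trans gb.
by rewrite ler_pM // ltW.
Qed.

Lemma hd_ge u v a b : C u -> C v -> 0 < a -> 0 < b -> (forall k, K (k *: v - u) -> a <= k) ->
  (forall k, K (k *: u - v) -> b <= k) -> 2^-1 * ln (a * b) <= hd K u v.
Proof.
move=> Cu Cv a0 b0 Ka Kb; rewrite /hd ler_pM2l ?invr_gt0 //.
have [Ku Kv] := (cone_int KC Cu, cone_int KC Cv).
have ga := gauge_ge Ku Cv Ka; have gb := gauge_ge Kv Cu Kb.
have pa := gauge_gt0 Ku (int_neq0 Cu) Cv; have pb := gauge_gt0 Kv (int_neq0 Cv) Cu.
by rewrite ler_ln ?posrE ?mulr_gt0 // ler_pM // ltW.
Qed.

Lemma hdC u v : hd K u v = hd K v u.
Proof. by rewrite /hd [gauge K u v * _]mulrC. Qed.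

Lemma hdxx u : C u -> hd K u u = 0.
Proof. by move=> Cu; rewrite /hd gaugexx // mulr1 ln1 mulr0. Qed.

Lemma gauge_prod_gt0 u v : C u -> C v -> 0 < gauge K u v * gauge K v u.
Proof.
move=> Cu Cv; have [Ku Kv] := (cone_int KC Cu, cone_int KC Cv).
by apply: mulr_gt0; apply: gauge_gt0 => //; exact: int_neq0.
Qed.

Lemma hd_tri u v w : C u -> C v -> C w -> hd K u w <= hd K u v + hd K v w.
Proof.
move=> Cu Cv Cw.
have [puv pvw puw] := And3 (gauge_prod_gt0 Cu Cv) (gauge_prod_gt0 Cv Cw) (gauge_prod_gt0 Cu Cw).
rewrite -mulrDr ler_pM2l ?invr_gt0 // -lnM ?posrE // ler_ln ?posrE // ?(mulr_gt0 puv) //.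
have [Ku Kv Kw] := And3 (cone_int KC Cu) (cone_int KC Cv) (cone_int KC Cw).
rewrite mulrACA [X in _ <= _ * X]mulrC.
by rewrite ler_pM // ?gauge_ge0 // gauge_trans.
Qed.

End Cone.

(** * Axes and proximality *)

Lemma expr_small (R : realType) (mu e : R) N : 0 <= mu < 1 -> 0 < e ->
  exists2 k, (N <= k)%N & mu ^+ k < e.
Proof.
move=> /andP[m0 m1] e0; have /cvg_expr : `|mu| < 1 by rewrite ger0_norm.
move=> /cvgrPdist_lt /(_ e e0) [M _ Mb]; exists (maxn M N); first exact: leq_maxr.
have := Mb (maxn M N) (leq_maxl _ _); rewrite /= sub0r normrN.
by rewrite ger0_norm // exprn_ge0.
Qed.

Section Powers.
Context {R : realType} {d : nat}.
Implicit Types (T S : 'M[R]_d) (v : 'cV[R]_d).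

Lemma mulmx_pow0 T v : T ^+ 0 *m v = v.
Proof. by rewrite expr0 mul1mx. Qed.

Lemma mulmx_powS T k v : T ^+ k.+1 *m v = T *m (T ^+ k *m v).
Proof. by rewrite exprS -mulmxE mulmxA. Qed.

Lemma mulmx_powSr T k v : T ^+ k.+1 *m v = T ^+ k *m (T *m v).
Proof. by rewrite exprSr -mulmxE mulmxA. Qed.

Lemma mulmx_powD T j k v : T ^+ (j + k) *m v = T ^+ j *m (T ^+ k *m v).
Proof. by rewrite exprD -mulmxE mulmxA. Qed.

Lemma mulmx_pow_eigen T v a k : T *m v = a *: v -> T ^+ k *m v = a ^+ k *: v.
Proof.
move=> Tv; elim: k => [|k IH]; first by rewrite mulmx_pow0 scale1r.
by rewrite mulmx_powS IH -scalemxAr Tv scalerA exprSr.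
Qed.

Lemma invmx_eigen T v a : T \in unitmx -> T *m v = a *: v -> a != 0 ->
  invmx T *m v = a^-1 *: v.
Proof.
by move=> uT Tv a0; rewrite -[in RHS](mulKmx uT v) Tv -scalemxAr scalerA mulVf // scale1r.
Qed.

Lemma mulmx_pow_fix T v k : T *m v = v -> T ^+ k *m v = v.
Proof. by move=> Tv; rewrite (@mulmx_pow_eigen _ _ 1) ?expr1n ?scale1r. Qed.

Lemma mx_eq0_norm m n (A : 'M[R]_(m, n)) : (forall e : R, 0 < e -> `|A| < e) -> A = 0.
Proof.
move=> h; apply/eqP; rewrite -normr_eq0; apply/eqP/le_anti; rewrite normr_ge0 andbT.
by apply/ler_addgt0Pl => e e0; rewrite addr0 ltW // h.
Qed.

End Powers.

(* T is a lift of a translation along the line from z to x, scaled so that its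
   attracting fixed point has eigenvalue 1. *)
Record axis (R : realType) (d : nat) (K C : set 'cV[R]_d) (T : 'M[R]_d)
    (x z : 'cV[R]_d) (mu : R) : Prop := Axis {
  axis_unit : T \in unitmx ;
  axis_int : forall v, C v -> C (T *m v) ;
  axis_intV : forall v, C v -> C (invmx T *m v) ;
  axis_fix : T *m x = x ;
  axis_eig : T *m z = mu *: z ;
  axis_mu : 0 < mu < 1 ;
  axis_K1 : K x ;
  axis_K2 : K z ;
  axis_nC1 : ~ C x ;
  axis_nC2 : ~ C z ;
  axis_C : C (x + z) }.

(** Proximality with attracting line spanned by [x]. The powers are asked to accumulate at the rank
    one projection [x *m phi], which is the form that a compactness argument yields. *)
Definition prox (R : realType) (d : nat) (T : 'M[R]_d) (x : 'cV[R]_d) (phi : 'rV[R]_d) :=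
  [/\ pair phi x = 1, phi *m T = phi &
   forall e : R, 0 < e -> exists n, `|T ^+ n - x *m phi| < e].

(* [~ C (x + y)] says that the segment from x to y is in the boundary. *)
Definition half_triangle (R : realType) (d : nat) (K C : set 'cV[R]_d) (x z y : 'cV[R]_d) :=
  [/\ K y, y <> 0, ~ C (x + y) & ~ C (z + y)].

Section Axis.
Context {R : realType} {d : nat} (K C : set 'cV[R]_d) (f : 'rV[R]_d).
Hypothesis KC : proper_cone K C f.
Implicit Types (u v w e : 'cV[R]_d) (a s t : R) (k : nat) (T : 'M[R]_d).

Lemma cone_map T e : C e -> (forall v, C v -> C (T *m v)) -> forall v, K v -> K (T *m v).
Proof.
move=> Ce TC v Kv; rewrite -[T *m v]addr0 -(scale0r (T *m e)).
apply: (cone_closed_line KC) => r r0; exists (r / 2).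
  by rewrite subr0 ger0_norm ?divr_ge0 ?ltW //; lra.
rewrite scalemxAr -mulmxDr; apply/(cone_int KC)/TC; apply: (int_addl KC) => //.
by apply: (cone_scaleint KC) => //; lra.
Qed.

Lemma cone_pow T : (forall v, K v -> K (T *m v)) -> forall k v, K v -> K (T ^+ k *m v).
Proof.
by move=> TK; elim=> [|k IH] v Kv; rewrite ?mulmx_pow0 // mulmx_powS; apply/TK/IH.
Qed.

Lemma int_pow T : (forall v, C v -> C (T *m v)) -> forall k v, C v -> C (T ^+ k *m v).
Proof.
by move=> TK; elim=> [|k IH] v Kv; rewrite ?mulmx_pow0 // mulmx_powS; apply/TK/IH.
Qed.

(** The reversed translation: the factor [mu] makes the eigenvalue at [z] equal to 1 and the one at
    [x] equal to [mu], so a statement about one end applies to the other. *)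
Lemma axis_sym T x z mu : axis K C T x z mu -> axis K C (mu *: invmx T) z x mu.
Proof.
move=> [uT TC TVC Tx Tz /andP[m0 m1] Kx Kz nx nz Cxz].
have TVz : invmx T *m z = mu^-1 *: z.
  by apply: invmx_eigen; rewrite // gt_eqF.
have TVx : invmx T *m x = x by rewrite -[in LHS]Tx mulKmx.
split => //.
- by rewrite unitmxZ ?unitfE ?gt_eqF // unitmx_inv.
- by move=> v Cv; rewrite -scalemxAl; apply: (cone_scaleint KC) => //; exact: TVC.
- move=> v Cv; rewrite invmxZ ?unitmxZ ?unitfE ?gt_eqF ?unitmx_inv // invmxK -scalemxAl.
  by apply: (cone_scaleint KC); rewrite ?invr_gt0 //; exact: TC.
- by rewrite -scalemxAl TVz scalerA divff ?scale1r // gt_eqF.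
- by rewrite -scalemxAl TVx.
- by rewrite m0.
- by rewrite addrC.
Qed.

Section OneAxis.
Variables (T : 'M[R]_d) (x z : 'cV[R]_d) (mu : R).
Hypothesis axT : axis K C T x z mu.

Let Cxz := axis_C axT.

Lemma axis_neq0 : x != 0.
Proof. by apply/eqP => x0; apply: (axis_nC2 axT); have := Cxz; rewrite x0 add0r. Qed.

Lemma axis_K v : K v -> K (T *m v).
Proof. exact: cone_map Cxz (axis_int axT) v. Qed.

(** Since T^k (x + z) = x + mu^k z <= x + z, the powers of [T] preserve the order intervals between
    - c (x + z) and c (x + z); as x + z is an order unit and the cone is normal, these are bounded
    neighbourhoods of 0. *)
Lemma axis_power_bounded : exists2 B : R, 0 < B & forall k v, `|T ^+ k *m v| <= B * `|v|.
Proof.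
have [m mp mb] := int_unit KC Cxz; have [N Np Nb] := cone_normal KC.
have N1 : 0 < 1 + 2 * N by lra.
exists (m * (1 + 2 * N) * (`|x + z| + 1)); first by rewrite !mulr_gt0 // ltr_wpDl.
move=> k v; set c := m * `|v|.
have c0 : 0 <= c by rewrite mulr_ge0 // ltW.
have /andP[mu0 mu1] := axis_mu axT.
have Te : K (c *: (x + z) - c *: (T ^+ k *m (x + z))).
  rewrite mulmxDr (mulmx_pow_fix _ (axis_fix axT)) (mulmx_pow_eigen _ (axis_eig axT)).
  rewrite -scalerBr; apply: (cone_scale KC) => //.
  rewrite (_ : _ - _ = (1 - mu ^+ k) *: z); last vring.
  by apply: (cone_scale KC); [rewrite subr_ge0 exprn_ile1 // ltW|exact: axis_K2 axT].
have h1 : K (c *: (T ^+ k *m (x + z)) - T ^+ k *m v).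
  by rewrite scalemxAr -mulmxBr; apply: (cone_pow axis_K); exact: mb.
have h2 : K (c *: (T ^+ k *m (x + z)) + T ^+ k *m v).
  rewrite scalemxAr -mulmxDr; apply: (cone_pow axis_K).
  by have := mb (- v); rewrite normrN opprK.
have k1 := cone_le_trans KC h1 Te.
have k2 : K (c *: (x + z) + T ^+ k *m v).
  veq (cone_add KC h2 Te).
have := Nb _ ((2 * c) *: (x + z)) k2; rewrite normrZ (@ger0_norm _ (2 * c)) => [h|]; last lra.
have {}h : `|c *: (x + z) + T ^+ k *m v| <= N * (2 * c * `|x + z|).
  by apply: h; veq k1.
have := ler_normB (c *: (x + z) + T ^+ k *m v) (c *: (x + z)).
rewrite (_ : _ - _ = T ^+ k *m v); last vring.
rewrite normrZ (ger0_norm c0) => h'.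
apply: le_trans h' _; apply: (@le_trans _ _ (c * (1 + 2 * N) * `|x + z|)); first lra.
rewrite /c; apply: (@le_trans _ _ (m * `|v| * (1 + 2 * N) * (`|x + z| + 1))).
  by rewrite ler_wpM2l ?lerDl // !mulr_ge0 // ltW.
by rewrite le_eqVlt; apply/orP; left; apply/eqP; ring.
Qed.

Lemma axis_power_bounded_mx : exists2 B : R, 0 < B & forall k, `|T ^+ k| <= B.
Proof.
have [B B0 Bb] := axis_power_bounded; exists B => // k.
apply: mx_norm_le_col => [|j]; first exact: ltW.
by apply: le_trans (Bb k _) _; rewrite -[leRHS]mulr1 ler_pM2l // delta_norm_le1.
Qed.

Lemma prox_of_no_half_triangle : (forall y, ~ half_triangle K C x z y) ->
  exists phi, prox T x phi.
Proof.
move=> nht; have [B B0 TB] := axis_power_bounded_mx.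
have [S Sclu] := bounded_seq_cluster TB.
have d0 : 0 <= d%:R :> R by [].
have Svec v (e : R) N : 0 < e -> exists2 k, (N <= k)%N & `|T ^+ k *m v - S *m v| < e.
  move=> e0; have [|k Nk ke] := Sclu (e / (d%:R * `|v| + 1)) N.
    by rewrite divr_gt0 // ltr_wpDl // mulr_ge0.
  by exists k => //; rewrite -mulmxBl; exact: mulmx_norm_lt.
have SK v : K v -> K (S *m v).
  move=> Kv; apply: (cone_closed KC) => e /(Svec v e 0%N)[k _ ke].
  by exists (T ^+ k *m v) => //; exact: (cone_pow axis_K).
have Sx : S *m x = x.
  apply/eqP; rewrite -subr_eq0; apply/eqP/mx_eq0_norm => e /(Svec x e 0%N)[k _].
  by rewrite (mulmx_pow_fix _ (axis_fix axT)) distrC.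
have /andP[mu0 mu1] := axis_mu axT.
have zsmall (e : R) : 0 < e -> exists N, forall k, (N <= k)%N -> `|T ^+ k *m z| < e.
  move=> e0; have [||N _ Ns] := @expr_small _ mu (e / (`|z| + 1)) 0%N.
  - by rewrite mu1 ltW.
  - by rewrite divr_gt0 // ltr_wpDl.
  exists N => k Nk; rewrite (mulmx_pow_eigen _ (axis_eig axT)) normrZ.
  rewrite ger0_norm ?exprn_ge0 ?ltW //.
  move: Ns; rewrite ltr_pdivlMr ?ltr_wpDl //; apply: le_lt_trans.
  rewrite ler_pM ?exprn_ge0 ?(ltW mu0) ?lerDl // ler_wiXn2l // ltW //.
have Sz : S *m z = 0.
  apply/mx_eq0_norm => e e0; have [|N Nb] := zsmall (e / 2); first by rewrite divr_gt0.
  have [|k Nk ke] := Svec z (e / 2) N; first by rewrite divr_gt0.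
  have := ler_normB (T ^+ k *m z) (T ^+ k *m z - S *m z).
  by rewrite subKr; have := Nb _ Nk; lra.
(* Limit points are recurrent: if T^n w and T^m w are both close to S w with m much larger than n,
   then T^(m - n) almost fixes S w. *)
have Srec w (e : R) N : 0 < e -> exists2 j, (N <= j)%N & `|T ^+ j *m (S *m w) - S *m w| < e.
  move=> e0; have e2 : 0 < e / 2 by rewrite divr_gt0.
  have [|n _ ne] := Svec w (e / 2 / (d%:R * B + 1)) 0%N.
    by rewrite divr_gt0 // ltr_wpDl // mulr_ge0 // ltW.
  have [m nm me] := Svec w (e / 2) (n + N)%N e2.
  exists (m - n)%N; first by rewrite leq_subRL // (leq_trans _ nm) ?leq_addr.
  rewrite (_ : _ - _ = T ^+ (m - n) *m (S *m w - T ^+ n *m w) + (T ^+ m *m w - S *m w)).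
    apply: le_lt_trans (ler_normD _ _) _; rewrite [e](splitr e) ltr_leD // ?ltW //.
    apply: le_lt_trans (mulmx_norm _ _) _; rewrite distrC.
    move: ne; rewrite ltr_pdivlMr ?ltr_wpDl ?mulr_ge0 // ?ltW //; apply: le_lt_trans.
    rewrite mulrDr mulr1 ler_wpDr // mulrC ler_wpM2l // ler_wpM2l //.
  rewrite mulmxBr -mulmx_powD subnK ?(leq_trans _ nm) ?leq_addr //.
  by rewrite addrA subrK.
have Sprop w' : exists c, S *m w' = c *: x.
  (* If both S w' and - S w' lie in [K], then S w' = 0; otherwise one of them is outside [K] and the
     half triangle construction applies to it. *)
  suff main w0 : ~ K (S *m w0) -> exists c, S *m w0 = c *: x.
    have [/main//|/contrapT Kw] := pselect (~ K (S *m w')).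
    have [/main[c cE]|/contrapT Kw'] := pselect (~ K (S *m (- w'))).
      by exists (- c); rewrite scaleNr -cE mulmxN opprK.
    by exists 0; rewrite scale0r; apply: (cone_salient KC) => //; rewrite -mulmxN.
  move=> nKw; set w := S *m w0; apply: contrapT => nprop.
  have [t [t0 Ky tmax]] := cone_ray_max KC (axis_K1 axT) nKw.
  apply: (nht (x + t *: w)); split => //.
  - move=> y0; have t0' : t != 0.
      by apply/eqP => t0'; move: y0; rewrite t0' scale0r addr0; apply/eqP/axis_neq0.
    apply: nprop; exists (- t^-1); apply: (scalerI t0').
    rewrite scalerA mulrN divff // scaleN1r; apply/eqP; rewrite -addr_eq0 addrC.
    exact/eqP.
  (* [S] maps the interior point x + z - r w0 to x - r w in [K]. If 2 x + t w were interior, [x]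
     would be too, being a positive combination of these two. *)
  - move=> Cxy; have [r r0 Cr] := int_line KC (- w0) Cxz.
    have Kr : K (x - r *: w).
      by move: (SK _ (cone_int KC Cr)); rewrite !mulmxDr Sx Sz addr0 -scalemxAr mulmxN scalerN.
    apply: (axis_nC1 axT).
    have p0 : 0 < r + r + t by rewrite ltr_wpDr // addr_gt0.
    rewrite (_ : x = (r + r + t)^-1 *: (r *: (x + (x + t *: w)) + t *: (x - r *: w))).
      apply: (cone_scaleint KC); rewrite ?invr_gt0 //; apply: (cone_addint KC).
        exact: (cone_scaleint KC).
      exact: (cone_scale KC).
    by apply/matrixP => i j; rewrite !mxE; field; rewrite gt_eqF.
  (* If z + y were interior, z + y + s w would be too; under suitable powers of [T] the term [z]
     dies while [w] recurs, so x + (t + s) w lies in [K], beyond the last point of the ray. *)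
  - move=> Czy; have [s s0 Cs] := int_line KC w Czy.
    apply: (tmax (t + s)); first by rewrite ltrDl.
    apply: (cone_closed KC) => e e0; have e2 : 0 < e / 2 by rewrite divr_gt0.
    have [N Nz] := zsmall _ e2.
    have [|j Nj je] := Srec w0 (e / 2 / (t + s)) N; first by rewrite divr_gt0 // ltr_wpDl.
    exists (T ^+ j *m (z + (x + t *: w) + s *: w)).
      by apply: (cone_pow axis_K); exact: cone_int KC _ Cs.
    rewrite (_ : _ - _ = T ^+ j *m z + (t + s) *: (T ^+ j *m w - w)); last first.
      rewrite !mulmxDr (mulmx_pow_fix _ (axis_fix axT)) -!scalemxAr.
      vring.
    apply: le_lt_trans (ler_normD _ _) _; rewrite [e](splitr e) ltr_leD ?Nz //.
    rewrite normrZ ger0_norm; last lra.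
    move: je; rewrite ltr_pdivlMr; last lra.
    by move=> /ltW; rewrite mulrC.
have [i xi] := exists_entry_neq0 axis_neq0.
pose phi := (x i 0)^-1 *: row i S.
have SE : S = x *m phi.
  apply/matrixP => i' j; have [c cE] := Sprop (delta_mx j 0).
  rewrite mxE big_ord1 !mxE.
  have := congr1 (fun M : 'cV_d => M i' 0) cE; have := congr1 (fun M : 'cV_d => M i 0) cE.
  by rewrite -colE !mxE => -> ->; field.
have xinj (g1 g2 : 'rV[R]_d) : x *m g1 = x *m g2 -> g1 = g2.
  move=> /matrixP g12; apply/rowP => j; have := g12 i j.
  by rewrite !mxE !big_ord1 => /(mulfI xi).
exists phi; split.
- have := congr1 (fun M : 'cV_d => M i 0) Sx.
  by rewrite SE mulmx_pair mxE => h; apply: (mulIf xi); rewrite h mul1r.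
(* [S] commutes with [T] as a limit of its powers, and T S = S since [T] fixes [x]; hence S T = S,
   which is the invariance of [phi]. *)
- apply: xinj; rewrite mulmxA -SE [RHS](_ : _ = T *m S); last by rewrite SE mulmxA (axis_fix axT).
  apply/eqP; rewrite -subr_eq0; apply/eqP/mx_eq0_norm => e e0.
  have [|k _ ke] := Sclu (e / (2 * (d%:R * `|T|) + 1)) 0%N.
    by rewrite divr_gt0 // ltr_wpDl // !mulr_ge0.
  rewrite (_ : _ - _ = (S - T ^+ k) *m T + T *m (T ^+ k - S)).
    apply: le_lt_trans (ler_normD _ _) _.
    have := mulmx_norm (S - T ^+ k) T; have := mulmx_norm T (T ^+ k - S).
    rewrite distrC => h1 h2.
    move: ke; rewrite ltr_pdivlMr ?ltr_wpDl ?mulr_ge0 //; apply: le_lt_trans.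
    rewrite mulrDr mulr1 ler_wpDr //; apply: le_trans (lerD h2 h1) _.
    by rewrite [`|T ^+ k - S|]distrC le_eqVlt; apply/orP; left; apply/eqP; ring.
  rewrite mulmxBl mulmxBr addrA; congr (_ - _); rewrite -addrA.
  by rewrite !mulmxE -exprS -exprSr addNr addr0.
- by move=> e e0; have [k _ ke] := Sclu e 0%N e0; exists k; rewrite -SE.
Qed.

End OneAxis.
End Axis.

Section ProxFacts.
Context {R : realType} {d : nat} (K C : set 'cV[R]_d) (f : 'rV[R]_d).
Hypothesis KC : proper_cone K C f.
Variables (T : 'M[R]_d) (x z : 'cV[R]_d) (mu : R) (phi : 'rV[R]_d).
Hypothesis axT : axis K C T x z mu.
Hypothesis pT : prox T x phi.
Implicit Types (u v w : 'cV[R]_d).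

Lemma prox_eig : pair phi z = 0.
Proof.
have [_ phiT _] := pT; have /andP[mu0 mu1] := axis_mu axT.
have : pair phi z = mu * pair phi z by rewrite -pairZ -(axis_eig axT) pairM phiT.
move=> h; have /eqP : (1 - mu) * pair phi z = 0 by rewrite mulrBl mul1r -h subrr.
by rewrite mulf_eq0 => /orP[/eqP|/eqP//]; lra.
Qed.

Lemma prox_inv v : pair phi (T *m v) = pair phi v.
Proof. by have [_ phiT _] := pT; rewrite pairM phiT. Qed.

Lemma prox_approx v (e : R) : 0 < e -> exists n, `|T ^+ n *m v - pair phi v *: x| < e.
Proof.
have [_ _ pl] := pT => e0; have [|n nb] := pl (e / (d%:R * `|v| + 1)).
  by rewrite divr_gt0 // ltr_wpDl // mulr_ge0.
by exists n; rewrite -mulmx_pair -mulmxBl; exact: mulmx_norm_lt.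
Qed.

Lemma prox_ge0 v : K v -> 0 <= pair phi v.
Proof.
move=> Kv; have : K (pair phi v *: x).
  apply: (cone_closed KC) => e /(prox_approx v)[n nb].
  by exists (T ^+ n *m v) => //; apply: (cone_pow (axis_K KC axT)).
move=> h; rewrite leNgt; apply/negP => p0; have /eqP := axis_neq0 axT; apply.
apply: (cone_salient KC); first exact: axis_K1 axT.
rewrite (_ : - x = (- pair phi v)^-1 *: (pair phi v *: x)).
  by apply: (cone_scale KC) => //; rewrite invr_ge0; lra.
by rewrite scalerA invrN mulNr mulVf ?scaleN1r // lt_eqF.
Qed.

(** Some [v - s *: x] with s > 0 is still in [C], and [phi] takes the value 1 at [x]. *)
Lemma prox_gt0 v : C v -> 0 < pair phi v.
Proof.
move=> Cv; have [s s0 Cs] := int_line KC (- x) Cv.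
have [phix _ _] := pT; have := prox_ge0 (cone_int KC Cs).
rewrite pairD pairZ pairN phix; lra.
Qed.

End ProxFacts.

Lemma invmx_mul (R : realType) d (A B : 'M[R]_d) :
  A \in unitmx -> B \in unitmx -> invmx (A *m B) = invmx B *m invmx A.
Proof.
move=> uA uB; have uAB : A *m B \in unitmx by rewrite unitmx_mul uA.
apply: (can_inj (mulKmx uAB)); rewrite mulmxV // -mulmxA [B *m _]mulmxA.
by rewrite mulmxV // mul1mx mulmxV.
Qed.

Lemma invmx_scale_inv (R : realType) d (T : 'M[R]_d) (mu : R) :
  T \in unitmx -> mu != 0 -> mu *: invmx (mu *: invmx T) = T.
Proof.
move=> uT mu0; rewrite invmxZ ?unitmxZ ?unitfE ?unitmx_inv // invmxK.
by rewrite scalerA divff // scale1r.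
Qed.

Lemma geometric_window (R : realType) (mu r : R) : 0 < mu < 1 -> 0 < r ->
  exists k, (mu <= mu ^+ k * r <= 1) \/ (mu <= mu ^- k * r <= 1).
Proof.
move=> /andP[mu0 mu1]; suff up s : mu <= s -> exists k, mu <= mu ^+ k * s <= 1.
  move=> r0; have [/up[k kr]|rmu] := leP mu r; first by exists k; left.
  have [|k /andP[k1 k2]] := up (mu / r); first by rewrite ler_pdivlMr //; nra.
  exists k; right; have mk : 0 < mu ^+ k by rewrite exprn_gt0.
  move: k1 k2; rewrite !mulrA ler_pdivlMr // ler_pdivrMr // mul1r => k1 k2.
  rewrite mulrC ler_pdivlMr // ler_pdivrMr // mul1r [mu * _]mulrC k2 /=.
  by rewrite -(ler_pM2l mu0) [_ * mu ^+ k]mulrC.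
move=> smu; have s0 : 0 < s by apply: lt_le_trans smu.
have ex : exists k, mu ^+ k * s <= 1.
  have [||k _ kb] := @expr_small _ mu s^-1 0%N; rewrite ?invr_gt0 ?mu1 ?ltW //.
  by exists k; rewrite -ler_pdivlMr // div1r ltW.
have [k kb kmin] := ex_minnP ex; exists k; rewrite kb andbT.
case: k kb kmin => [|k] kb kmin; first by rewrite expr0 mul1r.
have : ~~ (mu ^+ k * s <= 1) by apply/negP => /kmin; rewrite ltnn.
rewrite -ltNge exprS -mulrA => h.
by rewrite -[leLHS]mulr1 ler_pM2l // ltW.
Qed.

(** * Comparison of a vector with its projection to the axis *)

Section Contraction.
Context {R : realType} {d : nat} (K C : set 'cV[R]_d) (f : 'rV[R]_d).
Hypothesis KC : proper_cone K C f.
Implicit Types (u v w : 'cV[R]_d) (T : 'M[R]_d).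

Definition biprox T (x z : 'cV[R]_d) (mu : R) (phi psi : 'rV[R]_d) :=
  [/\ axis K C T x z mu, prox T x phi & prox (mu *: invmx T) z psi].

Lemma biprox_sym T x z mu phi psi :
  biprox T x z mu phi psi -> biprox (mu *: invmx T) z x mu psi phi.
Proof.
move=> [axT pT pT']; split => //; first exact: axis_sym KC _ _ _ _ axT.
have /andP[mu0 _] := axis_mu axT.
by rewrite invmx_scale_inv ?(axis_unit axT) // gt_eqF.
Qed.

Lemma half_triangle_sym x z y : half_triangle K C x z y -> half_triangle K C z x y.
Proof. by case. Qed.

Section OneSide.
Variables (T : 'M[R]_d) (x z : 'cV[R]_d) (mu : R) (phi psi : 'rV[R]_d).
Hypothesis bT : biprox T x z mu phi psi.

Let axT : axis K C T x z mu. Proof. by case: bT. Qed.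
Let pT : prox T x phi. Proof. by case: bT. Qed.
Let pT' : prox (mu *: invmx T) z psi. Proof. by case: bT. Qed.
Let axT' : axis K C (mu *: invmx T) z x mu. Proof. exact: axis_sym KC _ _ _ _ axT. Qed.
Let mu0 : 0 < mu. Proof. by have /andP[] := axis_mu axT. Qed.
Let phix : pair phi x = 1. Proof. by case: pT. Qed.
Let psiz : pair psi z = 1. Proof. by case: pT'. Qed.
Let phiz : pair phi z = 0. Proof. exact: prox_eig axT pT. Qed.
Let psix : pair psi x = 0. Proof. exact: prox_eig axT' pT'. Qed.

Lemma biprox_psi v : pair psi (T *m v) = mu * pair psi v.
Proof.
rewrite -(prox_inv pT') -scalemxAl pairZ mulKmx //; exact: axis_unit axT.
Qed.

(* Powers of T, of both signs, move any point to a fundamental domain where phi and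
   psi are comparable. *)
Definition shift (U : 'M[R]_d) (a : R) :=
  [/\ U \in unitmx, 0 < a, U *m x = x, U *m z = a *: z &
   [/\ forall v, C v -> C (U *m v), forall v, C v -> C (invmx U *m v),
       forall v, pair phi (U *m v) = pair phi v &
       forall v, pair psi (U *m v) = a * pair psi v]].

Lemma shift_pow k : shift (T ^+ k) (mu ^+ k).
Proof.
have uT := axis_unit axT.
elim: k => [|k [U1 a0 Ux Uz [UC UC' Up Us]]].
  rewrite !expr0; split; rewrite ?unitmx1 ?mul1mx ?scale1r //.
  by split => v; rewrite ?invmx1 ?mul1mx ?mul1r.
rewrite !exprS -mulmxE; split.
- by rewrite unitmx_mul uT.
- exact: mulr_gt0.
- by rewrite -mulmxA Ux (axis_fix axT).
- by rewrite -mulmxA Uz -scalemxAr (axis_eig axT) scalerA mulrC.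
- split => v.
  + by rewrite -mulmxA => /UC/(axis_int axT).
  + by rewrite invmx_mul // -mulmxA => Cv; apply/UC'/(axis_intV axT).
  + by rewrite -mulmxA (prox_inv pT).
  + by rewrite -mulmxA biprox_psi Us mulrA.
Qed.

Lemma shift_inv U a : shift U a -> shift (invmx U) a^-1.
Proof.
move=> [uU a0 Ux Uz [UC UC' Up Us]]; split.
- by rewrite unitmx_inv.
- by rewrite invr_gt0.
- by rewrite -[in LHS]Ux mulKmx.
- by apply: invmx_eigen; rewrite // gt_eqF.
- split => //; first by rewrite invmxK.
  + by move=> v; rewrite -Up mulKVmx.
  + by move=> v; rewrite -[in RHS](mulKVmx uU v) Us mulrA mulVf ?mul1r // gt_eqF.
Qed.

Lemma shift_window v : C v ->
  exists U a, shift U a /\ mu * pair phi v <= a * pair psi v <= pair phi v.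
Proof.
move=> Cv; have p0 := prox_gt0 KC axT pT Cv; have s0 := prox_gt0 KC axT' pT' Cv.
have [k kb] := geometric_window (axis_mu axT) (divr_gt0 s0 p0).
have win a : mu <= a * (pair psi v / pair phi v) <= 1 ->
    mu * pair phi v <= a * pair psi v <= pair phi v.
  by rewrite mulrA ler_pdivlMr // ler_pdivrMr // mul1r.
case: kb => /win h.
  by exists (T ^+ k), (mu ^+ k); split => //; exact: shift_pow.
by exists (invmx (T ^+ k)), (mu ^- k); split => //; apply/shift_inv/shift_pow.
Qed.

Hypothesis nht : forall y, ~ half_triangle K C x z y.

(** A nonzero [y] of [K] killed by both forms is the vertex of a half triangle: [psi] vanishes at x
    + y and [phi] at z + y, whereas both forms are positive on [C]. *)
Lemma biprox_pos y : K y -> y != 0 -> 0 < pair phi y + pair psi y.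
Proof.
move=> Ky y0; have p0 := prox_ge0 KC axT pT Ky; have s0 := prox_ge0 KC axT' pT' Ky.
rewrite lt_neqAle addr_ge0 // andbT eq_sym; apply/eqP => ps0.
have [pE sE] : pair phi y = 0 /\ pair psi y = 0 by split; lra.
apply: (nht (y := y)); split => //; first exact/eqP.
- by move=> /(prox_gt0 KC axT' pT'); rewrite pairD psix sE; lra.
- by move=> /(prox_gt0 KC axT pT); rewrite pairD phiz pE; lra.
Qed.

(** Compactness of the unit vectors of [K]: otherwise unit vectors with phi + psi < 1/(k + 1)
    accumulate at a vector contradicting [biprox_pos]. *)
Lemma biprox_norm : exists2 c : R, 0 < c &
  forall v, K v -> `|v| <= c * (pair phi v + pair psi v).
Proof.
apply: contrapT => nc.
have /choice[u uP] : forall k : nat, exists v, [/\ K v, `|v| = 1 &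
    k.+1%:R * (pair phi v + pair psi v) < 1].
  move=> k; apply: contrapT => nv; apply: nc; exists k.+1%:R => // v Kv.
  rewrite leNgt; apply/negP => vb.
  have ps0 : 0 <= pair phi v + pair psi v.
    by rewrite addr_ge0 // ?(prox_ge0 KC axT pT) ?(prox_ge0 KC axT' pT').
  have v0 : 0 < `|v| by apply: le_lt_trans vb; rewrite mulr_ge0.
  apply: nv; exists (`|v|^-1 *: v); split.
  - by apply: (cone_scale KC) => //; rewrite invr_ge0.
  - by rewrite normrZ ger0_norm ?invr_ge0 // mulVf ?gt_eqF.
  - by rewrite !pairZ -mulrDr mulrCA mulrC ltr_pdivrMr // mul1r.
have [|S Scl] := @bounded_seq_cluster R d 1 u 1; first by move=> k; have [_ -> _] := uP k.
have KS : K S.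
  by apply: (cone_closed KC) => e /(Scl e 0%N)[k _ kb]; exists (u k) => //; case: (uP k).
have S0 : S != 0.
  apply/eqP => S0; have [//|k _] := Scl 1 0%N; rewrite S0 subr0.
  by have [_ -> _] := uP k; rewrite ltxx.
have := biprox_pos KS S0; set e := _ + _ => e0.
pose L : R := d%:R * `|phi| + d%:R * `|psi|.
have L0 : 0 <= L by rewrite addr_ge0 // mulr_ge0.
have [N Nb] : exists N : nat, 2 / e < N%:R.
  by exists (Num.Def.archi_bound (2 / e)); rewrite archi_boundP // divr_ge0 // ltW.
have [|k Nk kb] := Scl (e / 2 / (L + 1)) N; first by rewrite !divr_gt0 // ltr_wpDl.
have [_ _ ku] := uP k.
have h1 : pair phi S + pair psi S - (pair phi (u k) + pair psi (u k)) <= L * `|u k - S|.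
  rewrite opprD addrACA -!pairB distrC /L mulrDl lerD // (le_trans (ler_norm _)) //;
  exact: pair_norm.
have h2 : L * `|u k - S| <= e / 2.
  move: kb; rewrite ltr_pdivlMr ?ltr_wpDl // => /ltW; apply: le_trans.
  by rewrite mulrC ler_wpM2l // lerDl.
have h3 : e / 2 <= pair phi (u k) + pair psi (u k) by rewrite -/e in h1; lra.
have : k.+1%:R * (e / 2) < 1.
  by apply: le_lt_trans ku; rewrite ler_wpM2l.
rewrite mulrA ltr_pdivrMr // mul1r => h4.
move: Nb; rewrite ltr_pdivrMr // => h5.
have : N%:R * e <= k.+1%:R * e by rewrite ler_wpM2r ?ler_nat ?ltW // ltnW.
lra.
Qed.

Definition axproj v := pair phi v *: x + pair psi v *: z.

(** After a shift [U] the value of [psi] is at most that of [phi], so U v has norm at most 2 c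
    phi(v) and lies below a multiple of x + z. Shifting back divides the coefficient of [z] by [a],
    and the window turns phi(v)/a into at most psi(v)/mu. *)
Lemma axproj_upper : exists2 k : R, 0 < k & forall v, C v -> K (k *: axproj v - v).
Proof.
have [c c0 cb] := biprox_norm; have [m m0 mb] := int_unit KC (axis_C axT).
have mu1 : mu < 1 by have /andP[] := axis_mu axT.
have mc : 0 < m * c by rewrite mulr_gt0.
exists (2 * (m * c) / mu); first by rewrite divr_gt0 // mulr_gt0.
move=> v Cv; have [U [a [sU /andP[w1 w2]]]] := shift_window Cv.
have [uU a0 Ux Uz [UC UC' Up Us]] := sU.
have p0 := prox_gt0 KC axT pT Cv; have s0 := prox_gt0 KC axT' pT' Cv.
have CU := UC _ Cv; have KU := cone_int KC CU.
have := cb _ KU; rewrite Up Us => h.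
have h1 : K ((2 * (m * c) * pair phi v) *: (x + z) - U *m v).
  have k1 := mb (U *m v).
  have k2 : K ((2 * (m * c) * pair phi v - m * `|U *m v|) *: (x + z)).
    apply: (cone_scale KC); last exact: cone_int KC _ (axis_C axT).
    have : m * `|U *m v| <= m * (c * (pair phi v + a * pair psi v)) by rewrite ler_pM2l.
    by rewrite mulrA => ?; nra.
  by veq (cone_add KC k1 k2).
have [_ _ _ _ [VC _ _ _]] := shift_inv sU.
have := cone_map KC (axis_C axT) VC h1.
have [_ _ Vx Vz _] := shift_inv sU.
rewrite mulmxBr -scalemxAr mulmxDr Vx Vz mulKmx // => h2.
have k3 : K (2 * (m * c) * pair phi v * (mu^-1 - 1) *: x).
  apply: (cone_scale KC); last exact: axis_K1 axT.
  by rewrite !mulr_ge0 ?subr_ge0 ?invf_ge1 // ltW.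
have k4 : K (2 * (m * c) * (pair psi v / mu - pair phi v / a) *: z).
  apply: (cone_scale KC); last exact: axis_K2 axT.
  rewrite mulr_ge0 ?subr_ge0 //; first by rewrite mulr_ge0 // ltW.
  by rewrite ler_pdivrMr // mulrAC ler_pdivlMr // mulrC [_ * a]mulrC.
have := cone_add KC (cone_add KC h2 k3) k4; rewrite /axproj.
set A := _ + _; set B := _ - v; rewrite (_ : A = B) // /A /B.
by vring.
Qed.

(** After a shift, one power T^n, the same for all [v] by [biprox_norm], brings U v within r
    phi(v)/2 of phi(v) x. The ball of radius [r] around x + z absorbs this error at the price of
    half of phi(v) x and a multiple of [z], which shifting back multiplies by mu^-n / a. *)
Lemma axproj_lower : exists2 c : R, 0 < c &
  forall v, C v -> K (v + (c * pair psi v) *: z - (2^-1 * pair phi v) *: x).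
Proof.
have [c c0 cb] := biprox_norm; have [r r0 rb] := cone_open KC (axis_C axT).
have [_ _ pl] := pT; have [|n nb] := pl (r / 2 / (d%:R * (2 * c) + 1)).
  by rewrite !divr_gt0 // ltr_wpDl // !mulr_ge0 // ltW.
have mn : 0 < mu ^+ n by rewrite exprn_gt0.
exists (mu ^- n / mu / 2); first by rewrite !divr_gt0 ?invr_gt0.
move=> v Cv; have [U [a [sU /andP[w1 w2]]]] := shift_window Cv.
have [uU a0 Ux Uz [UC UC' Up Us]] := sU.
have p0 := prox_gt0 KC axT pT Cv; have s0 := prox_gt0 KC axT' pT' Cv.
have CU := UC _ Cv; have KU := cone_int KC CU.
have h : `|U *m v| <= 2 * c * pair phi v.
  apply: le_trans (cb _ KU) _; rewrite Up Us [2 * c]mulrC -mulrA ler_pM2l //; lra.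
have h1 : `|T ^+ n *m (U *m v) - pair phi v *: x| < r / 2 * pair phi v.
  rewrite -[X in X *: x]Up -mulmx_pair -mulmxBl; apply: le_lt_trans (mulmx_norm _ _) _.
  move: nb; rewrite ltr_pdivlMr ?ltr_wpDl ?mulr_ge0 // ?ltW // -(ltr_pM2r p0).
  apply: le_lt_trans; rewrite mulrDr mulr1 mulrDl ler_wpDr ?mulr_ge0 ?(ltW p0) //.
  apply: (@le_trans _ _ (d%:R * `|T ^+ n - x *m phi| * (2 * c * pair phi v))).
    by rewrite ler_wpM2l // mulr_ge0.
  by rewrite le_eqVlt; apply/orP; left; apply/eqP; ring.
have h2 : K (T ^+ n *m (U *m v) - (2^-1 * pair phi v) *: x + (2^-1 * pair phi v) *: z).
  have /rb/(cone_int KC) k1 : `|(2 / pair phi v) *: (T ^+ n *m (U *m v) - pair phi v *: x)| < r.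
    rewrite normrZ gtr0_norm ?divr_gt0 // mulrC mulrA ltr_pdivrMr // mulrC; lra.
  have := @cone_scale _ _ _ _ _ KC (2^-1 * pair phi v) _ _ k1.
  rewrite mulr_ge0 ?(ltW p0) // => /(_ isT).
  set A := _ *: _; set B := _ + _ *: z; rewrite (_ : A = B) // /A /B.
  by vfield.
have sV := shift_inv (shift_pow n).
have [_ _ Vx Vz [VC _ _ _]] := sV; have := cone_map KC (axis_C axT) VC h2.
have un : T ^+ n \in unitmx by have [] := shift_pow n.
rewrite mulmxDr mulmxBr -!scalemxAr Vx Vz mulKmx // => h3.
have [_ _ Wx Wz [WC _ _ _]] := shift_inv sU; have := cone_map KC (axis_C axT) WC h3.
rewrite mulmxDr mulmxBr -!scalemxAr Wx Wz mulKmx // => h4.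
have k4 : K ((mu ^- n / 2 * (pair psi v / mu - pair phi v / a)) *: z).
  apply: (cone_scale KC); last exact: axis_K2 axT.
  rewrite mulr_ge0 ?subr_ge0 //; first by rewrite divr_ge0 // invr_ge0 ltW.
  by rewrite ler_pdivrMr // mulrAC ler_pdivlMr // mulrC [_ * a]mulrC.
have := cone_add KC h4 k4.
set A := _ + _; set B := _ - (_ * _) *: x; rewrite (_ : A = B) // /A /B.
by vring.
Qed.

End OneSide.

Lemma axproj_sym x z phi psi v : axproj z x psi phi v = axproj x z phi psi v.
Proof. by rewrite /axproj addrC. Qed.

End Contraction.

(** * Distances to the axis *)

Record chord (R : realType) (d : nat) (K C : set 'cV[R]_d) (x z : 'cV[R]_d) : Prop :=
  Chord {
  chord_K1 : K x ;
  chord_K2 : K z ;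
  chord_nC1 : ~ C x ;
  chord_nC2 : ~ C z ;
  chord_C : C (x + z) }.

Section Chord.
Context {R : realType} {d : nat} (K C : set 'cV[R]_d) (f : 'rV[R]_d).
Hypothesis KC : proper_cone K C f.
Implicit Types (u v w x z : 'cV[R]_d).

Lemma axis_chord T x z mu : axis K C T x z mu -> chord K C x z.
Proof. by case. Qed.

Lemma chord_sym x z : chord K C x z -> chord K C z x.
Proof. by move=> [*]; split => //; rewrite addrC. Qed.

Lemma int_comb a b u v : 0 <= a -> 0 <= b -> K u -> K v ->
  C (a *: u + b *: v) -> C (u + v).
Proof.
move=> a0 b0 Ku Kv Cab; have m0 : 0 < a + b.
  rewrite lt_neqAle addr_ge0 // andbT eq_sym; apply/eqP => ab0.
  have [aE bE] : a = 0 /\ b = 0 by split; lra.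
  by apply: (cone_int0 KC); move: Cab; rewrite aE bE !scale0r addr0.
rewrite (_ : u + v = (a + b)^-1 *: ((a *: u + b *: v) + (b *: u + a *: v))); last by vfield.
apply: (cone_scaleint KC); rewrite ?invr_gt0 //; apply: (cone_addint KC) => //.
by apply: (cone_add KC); apply: (cone_scale KC).
Qed.

Lemma chord_int x z a b : chord K C x z -> 0 < a -> 0 < b -> C (a *: x + b *: z).
Proof.
move=> [Kx Kz _ _ Cxz] a0 b0; have [ab|ba] := leP a b.
  rewrite (_ : _ + _ = a *: (x + z) + (b - a) *: z); last vring.
  apply: (cone_addint KC); first exact: (cone_scaleint KC).
  by apply: (cone_scale KC); rewrite ?subr_ge0.
rewrite (_ : _ + _ = b *: (x + z) + (a - b) *: x); last vring.
apply: (cone_addint KC); first exact: (cone_scaleint KC).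
by apply: (cone_scale KC); rewrite ?subr_ge0 // ltW.
Qed.

(** In the plane of [x] and [z] the cone is exactly a quadrant. If a < 0, adding - a (x + z) would
    make a multiple of [z] interior, which neither a positive nor a nonpositive multiple can be. *)
Lemma chord_coef_ge0 x z a b : chord K C x z -> K (a *: x + b *: z) -> 0 <= a.
Proof.
move=> [Kx Kz Cx Cz Cxz] Kab; rewrite leNgt; apply/negP => a0.
have : C ((- a) *: (x + z) + (a *: x + b *: z)).
  by apply: (cone_addint KC) => //; apply: (cone_scaleint KC) => //; lra.
rewrite [X in C X](_ : _ = (b - a) *: z); last vring.
have [ba|ba] := ltP 0 (b - a) => Cbz.
  apply: Cz; rewrite (_ : z = (b - a)^-1 *: ((b - a) *: z)).
    by apply: (cone_scaleint KC) => //; rewrite invr_gt0.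
  by rewrite scalerA mulVf ?scale1r // gt_eqF.
apply: (cone_int0 KC); rewrite (_ : 0 = (b - a) *: z + (a - b) *: z); last vring.
by apply: (cone_addint KC) => //; apply: (cone_scale KC) => //; lra.
Qed.

Lemma chord_hd_le x z a b a' b' : chord K C x z -> 0 < a -> 0 < b -> 0 < a' -> 0 < b' ->
  ln (b / a) <= ln (b' / a') ->
  hd K (a *: x + b *: z) (a' *: x + b' *: z) = 2^-1 * (ln (b' / a') - ln (b / a)).
Proof.
move=> ch a0 b0 a0' b0'; rewrite ler_ln ?posrE ?divr_gt0 // => ab.
have [Kx Kz _ _ _] := ch.
have e : ln (b' / a') - ln (b / a) = ln ((a / a') * (b' / b)).
  by rewrite -ln_div ?posrE ?divr_gt0 //; congr ln; field; rewrite !gt_eqF.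
have ab' : a' * b <= b' * a.
  by move: ab; rewrite ler_pdivrMr // mulrAC ler_pdivlMr // mulrC.
rewrite e; apply/eqP; rewrite eq_le; apply/andP; split.
- apply: (hd_le KC); [exact: chord_int|exact: chord_int| |].
  + rewrite (_ : _ - _ = (a / a' * b' - b) *: z); last by vfield.
    apply: (cone_scale KC) => //; rewrite subr_ge0 mulrAC ler_pdivlMr //; lra.
  + rewrite (_ : _ - _ = (b' / b * a - a') *: x); last by vfield.
    apply: (cone_scale KC) => //; rewrite subr_ge0 mulrAC ler_pdivlMr //; lra.
- apply: (hd_ge KC); rewrite ?divr_gt0 //; [exact: chord_int|exact: chord_int| |] => k.
  + rewrite (_ : _ - _ = (k * a' - a) *: x + (k * b' - b) *: z); last vring.
    by move=> /(chord_coef_ge0 ch); rewrite ler_pdivrMr // subr_ge0.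
  + rewrite (_ : _ - _ = (k * b - b') *: z + (k * a - a') *: x); last vring.
    by move=> /(chord_coef_ge0 (chord_sym ch)); rewrite ler_pdivrMr // subr_ge0.
Qed.

Lemma chord_hd x z a b a' b' : chord K C x z -> 0 < a -> 0 < b -> 0 < a' -> 0 < b' ->
  hd K (a *: x + b *: z) (a' *: x + b' *: z) = `|2^-1 * ln (b / a) - 2^-1 * ln (b' / a')|.
Proof.
move=> ch a0 b0 a0' b0'; rewrite -mulrBr normrM ger0_norm ?invr_ge0 //.
have [h|h] := leP (ln (b / a)) (ln (b' / a')).
  by rewrite chord_hd_le // distrC ger0_norm // subr_ge0.
by rewrite hdC chord_hd_le ?(ltW h) // ger0_norm // subr_ge0 ltW.
Qed.

End Chord.

Section AxisGeometry.
Context {R : realType} {d : nat} (K C : set 'cV[R]_d) (f : 'rV[R]_d).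
Hypothesis KC : proper_cone K C f.
Implicit Types (u v w : 'cV[R]_d) (T : 'M[R]_d).

Section OneSide.
Variables (T : 'M[R]_d) (x z : 'cV[R]_d) (mu : R) (phi psi : 'rV[R]_d) (c : R).
Hypothesis bT : biprox K C T x z mu phi psi.
Hypothesis c0 : 0 < c.
Hypothesis low1 : forall v, C v -> K (v + (c * pair psi v) *: z - (2^-1 * pair phi v) *: x).
Hypothesis low2 : forall v, C v -> K (v + (c * pair phi v) *: x - (2^-1 * pair psi v) *: z).
Local Notation P := (axproj x z phi psi).
Local Notation m v := (gauge K (P v) v).

Let axT : axis K C T x z mu. Proof. by case: bT. Qed.
Let pT : prox T x phi. Proof. by case: bT. Qed.
Let pT' : prox (mu *: invmx T) z psi. Proof. by case: bT. Qed.
Let axT' : axis K C (mu *: invmx T) z x mu. Proof. exact: axis_sym KC _ _ _ _ axT. Qed.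
Let phix : pair phi x = 1. Proof. by case: pT. Qed.
Let psiz : pair psi z = 1. Proof. by case: pT'. Qed.
Let phiz : pair phi z = 0. Proof. exact: prox_eig axT pT. Qed.
Let psix : pair psi x = 0. Proof. exact: prox_eig axT' pT'. Qed.
Let p0 v : C v -> 0 < pair phi v. Proof. exact: (prox_gt0 KC axT pT). Qed.
Let s0 v : C v -> 0 < pair psi v. Proof. exact: (prox_gt0 KC axT' pT'). Qed.

Lemma axproj_int v : C v -> C (P v).
Proof. by move=> Cv; apply: (chord_int KC (axis_chord axT)); [exact: p0|exact: s0]. Qed.

Lemma axproj_gauge_mem v : C v -> K (m v *: v - P v).
Proof. by move=> Cv; apply: (gauge_mem KC) => //; exact/(cone_int KC)/axproj_int. Qed.

Lemma axproj_gauge_ge1 v : C v -> 1 <= m v.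
Proof.
move=> Cv; have /(prox_ge0 KC axT pT) := axproj_gauge_mem Cv.
rewrite /axproj pairB pairD !pairZ phix phiz mulr1 mulr0 addr0 subr_ge0 => h.
by rewrite -(ler_pM2r (p0 Cv)) mul1r.
Qed.

(** It suffices to dominate the [z] part of the projection: by [low1] the [x] part is below 2 v + 2
    c psi(v) z, so both parts together cost 2 + (2 c + 1) j, and j >= 1. *)
Lemma axproj_gauge_le v j : C v -> K (j *: v - pair psi v *: z) -> m v <= (3 + 2 * c) * j.
Proof.
move=> Cv Kj; have j1 : 1 <= j.
  have /(prox_ge0 KC axT' pT') := Kj.
  rewrite pairB !pairZ psiz mulr1 subr_ge0 => h.
  by rewrite -(ler_pM2r (s0 Cv)) mul1r.
apply: (@le_trans _ _ (2 + (2 * c + 1) * j)); last nra.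
apply: (gauge_le KC) => //; first exact/(cone_int KC)/axproj_int.
have k1 := cone_scale KC (ler0n R 2) (low1 Cv).
have c1 : 0 <= 2 * c + 1 by rewrite addr_ge0 // mulr_ge0 // ltW.
have k2 := cone_scale KC c1 Kj.
have := cone_add KC k1 k2; set A := _ + _; set B := _ - P v.
by rewrite (_ : A = B) // /A /B /axproj; vfield.
Qed.

(** The case of [w] far from [u] towards [z]. If w <= k u, then by [low2] half of psi(w) z is below
    k u + c phi(w) x, and phi(w) x is below a multiple of [u]. So [u] dominates its own [z] part,
    and [axproj_gauge_le] bounds [k] below; the hypothesis on the ratios lets half of the main term
    absorb the error from phi(w) x. *)
Lemma gauge_far u w k : C u -> C w -> K (k *: u - w) ->
  4 * (3 + 2 * c) * c * (pair phi w / pair phi u) <= pair psi w / pair psi u ->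
  m u * (pair psi w / pair psi u) / (4 * (3 + 2 * c)) <= k.
Proof.
move=> Cu Cw Kk; set r := pair phi w / _; set s := pair psi w / _ => rs.
have [pu pw su sw] : [/\ 0 < pair phi u, 0 < pair phi w, 0 < pair psi u & 0 < pair psi w].
  by split; [exact: p0|exact: p0|exact: s0|exact: s0].
have r0 : 0 < r by rewrite divr_gt0.
have s00 : 0 < s by rewrite divr_gt0.
have k1 : K ((m u * r) *: u - pair phi w *: x).
  have := cone_scale KC (ltW r0) (axproj_gauge_mem Cu).
  have := cone_scale KC (ltW (mulr_gt0 r0 su)) (axis_K2 axT).
  move=> h1 h2; have := cone_add KC h1 h2; set A := _ + _; set B := _ - _ *: x.
  by rewrite (_ : A = B) // /A /B /axproj /r; vfield.
have k2 := cone_add KC (cone_add KC Kk (low2 Cw)) (cone_scale KC (ltW c0) k1).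
have k3 : K ((2 / s * (k + c * (m u * r))) *: u - pair psi u *: z).
  have := cone_scale KC _ k2; move=> /(_ (2 / s)); rewrite divr_ge0 ?(ltW s00) // => /(_ isT).
  set A := _ *: _; set B := _ - _ *: z.
  by rewrite (_ : A = B) // /A /B /s; vfield.
have := axproj_gauge_le Cu k3; set g := m u.
have g1 : 1 <= g by exact: axproj_gauge_ge1.
have c0' := c0; have c1 : 0 < 3 + 2 * c by lra.
rewrite [X in g <= X -> _](_ : _ = 2 * (3 + 2 * c) * (k + c * (g * r)) / s); last by field; rewrite gt_eqF.
rewrite ler_pdivlMr // => h; rewrite ler_pdivrMr; last lra.
have : g * (4 * (3 + 2 * c) * c * r) <= g * s by rewrite ler_wpM2l //; lra.
lra.
Qed.

End OneSide.
End AxisGeometry.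

Section AxisEstimates.
Context {R : realType} {d : nat} (K C : set 'cV[R]_d) (f : 'rV[R]_d).
Hypothesis KC : proper_cone K C f.
Implicit Types (u v w : 'cV[R]_d) (T : 'M[R]_d).

(** Only one of the two gauges between [u] and its projection; the other one is bounded by
    [axproj_upper], so this is the distance to the projection up to a constant. *)
Definition axis_depth x z phi psi u := 2^-1 * ln (gauge K (axproj x z phi psi u) u).
(** On the axis this is the arc length, increasing towards [z], by [chord_hd]. *)
Definition axis_coord (phi psi : 'rV[R]_d) u := 2^-1 * ln (pair psi u / pair phi u).

Lemma axis_estimates T x z mu phi psi : biprox K C T x z mu phi psi ->
  (forall y, ~ half_triangle K C x z y) ->
  exists A : R, [/\ 0 < A,
    forall u w, C u -> C w ->
      A <= `|axis_coord phi psi u - axis_coord phi psi w| ->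
      axis_depth x z phi psi u + axis_depth x z phi psi w
        + `|axis_coord phi psi u - axis_coord phi psi w| - A <= hd K u w,
    forall u, C u -> hd K u (axproj x z phi psi u) <= axis_depth x z phi psi u + A,
    forall u, C u -> 0 <= axis_depth x z phi psi u &
    forall u (a b : R), C u -> 0 < a -> 0 < b ->
      axis_depth x z phi psi u <= hd K u (a *: x + b *: z)].
Proof.
move=> bT nht; have [axT pT pT'] := bT; have ch := axis_chord axT.
have axT' := axis_sym KC axT.
have p0 v := prox_gt0 KC axT pT (v := v).
have s0 v := prox_gt0 KC axT' pT' (v := v).
have [phix _ _] := pT; have [psiz _ _] := pT'.
have phiz := prox_eig axT pT; have psix := prox_eig axT' pT'.
have [k k0 up] := axproj_upper KC bT nht.
have [c1 c1p lo1] := axproj_lower KC bT nht.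
have [c2 c2p lo2] := axproj_lower KC (biprox_sym KC bT) (fun y h => nht y (half_triangle_sym h)).
pose c := c1 + c2; have cp : 0 < c by rewrite addr_gt0.
have low1 v : C v -> K (v + (c * pair psi v) *: z - (2^-1 * pair phi v) *: x).
  move=> Cv; rewrite /c; veq (cone_add KC (lo1 _ Cv)
    (cone_scale KC (ltW (mulr_gt0 c2p (s0 _ Cv))) (chord_K2 ch))).
have low2 v : C v -> K (v + (c * pair phi v) *: x - (2^-1 * pair psi v) *: z).
  move=> Cv; rewrite /c; veq (cone_add KC (lo2 _ Cv)
    (cone_scale KC (ltW (mulr_gt0 c1p (p0 _ Cv))) (chord_K1 ch))).
have m1 u (Cu : C u) := axproj_gauge_ge1 KC bT Cu.
have m0 u (Cu : C u) : 0 < gauge K (axproj x z phi psi u) u.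
  exact: lt_le_trans ltr01 (m1 _ Cu).
pose c' := 3 + 2 * c; have cp' : 0 < c' by rewrite /c'; lra.
pose A := 1 + `|2^-1 * ln (4 * c' * c)| + `|2^-1 * ln ((4 * c') ^+ 2)| + `|2^-1 * ln k|.
have [A1 A2 A3 A4] : [/\ 2^-1 * ln (4 * c' * c) <= A, 2^-1 * ln ((4 * c') ^+ 2) <= A,
    2^-1 * ln k <= A & 0 < A].
  rewrite /A; have := ler_norm (2^-1 * ln (4 * c' * c)).
  have := ler_norm (2^-1 * ln ((4 * c') ^+ 2)); have := ler_norm (2^-1 * ln k).
  have := normr_ge0 (2^-1 * ln (4 * c' * c)); have := normr_ge0 (2^-1 * ln ((4 * c') ^+ 2)).
  have := normr_ge0 (2^-1 * ln k).
  by move: `|_| `|_| `|_| => *; split; lra.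
exists A; split => //.
- suff main u w : C u -> C w -> A <= axis_coord phi psi w - axis_coord phi psi u ->
      axis_depth x z phi psi u + axis_depth x z phi psi w
        + (axis_coord phi psi w - axis_coord phi psi u) - A <= hd K u w.
    move=> u w Cu Cw; have [h|h] := leP (axis_coord phi psi u) (axis_coord phi psi w).
      by rewrite distrC ger0_norm ?subr_ge0 // => /(main _ _ Cu Cw).
    rewrite ger0_norm ?subr_ge0 ?(ltW h) // => /(main _ _ Cw Cu).
    by rewrite hdC [X in X + _ - A]addrC.
  move=> Cu Cw; rewrite /axis_coord /axis_depth.
  have [pu pw su sw] := And4 (p0 _ Cu) (p0 _ Cw) (s0 _ Cu) (s0 _ Cw).
  pose r := pair phi w / pair phi u; pose s := pair psi w / pair psi u.
  have r0 : 0 < r by rewrite divr_gt0.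
  have s00 : 0 < s by rewrite divr_gt0.
  rewrite -mulrBr -ln_div ?posrE ?divr_gt0 //.
  rewrite (_ : _ / _ / _ = s / r); last by rewrite /s /r; field; rewrite !gt_eqF.
  move=> hA; have rs : 4 * c' * c * r <= s.
    rewrite -ler_pdivlMr // -ler_ln ?posrE ?divr_gt0 ?mulr_gt0 //.
    by have := le_trans A1 hA; rewrite ler_pM2l ?invr_gt0.
  (* The same separation seen from [w] with the ends exchanged. [gauge_far] thus applies to both
     gauges, and the product of its bounds contains both depths and s / r, the exponential of twice
     the coordinate difference. *)
  have rs' : 4 * c' * c * (pair psi u / pair psi w) <= pair phi u / pair phi w.
    rewrite (_ : _ / _ = s^-1); last by rewrite /s invf_div.
    rewrite (_ : pair phi u / _ = r^-1); last by rewrite /r invf_div.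
    by rewrite ler_pdivrMr // ler_pdivlMl // mulrC.
  have h1 j (Kj : K (j *: u - w)) := gauge_far KC bT cp low1 low2 Cu Cw Kj rs.
  have h2 j (Kj : K (j *: w - u)) := gauge_far KC (biprox_sym KC bT) cp low2 low1 Cw Cu Kj rs'.
  move: h1 h2; rewrite -/s -/c' (axproj_sym x z phi psi w).
  set mu' := gauge K _ u; set mw := gauge K _ w => h1 h2.
  have [mu0 mw0] : 0 < mu' /\ 0 < mw by split; exact: m0.
  have r1 : 0 < pair phi u / pair phi w by rewrite divr_gt0.
  have c4 : 0 < 4 * c' by rewrite mulr_gt0.
  have q1 := divr_gt0 (mulr_gt0 mw0 r1) c4; have q2 := divr_gt0 (mulr_gt0 mu0 s00) c4.
  apply: le_trans (hd_ge KC Cu Cw q1 q2 h2 h1).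
  rewrite (_ : _ * _ = mu' * mw * (s / r) / (4 * c') ^+ 2); last first.
    by rewrite /r; field; rewrite !gt_eqF.
  have : 0 < s / r by rewrite divr_gt0.
  move: (s / r) => q q0; rewrite ln_div ?posrE ?exprn_gt0 ?mulr_gt0 //.
  rewrite lnM ?posrE ?mulr_gt0 // lnM ?posrE //.
  by have := A2; lra.
- move=> u Cu; apply: le_trans (hd_le KC Cu (axproj_int KC bT Cu) (up _ Cu)
    (axproj_gauge_mem KC bT Cu)) _.
  by rewrite lnM ?posrE ?m0 // mulrDr addrC lerD2l.
- by move=> u Cu; rewrite mulr_ge0 // ?invr_ge0 // ln_ge0 // m1.
(* The projection is monotone because [phi] and [psi] are nonnegative on [K], and it fixes q = a x +
   b z. Thus u <= g q gives P u <= g q, and q is in turn dominated by [u]. *)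
- move=> u a b Cu a0 b0; have Cq := chord_int KC ch a0 b0.
  rewrite /axis_depth /hd ler_pM2l ?invr_gt0 // ler_ln ?posrE ?m0 ?gauge_prod_gt0 //; last first.
    exact: (gauge_prod_gt0 KC).
  have [Ku Kq] := (cone_int KC Cu, cone_int KC Cq).
  apply: (gauge_le KC) => //; first exact/(cone_int KC)/(axproj_int KC bT).
  have k1 := gauge_mem KC Ku Cq; have k2 := gauge_mem KC Kq Cu.
  have g0 := gauge_ge0 KC Ku Cq.
  rewrite -scalerA; apply: (cone_le_trans KC) (_ : K (_ *: _ - gauge K u (a *: x + b *: z) *: (a *: x + b *: z))); last first.
    by rewrite -scalerBr; apply: (cone_scale KC).
  move: k1 g0; set g := gauge K u _ => k1 g0.
  have /(prox_ge0 KC axT pT) := k1; have /(prox_ge0 KC axT' pT') := k1.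
  rewrite !pairB !pairZ !pairD !pairZ phix psiz phiz psix !mulr0 !mulr1 addr0 add0r => h1 h2.
  rewrite /axproj (_ : _ - _ = (g * a - pair phi u) *: x + (g * b - pair psi u) *: z); last vring.
  by apply: (cone_add KC); apply: (cone_scale KC) => //; [exact: chord_K1 ch|exact: chord_K2 ch].
Qed.

End AxisEstimates.

(** * Contracting and Morse axes *)

(* The axis L of a space Om with distance D is described by a coordinate sigma,
   a projection P to L, and the depth of a point, which is its distance to L up
   to the error A; [am_far] says that a path between points with far apart
   coordinates has to go down to L and up again. *)
Record axis_metric (R : realType) (X : Type) (Om L : set X) (D : X -> X -> R)
    (depth sigma : X -> R) (P : X -> X) (A : R) : Prop := AxisMetric {
  am_A : 0 < A ;
  am_sub : L `<=` Om ;
  am_sym : forall p q, D p q = D q p ;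
  am_tri : forall p q r, Om p -> Om q -> Om r -> D p r <= D p q + D q r ;
  am_depth : forall p, Om p -> 0 <= depth p ;
  am_far : forall p q, Om p -> Om q -> A <= `|sigma p - sigma q| ->
    depth p + depth q + `|sigma p - sigma q| - A <= D p q ;
  am_projL : forall p, Om p -> L (P p) ;
  am_sigmaP : forall p, Om p -> sigma (P p) = sigma p ;
  am_proj : forall p, Om p -> D p (P p) <= depth p + A ;
  am_lower : forall p q, Om p -> L q -> depth p <= D p q ;
  am_depthL : forall q, L q -> depth q = 0 ;
  am_isom : forall q q', L q -> L q' -> D q q' = `|sigma q - sigma q'| }.

Lemma nat_floor (R : realType) (x : R) : 0 <= x -> exists k : nat, k%:R <= x < k.+1%:R.
Proof. by move=> x0; exists (Num.truncn x); exact: truncn_itv. Qed.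

Section AxisMetric.
Context {R : realType} {X : Type} (Om L : set X) (D : X -> X -> R).
Context (depth sigma : X -> R) (P : X -> X) (A : R).
Hypothesis am : axis_metric Om L D depth sigma P A.

Let A0 : 0 < A := am_A am.

(** A coordinate gap above 2 A between the centre and a point of the ball would, by [am_far], make
    their distance exceed the one from the centre to its projection, hence the radius. The same
    argument puts a nearest point within 2 A of its source, so two such points are within 2 (2 A + 2
    A). *)
Lemma axis_metric_contracting :
  exists2 B : R, 0 < B & forall p0 r, Om p0 -> (forall q, L q -> r <= D p0 q) ->
    forall p p' q q', Om p -> Om p' -> D p0 p < r -> D p0 p' < r -> L q -> L q' ->
    (forall q'', L q'' -> D p q <= D p q'') ->
    (forall q'', L q'' -> D p' q' <= D p' q'') -> D q q' <= B.
Proof.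
have A0' := A0; exists (8 * A); first lra.
move=> p0 r Op0 rL.
suff near p q : Om p -> D p0 p < r -> L q -> (forall q'', L q'' -> D p q <= D p q'') ->
    `|sigma q - sigma p0| <= 4 * A.
  move=> p p' q q' Op Op' pr pr' Lq Lq' qm qm'; rewrite (am_isom am) //.
  have := near _ _ Op pr Lq qm; have := near _ _ Op' pr' Lq' qm'.
  by rewrite !ler_norml; lra.
move=> Op pr Lq qm.
have h1 : `|sigma p0 - sigma p| <= 2 * A.
  rewrite leNgt; apply/negP => far.
  have := am_far am Op0 Op; have := rL _ (am_projL am Op0).
  have := am_proj am Op0; have := am_depth am Op; lra.
have h2 : `|sigma p - sigma q| <= 2 * A.
  rewrite leNgt; apply/negP => far.
  have := am_far am Op (am_sub am Lq); have := qm _ (am_projL am Op).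
  have := am_proj am Op; rewrite (am_depthL am Lq); lra.
by move: h1 h2; rewrite !ler_norml; lra.
Qed.

(* Outside of a large enough neighbourhood of L, a quasi-geodesic makes little
   progress along L, so that it has to return after a bounded time. *)
Lemma axis_metric_morse (lambda e : R) : 1 <= lambda -> 0 <= e ->
  exists2 M : R, 0 < M & forall (a b : R) (c : R -> X), a <= b ->
    (forall t, a <= t <= b -> Om (c t)) ->
    (forall s t, a <= s <= b -> a <= t <= b ->
      lambda^-1 * `|s - t| - e <= D (c s) (c t) <= lambda * `|s - t| + e) ->
    L (c a) -> L (c b) -> forall t, a <= t <= b -> D (c t) (P (c t)) < M.
Proof.
move=> l1 e0; have A0' := A0; have l0 : 0 < lambda by lra.
(* An advance of [A] along L per [q] unit steps is at most half of the speed [lambda^-1] that the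
   quasi-geodesic must keep. *)
have [q q0 qA] : exists2 q : nat, (0 < q)%N & 2 * lambda * A <= q%:R.
  have [q' /andP[_ /ltW qA]] := nat_floor (mulr_ge0 (mulr_ge0 (ler0n R 2) (ltW l0)) (ltW A0)).
  by exists q'.+1.
have q1 : 1 <= q%:R :> R by rewrite ler1n.
(* Samples at most [q] steps apart are nearer than [R0], so [am_far] forbids them a coordinate gap
   above [A] as soon as one has depth above [R0]. *)
pose R0 := lambda * q%:R + e + 1.
(* Solves [lambda^-1 * (N - 1) - e <= 2 * R0 + 4 * A + N / (2 * lambda)] for the number [N] of steps
   of an excursion, using [1 <= lambda]. *)
pose N0 := 2 * lambda * (2 * R0 + 4 * A + e + 1).
have R0p : 0 < R0 by rewrite /R0; nra.
have N0p : 0 < N0 by rewrite /N0 !mulr_gt0 //; lra.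
pose M1 := lambda * N0 + e + R0 + A.
have M1p : R0 <= M1 by rewrite /M1; nra.
exists (M1 + lambda + e + 2 * A + 1); first lra.
move=> a b c ab Oc qg La Lb.
(* Samples at unit steps, the last one cut off at [b]; this costs the 1 in [ttlo] and [Dlow]. *)
pose tt k : R := Num.min (a + k%:R) b; pose cc k := c (tt k).
have tab k : a <= tt k <= b.
  by rewrite /tt ge_min lexx orbT andbT le_min ab andbT lerDl.
have Occ k : Om (cc k) by exact/Oc/tab.
have tD j k : (j <= k)%N -> `|tt j - tt k| <= (k - j)%:R.
  move=> jk; rewrite natrB // /tt; have : j%:R <= k%:R :> R by rewrite ler_nat.
  by rewrite ler_norml /Num.min; do 2![case: ifP => ?]; lra.
have Dup j k : (j <= k)%N -> D (cc j) (cc k) <= lambda * (k - j)%:R + e.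
  move=> jk; have /andP[_ h] := qg _ _ (tab j) (tab k).
  by apply: le_trans h _; rewrite lerD2r ler_pM2l // tD.
have [n nb nmin] : exists2 n : nat, b <= a + n%:R & forall k, (k < n)%N -> a + k%:R < b.
  have ex : exists n : nat, b <= a + n%:R.
    have [|k /andP[_ /ltW kb]] := @nat_floor R (b - a); first by rewrite subr_ge0.
    by exists k.+1; rewrite -lerBlDl.
  have [n nb nmin] := ex_minnP ex; exists n => // k kn.
  by rewrite ltNge; apply/negP => /nmin; rewrite leqNgt kn.
have ttlo k : (k <= n)%N -> a + k%:R - 1 <= tt k.
  case: k => [|k] kn; first by rewrite /tt le_min; lra.
  by have := nmin _ kn; rewrite /tt le_min -natr1; lra.
have tthi j : tt j <= a + j%:R by rewrite /tt ge_min lexx.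
have Dlow j k : (j <= k)%N -> (k <= n)%N -> lambda^-1 * ((k - j)%:R - 1) - e <= D (cc j) (cc k).
  move=> jk kn; have /andP[h _] := qg _ _ (tab j) (tab k).
  apply: le_trans h; rewrite lerD2r ler_pM2l ?invr_gt0 // natrB // distrC.
  by apply: le_trans (ler_norm _); have := ttlo _ kn; have := tthi j; lra.
have c0 : depth (cc 0%N) = 0.
  by rewrite /cc /tt addr0 min_l // (am_depthL am).
have cn : depth (cc n) = 0 by rewrite /cc /tt min_r // (am_depthL am).
have grid i : (i <= n)%N -> depth (cc i) <= M1.
  move=> le_in; rewrite leNgt; apply/negP => big.
  have bigR : R0 < depth (cc i) by lra.
  (* [i1] and [i2] delimit the excursion around [i] at depth above [R0]; both exist since the ends
     of the path have depth 0. *)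
  have [i1 [i1i i1R i1max]] : exists i1, [/\ (i1 < i)%N, depth (cc i1) <= R0 &
      forall k, (i1 < k <= i)%N -> R0 < depth (cc k)].
    pose Q k := (k <= i)%N && (depth (cc k) <= R0).
    have exQ : exists k, Q k by exists 0%N; rewrite /Q c0 ltW.
    have ubQ k : Q k -> (k <= i)%N by case/andP.
    have [i1 /andP[i1i i1R] i1max] := ex_maxnP exQ ubQ; exists i1; split => //.
      by rewrite ltn_neqAle i1i andbT; apply/eqP => E; move: i1R; rewrite E; lra.
    move=> k /andP[i1k ki]; rewrite ltNge; apply/negP => kR.
    by have := i1max k; rewrite /Q ki kR => /(_ isT); rewrite leqNgt i1k.
  have [i2 [i2i i2n i2R i2min]] : exists i2, [/\ (i < i2)%N, (i2 <= n)%N, depth (cc i2) <= R0 &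
      forall k, (i <= k < i2)%N -> R0 < depth (cc k)].
    pose Q k := (i <= k)%N && (depth (cc k) <= R0).
    have Qn : Q n by rewrite /Q le_in cn ltW.
    have [i2 /andP[ii2 i2R] i2min] := ex_minnP (ex_intro _ n Qn); exists i2; split => //.
    - by rewrite ltn_neqAle ii2 andbT; apply/eqP => E; move: i2R; rewrite -E; lra.
    - exact: i2min.
    - move=> k /andP[ik ki2]; rewrite ltNge; apply/negP => kR.
      by have := i2min k; rewrite /Q ik kR => /(_ isT); rewrite leqNgt ki2.
  have deep k : (i1 < k < i2)%N -> R0 < depth (cc k).
    move=> /andP[k1 k2]; have [ki|ik] := leqP k i; first by rewrite i1max // k1.
    by rewrite i2min // (ltnW ik).
  have jump j k : (i1 < j < i2)%N -> (k - j <= q)%N -> (j - k <= q)%N ->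
      `|sigma (cc j) - sigma (cc k)| <= A.
    move=> /deep dj kj jk; rewrite leNgt; apply/negP => far.
    have := am_far am (Occ j) (Occ k) (ltW far); have := am_depth am (Occ k).
    have : D (cc j) (cc k) <= lambda * q%:R + e.
      have [h|/ltnW h] := leqP j k.
        by apply: le_trans (Dup _ _ h) _; rewrite lerD2r ler_pM2l // ler_nat.
      by rewrite (am_sym am); apply: le_trans (Dup _ _ h) _; rewrite lerD2r ler_pM2l // ler_nat.
    by rewrite /R0 in dj; lra.
  have i12 : (i1.+1 < i2)%N by exact: leq_ltn_trans i1i i2i.
  have chain m : (i1.+1 + q * m <= i2)%N ->
      `|sigma (cc i1.+1) - sigma (cc (i1.+1 + q * m)%N)| <= m%:R * A.
    elim: m => [|m IH] le_m; first by rewrite muln0 addn0 subrr normr0 mul0r.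
    have lt_m : (i1.+1 + q * m < i2)%N.
      by move: le_m q0; rewrite mulnS; clear; lia.
    have := IH (ltnW lt_m); have := jump (i1.+1 + q * m)%N (i1.+1 + q * m.+1)%N.
    rewrite lt_m andbT ltn_addr // => /(_ isT).
    rewrite mulnS (addnCA i1.+1) addnK leqnn => /(_ isT).
    rewrite (_ : (_ - _)%N = 0%N) ?leq0n => [/(_ isT)|]; last by apply/eqP; rewrite subn_eq0 leq_addl.
    rewrite -natr1 mulrDl mul1r.
    set s1 := sigma _; set s2 := sigma _; set s3 := sigma _ => h2 h1.
    have := ler_distD s1 s3 s2; lra.
  pose N := (i2 - i1)%N; pose m := ((i2 - i1.+1) %/ q)%N.
  have qm : (i1.+1 + q * m <= i2)%N.
    by rewrite -(leq_subRL _ (ltnW i12)) mulnC leq_trunc_div.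
  have last : `|sigma (cc (i1.+1 + q * m)%N) - sigma (cc i2)| <= A.
    have [E|ne] := eqVneq (i1.+1 + q * m)%N i2; first by rewrite E subrr normr0 ltW.
    have := ltn_mod (i2 - i1.+1) q; have := divn_eq (i2 - i1.+1) q.
    rewrite -/m => E h; apply: jump; move: qm ne E h q0 i12; clear; lia.
  have first1 : `|sigma (cc i1) - sigma (cc i1.+1)| <= A.
    rewrite distrC; apply: jump; first by rewrite ltnSn i12.
      by rewrite -addn1 subnDA subnn.
    by rewrite subSnn.
  have NE : (i2 - i1)%N = N by [].
  have mN : m%:R * A <= N%:R / (2 * lambda).
    rewrite ler_pdivlMr; last lra.
    have : (m * q <= N)%N.
      by apply: leq_trans (leq_trunc_div _ _) _; rewrite leq_sub2l.
    rewrite -(ler_nat R) natrM => h; have : m%:R * (2 * lambda * A) <= m%:R * q%:R.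
      by rewrite ler_wpM2l.
    lra.
  have D12 : D (cc i1) (cc i2) <= 2 * R0 + 2 * A + (m%:R * A + 2 * A).
    have t1 := am_tri am (Occ i1) (am_sub am (am_projL am (Occ i1))) (Occ i2).
    have t2 := am_tri am (am_sub am (am_projL am (Occ i1)))
      (am_sub am (am_projL am (Occ i2))) (Occ i2).
    have := am_isom am (am_projL am (Occ i1)) (am_projL am (Occ i2)).
    rewrite !(am_sigmaP am) // => t3.
    have := am_proj am (Occ i1); have := am_proj am (Occ i2); rewrite (am_sym am) => p2 p1.
    have := chain m qm; move: last first1 t3.
    set s0 := sigma (cc i1); set s1 := sigma (cc i1.+1); set s2 := sigma _; set s3 := sigma _.
    have := ler_distD s1 s0 s3; have := ler_distD s2 s1 s3; lra.
  have := Dlow i1 i2 (ltnW (ltn_trans i1i i2i)) i2n; rewrite NE => lo.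
  have NN0 : N%:R <= N0.
    have : lambda^-1 * (N%:R - 1) <= 2 * R0 + 4 * A + e + N%:R / (2 * lambda) by lra.
    rewrite -(ler_pM2l l0) mulrA divff ?gt_eqF // mul1r => h.
    have E : lambda * (N%:R / (2 * lambda)) = N%:R / 2 by field; rewrite gt_eqF.
    rewrite mulrDr E in h; rewrite /N0; have : 1 <= lambda by []; lra.
  have i1le : (i1 <= i)%N by exact: ltnW.
  have d1 := Dup _ _ i1le.
  have : (i - i1)%:R <= N0.
    apply: le_trans NN0; rewrite ler_nat leq_sub2r // ltnW //.
  move=> h; have {}h : lambda * (i - i1)%:R <= lambda * N0 by rewrite ler_pM2l.
  have := am_tri am (Occ i) (Occ i1) (am_sub am (am_projL am (Occ i1))).
  have := am_lower am (Occ i) (am_projL am (Occ i1)); have := am_proj am (Occ i1).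
  rewrite (am_sym am (cc i) (cc i1)); rewrite /M1 in big; lra.
move=> t /andP[at_ tb].
have tab' : a <= t <= b by rewrite at_.
have [|k /andP[k1 k2]] := @nat_floor R (t - a); first by rewrite subr_ge0.
have ttk : tt k = a + k%:R by rewrite /tt min_l //; lra.
have kn : (k <= n)%N.
  rewrite -ltnS -(ltr_nat R); apply: le_lt_trans k1 _; rewrite -natr1; lra.
have /andP[_ d1] := qg _ _ tab' (tab k).
have d2 : `|t - tt k| <= 1 by rewrite ttk ger0_norm; move: k2; rewrite -natr1; lra.
have d3 : D (c t) (cc k) <= lambda + e.
  by apply: le_trans d1 _; rewrite lerD2r -[leRHS]mulr1 ler_pM2l.
have := am_tri am (Oc _ tab') (Occ k) (am_sub am (am_projL am (Occ k))).
have := am_lower am (Oc _ tab') (am_projL am (Occ k)); have := am_proj am (Occ k).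
have := grid _ kn; have := am_proj am (Oc _ tab'); lra.
Qed.

End AxisMetric.

(** * Half triangles *)

(* The half plane spanned by the side q of a half triangle and its opposite
   vertex: [p s rho] lies above [q s] at height rho. *)
Record half_strip (R : realType) (X : Type) (Om L : set X) (D : X -> X -> R)
    (p : R -> R -> X) (q : R -> X) : Prop := HalfStrip {
  hs_sym : forall u v, D u v = D v u ;
  hs_tri : forall u v w, Om u -> Om v -> Om w -> D u w <= D u v + D v w ;
  hs_Om : forall s rho, Om (p s rho) ;
  hs_sub : L `<=` Om ;
  hs_L : range q = L ;
  hs_isom : forall s t, D (q s) (q t) = `|s - t| ;
  hs_lip : forall s t rho rho', `|rho - rho'| <= `|s - t| ->
    D (p s rho) (p t rho') <= 3 * `|s - t| ;
  hs_low : forall s t rho rho', `|s - t| <= D (p s rho) (p t rho') ;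
  hs_lowq : forall s t rho, `|s - t| <= D (p s rho) (q t) ;
  hs_height : forall s t rho, 2^-1 * rho <= D (p s rho) (q t) ;
  hs_foot : forall s rho, D (p s rho) (q s) <= 2^-1 * ln (1 + expR rho) }.

Section HalfStrip.
Context {R : realType} {X : Type} (Om L : set X) (D : X -> X -> R).
Context (p : R -> R -> X) (q : R -> X).
Hypothesis hs : half_strip Om L D p q.

Let Lq s : L (q s).
Proof. by rewrite -(hs_L hs); exists s. Qed.

(** The path is a tent over the segment from [q (- N)] to [q N]. Its constants 3 and 1 do not depend
    on [N], but its top has height [N], hence distance at least N / 2 to L. *)
Lemma half_strip_not_morse (M : R) : exists (a b : R) (c : R -> X),
  [/\ a <= b, forall t, a <= t <= b -> Om (c t),
     forall s t, a <= s <= b -> a <= t <= b ->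
       3^-1 * `|s - t| - 1 <= D (c s) (c t) <= 3 * `|s - t| + 1,
     L (c a) /\ L (c b) &
     exists2 t, a <= t <= b & forall v, L v -> M <= D (c t) v].
Proof.
pose N := 2 * `|M| + 1; have N0 : 0 < N by rewrite /N ltr_wpDl.
pose P s := p s (N - `|s|).
(* At height 0 the point [p s 0] is not on L but within 2^-1 * ln 2 of it; replacing the two ends by
   points of L accounts for the additive constant 1. *)
pose c s := if `|s| < N then P s else q s.
have Oc t : Om (c t).
  by rewrite /c; case: ifP => _; [exact: hs_Om hs _ _|exact/(hs_sub hs)/Lq].
have Plip s t : D (P s) (P t) <= 3 * `|s - t|.
  apply: (hs_lip hs); rewrite (_ : _ - _ = `|t| - `|s|); last by ring.
  by rewrite [leRHS]distrC; exact: ler_dist_dist.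
have foot s : `|s| = N -> D (P s) (q s) <= 2^-1.
  move=> sN; apply: le_trans (hs_foot hs _ _) _; rewrite sN subrr expR0.
  rewrite -[leRHS]mulr1 ler_pM2l ?invr_gt0 // -[leRHS](expRK 1).
  rewrite ler_ln ?posrE ?expR_gt0 //; have := expR_ge1Dx (1 : R); lra.
have near s : `|s| <= N -> D (P s) (c s) <= 2^-1 \/ c s = P s.
  rewrite le_eqVlt => /orP[/eqP sN|sN]; last by right; rewrite /c sN.
  by left; rewrite /c sN ltxx; exact: foot.
have OP s : Om (P s) by exact: hs_Om hs _ _.
exists (- N), N, c; split.
- lra.
- by move=> t _; exact: Oc.
- move=> s t; rewrite -!ler_norml => sN tN; apply/andP; split.
    apply: (@le_trans _ _ `|s - t|); first by have := normr_ge0 (s - t); lra.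
    rewrite /c; case: ifP => _; case: ifP => _.
    + exact: hs_low hs _ _ _ _.
    + exact: hs_lowq hs _ _ _.
    + rewrite (hs_sym hs) distrC; exact: hs_lowq hs _ _ _.
    + by rewrite (hs_isom hs).
  have st := Plip s t; have half : 2^-1 + 2^-1 = 1 :> R by lra.
  have := hs_tri hs (Oc s) (OP s) (OP t); have := hs_tri hs (Oc s) (OP t) (Oc t).
  rewrite (hs_sym hs (c s) (P s)).
  case: (near _ sN) => [h1|->]; case: (near _ tN) => [h2|->]; lra.
- by rewrite /c normrN gtr0_norm // ltxx.
- exists 0; first by lra.
  move=> v; rewrite -(hs_L hs) => -[t _ <-].
  rewrite /c normr0 N0 /P normr0 subr0; apply: le_trans (hs_height hs _ _ _).
  by rewrite /N; have := ler_norm M; lra.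
Qed.

(** By [hs_lowq] the foot [q s] beats every [q t'] farther from [s] than [D (p s rho) (q s)], so the
    minimum over a compact interval is global. *)
Lemma half_strip_nearest s rho : exists2 t, forall t', D (p s rho) (q t) <= D (p s rho) (q t') &
  `|s - t| <= D (p s rho) (q s).
Proof.
set u := p s rho; have Ou : Om u by exact: hs_Om hs _ _.
pose F t : R := D u (q t).
have Flip t t' : `|F t - F t'| <= `|t - t'|.
  have := hs_tri hs Ou (hs_sub hs (Lq t)) (hs_sub hs (Lq t')).
  have := hs_tri hs Ou (hs_sub hs (Lq t')) (hs_sub hs (Lq t)).
  rewrite !(hs_isom hs) distrC => h1 h2; rewrite ler_norml /F; apply/andP; split; lra.
have Fc : continuous F.
  move=> t; apply/cvgrPdist_lt => e e0; near=> t'.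
  by apply: le_lt_trans (Flip _ _) _; near: t'; exact: cvgr_dist_lt.
have F0 : 0 <= F s by apply: le_trans (hs_lowq hs s s rho); rewrite normr_ge0.
have le : s - F s <= s + F s by lra.
have [t tI tmin] := EVT_min le (continuous_subspaceT Fc).
exists t; last by move: tI; rewrite in_itv /= ler_norml /F; lra.
move=> t'; have [t'I|] := boolP (t' \in `[s - F s, s + F s]); first exact: tmin.
move=> nI; apply: (@le_trans _ _ (F s)).
  by apply: tmin; rewrite in_itv /=; lra.
apply: le_trans (hs_lowq hs s t' rho).
rewrite leNgt; apply/negP => /ltW h; move: nI; rewrite in_itv /=.
by move: h; rewrite ler_norml => /andP[h1 h2]; case/negP; lra.
Unshelve. all: by end_near. Qed.

(** Points at height [rho] and spacing rho / 8 lie pairwise in a ball of radius rho / 2 that avoids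
    L. If nearest points moved by at most [B] from each one to the next, they would lag behind the
    points above them, yet they stay within [rho] of them. *)
Lemma half_strip_not_contracting (B : R) : 0 < B -> exists u0 (r : R),
  [/\ Om u0, 0 < r, forall v, L v -> r <= D u0 v &
   exists u u' v v', [/\ Om u /\ Om u', D u0 u < r /\ D u0 u' < r, L v /\ L v' ,
     (forall v'', L v'' -> D u v <= D u v'') /\ (forall v'', L v'' -> D u' v' <= D u' v'') &
     B < D v v']].
Proof.
move=> B0; apply: contrapT => contr; pose rho := 16 * B + 1.
have [rho1 rho0] : 1 <= rho /\ 0 < rho by rewrite /rho; split; lra.
pose s i : R := i%:R * (rho / 8).
have /choice[t tP] : forall i, exists t, (forall t', D (p (s i) rho) (q t) <= D (p (s i) rho) (q t'))
    /\ `|s i - t| <= D (p (s i) rho) (q (s i)).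
  by move=> i; have [t h1 h2] := half_strip_nearest (s i) rho; exists t.
have st i : `|s i - t i| <= rho.
  have [_ h] := tP i; apply: le_trans h _; apply: le_trans (hs_foot hs _ _) _.
  rewrite -(ler_pM2l (ltr0Sn R 1)) mulrA divff // mul1r -[leRHS]expRK.
  rewrite ler_ln ?posrE ?expR_gt0 // ?addr_gt0 ?expR_gt0 //.
  have : 2 <= expR rho by have := expR_ge1Dx rho; lra.
  rewrite (_ : 2 * rho = rho + rho) ?expRD; last by ring.
  by move: (expR rho) => w w2; nra.
have stepB i : `|t i - t i.+1| <= B.
  rewrite leNgt; apply/negP => far; apply: contr.
  have si : `|s i - s i.+1| = rho / 8.
    rewrite distrC /s -[i.+1%:R]natr1 mulrDl mul1r addrAC subrr add0r ger0_norm //.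
    by rewrite divr_ge0 // ltW.
  exists (p (s i) rho), (2^-1 * rho); split.
  - exact: hs_Om hs _ _.
  - lra.
  - by move=> v; rewrite -(hs_L hs) => -[t' _ <-]; exact: hs_height hs _ _ _.
  exists (p (s i) rho), (p (s i.+1) rho), (q (t i)), (q (t i.+1)); split.
  - by split; exact: hs_Om hs _ _.
  - split.
      have := hs_lip hs (s := s i) (t := s i) (rho := rho) (rho' := rho).
      by rewrite !subrr normr0 => /(_ (lexx 0)); lra.
    have := hs_lip hs (s := s i) (t := s i.+1) (rho := rho) (rho' := rho).
    by rewrite subrr normr0 si => /(_ _); lra.
  - by split.
  - by split => v; rewrite -(hs_L hs) => -[t' _ <-]; have [h _] := tP i; have [h' _] := tP i.+1.
  - by rewrite (hs_isom hs).
have chain n : `|t 0%N - t n| <= n%:R * B.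
  elim: n => [|n IH]; first by rewrite subrr normr0 mul0r.
  have := ler_distD (t n) (t 0%N) (t n.+1); have := stepB n; rewrite -natr1; lra.
(* 33 steps of rho / 8 make more than 66 B; the two feet account for at most 2 rho = 32 B + 2, and
   more than 33 B is left. *)
have := chain 33%N; have := st 0%N; have := st 33%N.
by rewrite /s mul0r /rho !ler_norml; lra.
Qed.

End HalfStrip.

Section HalfTriangle.
Context {R : realType} {d : nat} (K C : set 'cV[R]_d) (f : 'rV[R]_d).
Hypothesis KC : proper_cone K C f.
Variables (x z y : 'cV[R]_d).
Hypothesis ch : chord K C x z.
Hypothesis ht : half_triangle K C x z y.

Let Kx : K x := chord_K1 ch.
Let Kz : K z := chord_K2 ch.
Let Ky : K y. Proof. by case: ht. Qed.

(** The coordinate of [z] is a supporting form along the side from [x] to [y]: if b < 0, adding - b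
    (x + z) gives an interior point in the span of [x] and [y], and further multiples of both turn
    it into a multiple of x + y. *)
Lemma half_triangle_coef_ge0 a b c : K (a *: x + b *: z + c *: y) -> 0 <= b.
Proof.
move=> Kabc; rewrite leNgt; apply/negP => b0; have [_ _ nCxy _] := ht.
pose m := `|a - b| + `|c| + 1.
have [m0 ma mc] : [/\ 0 < m, a - b <= m & c <= m].
  rewrite /m; have := ler_norm (a - b); have := ler_norm c.
  by have := normr_ge0 (a - b); have := normr_ge0 c; split; lra.
apply: nCxy; rewrite (_ : x + y = m^-1 *: (m *: (x + y))); last first.
  by rewrite scalerA mulVf ?scale1r // gt_eqF.
apply: (cone_scaleint KC); first by rewrite invr_gt0.
rewrite (_ : m *: (x + y) = (- b) *: (x + z) + (a *: x + b *: z + c *: y)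
  + ((m - (a - b)) *: x + (m - c) *: y)); last vring.
apply: (cone_addint KC).
  apply: (cone_addint KC) => //; apply: (cone_scaleint KC); first lra.
  exact: chord_C ch.
by apply: (cone_add KC); apply: (cone_scale KC) => //; lra.
Qed.

Lemma half_triangle_int (a b c : R) : 0 < a -> 0 < b -> 0 <= c -> C (a *: x + b *: z + c *: y).
Proof.
move=> a0 b0 c0; apply: (cone_addint KC); first exact: (chord_int KC ch).
exact: (cone_scale KC).
Qed.

(** The factor 2 makes [s] the arc length along the axis, see [chord_hd]. *)
Definition strip (s h : R) : 'cV[R]_d := 1 *: x + expR (2 * s) *: z + h *: y.

Lemma strip_int s (h : R) : 0 <= h -> C (strip s h).
Proof. by move=> h0; apply: half_triangle_int; rewrite ?expR_gt0. Qed.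

Lemma strip_sub s t h h' k : k *: strip t h' - strip s h =
  (k - 1) *: x + (k * expR (2 * t) - expR (2 * s)) *: z + (k * h' - h) *: y.
Proof. by rewrite /strip; vring. Qed.

Lemma strip_gauge_ge s t h h' k : K (k *: strip t h' - strip s h) ->
  expR (2 * (s - t)) <= k.
Proof.
rewrite strip_sub => /half_triangle_coef_ge0; rewrite subr_ge0 mulrBr expRD expRN.
by rewrite ler_pdivrMr ?expR_gt0.
Qed.

End HalfTriangle.

Section HalfTriangleStrip.
Context {R : realType} {d : nat} (K C : set 'cV[R]_d) (f : 'rV[R]_d).
Hypothesis KC : proper_cone K C f.
Variables (x z y : 'cV[R]_d).
Hypothesis ch : chord K C x z.
Hypothesis ht : half_triangle K C x z y.
Local Notation strip := (strip x z y).

Let Kx : K x := chord_K1 ch.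
Let Kz : K z := chord_K2 ch.
Let Ky : K y. Proof. by case: ht. Qed.
Let Cs s (h : R) (h0 : 0 <= h) : C (strip s h) := strip_int KC ch ht s h0.

Lemma half_triangle_gauge_ge1 s t h h' k : K (k *: strip t h' - strip s h) -> 1 <= k.
Proof.
rewrite strip_sub => Kk; rewrite -subr_ge0.
apply: (half_triangle_coef_ge0 KC (chord_sym ch) (half_triangle_sym ht)
  (a := k * expR (2 * t) - expR (2 * s)) (c := k * h' - h)).
by rewrite [X in X + _]addrC.
Qed.

Lemma strip_low (s t h h' : R) : 0 <= h -> 0 <= h' -> `|s - t| <= hd K (strip s h) (strip t h').
Proof.
suff main (s' t' a b : R) : s' <= t' -> 0 <= a -> 0 <= b ->
    t' - s' <= hd K (strip s' a) (strip t' b).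
  move=> h0 h0'; have [st|/ltW ts] := leP s t.
    by rewrite distrC ger0_norm ?subr_ge0 ?main.
  by rewrite hdC ger0_norm ?subr_ge0 ?main.
move=> st a0 b0; rewrite [leLHS](_ : _ = 2^-1 * ln (1 * expR (2 * (t' - s')))); last first.
  by rewrite mul1r expRK; field.
apply: (hd_ge KC); rewrite ?expR_gt0 //; try exact: Cs.
- by move=> k; exact: half_triangle_gauge_ge1.
- by move=> k; exact: (strip_gauge_ge KC ch ht).
Qed.

Lemma half_triangle_height s : exists2 h : R, 0 < h & K (strip s 0 - h *: y) /\
  forall k, K (strip s 0 - k *: y) -> k <= h.
Proof.
have nKy : ~ K (- y).
  by move=> /(cone_salient KC Ky); case: ht.
have [h [h0 Kh hmax]] := cone_ray_max KC (cone_int KC (Cs s (lexx 0))) nKy.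
have [r r0 Cr] := int_line KC (- y) (Cs s (lexx 0)).
exists h.
  apply: lt_le_trans r0 _; rewrite leNgt; apply/negP => /hmax; apply.
  exact: cone_int KC _ Cr.
split; first by veq Kh.
move=> k Kk; rewrite leNgt; apply/negP => /hmax; apply; veq Kk.
Qed.

(** [rho] is the logarithm of the height relative to [h s], the largest [h] for which h y is below
    the axis point at [s]. As [h] is monotone and grows by a factor at most [expR (2 * (t - s))],
    this scale makes all bounds uniform in [s]. *)
Lemma half_triangle_strip : exists p, half_strip C
  (range (fun s : R => x + expR (2 * s) *: z)) (hd K) p (fun s : R => x + expR (2 * s) *: z).
Proof.
have /choice[h hP] : forall s, exists h : R, [/\ 0 < h, K (strip s 0 - h *: y) &
    forall k, K (strip s 0 - k *: y) -> k <= h].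
  by move=> s; have [h h0 [h1 h2]] := half_triangle_height s; exists h.
have h0 s : 0 < h s by have [] := hP s.
have mono s t : s <= t -> h s <= h t.
  move=> st; have [_ hs _] := hP s; have [_ _] := hP t; apply.
  rewrite (_ : _ - _ = (strip s 0 - h s *: y) + (expR (2 * t) - expR (2 * s)) *: z); last first.
    by rewrite /strip; vring.
  apply: (cone_add KC) => //; apply: (cone_scale KC) => //.
  by rewrite subr_ge0 ler_expR ler_pM2l.
have growth s t : s <= t -> h t <= expR (2 * (t - s)) * h s.
  move=> st; have [_ _ hs] := hP s; have [_ ht' _] := hP t.
  set e := expR _; have e0 : 0 < e by exact: expR_gt0.
  have e1 : 1 <= e by rewrite -expR0 ler_expR; lra.
  rewrite mulrC -ler_pdivrMr //; apply: hs.
  have ets : expR (2 * t) = e * expR (2 * s) by rewrite /e -expRD; congr expR; ring.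
  rewrite (_ : _ - _ = e^-1 *: (strip t 0 - h t *: y) + (1 - e^-1) *: x); last first.
    by rewrite /strip ets; vfield.
  apply: (cone_add KC); apply: (cone_scale KC) => //; first by rewrite invr_ge0 ltW.
  by rewrite subr_ge0 invf_le1.
have qE s : x + expR (2 * s) *: z = strip s 0 by rewrite /strip scale1r scale0r addr0.
pose p s rho := strip s (h s * expR rho).
have hp s rho : 0 < h s * expR rho by rewrite mulr_gt0 ?expR_gt0.
have Cp s rho : C (p s rho) by exact/Cs/ltW/hp.
have Cq s : C (x + expR (2 * s) *: z) by rewrite qE; exact: Cs.
exists p; split.
- by move=> u v; exact: hdC.
- exact: hd_tri KC.
- by [].
- by move=> _ [s _ <-].
- by [].
- move=> s t; rewrite -(scale1r x) (chord_hd KC) ?expR_gt0 // !divr1 !expRK.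
  by congr `|_|; field.
- suff main (s t a b : R) : s <= t -> `|a - b| <= t - s -> hd K (p s a) (p t b) <= 3 * (t - s).
    move=> s t a b; have [st|/ltW ts] := leP s t.
      by rewrite [`|s - t|]distrC (ger0_norm (_ : 0 <= t - s)) ?subr_ge0 //; exact: main.
    rewrite (ger0_norm (_ : 0 <= s - t)) ?subr_ge0 // distrC hdC; exact: main.
  move=> st; rewrite ler_norml => /andP[ab ba].
  pose u := t - s; have u0 : 0 <= u by rewrite subr_ge0.
  apply: (@le_trans _ _ (2^-1 * ln (expR u * expR (3 * u)))); last first.
    by rewrite -expRD expRK /u; lra.
  have e1 (r : R) : 0 <= r -> 1 <= expR r by move=> r0; rewrite -expR0 ler_expR.
  have comb a1 a2 a3 : 0 <= a1 -> 0 <= a2 -> 0 <= a3 -> K (a1 *: x + a2 *: z + a3 *: y).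
    move=> *; apply: (cone_add KC); last exact: (cone_scale KC).
    by apply: (cone_add KC); exact: (cone_scale KC).
  apply: (hd_le KC) => //; rewrite strip_sub; apply: comb; rewrite subr_ge0.
  + exact: e1.
  + by rewrite -expRD ler_expR /u; lra.
  + rewrite mulrCA -expRD ler_pM ?expR_ge0 ?(ltW (h0 _)) ?mono // ler_expR /u; lra.
  + by apply: e1; rewrite mulr_ge0.
  + by rewrite -expRD ler_expR /u; lra.
  + rewrite mulrCA -expRD.
    apply: (@le_trans _ _ (expR (2 * u) * h s * expR b)).
      by rewrite ler_wpM2r ?expR_ge0 // growth.
    by rewrite mulrAC mulrC -expRD ler_wpM2l ?(ltW (h0 _)) // ler_expR /u; lra.
- by move=> s t a b; apply: strip_low; exact: ltW.
- by move=> s t a; rewrite qE; apply: strip_low => //; exact: ltW.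
- move=> s t rho; have [_ _ hs] := hP t.
  (* Adding the axis point at [s] leaves only the multiple of [y] in [p s rho], which the maximality
     of [h t] bounds. *)
  have main k : K (k *: strip t 0 - p s rho) -> h s * expR rho <= k * h t.
    move=> Kk; have k1 := half_triangle_gauge_ge1 Kk.
    rewrite mulrC -ler_pdivrMl; last by lra.
    rewrite mulrC; apply: hs.
    have := cone_scale KC _ (cone_add KC Kk (cone_int KC (Cs s (lexx 0)))).
    move=> /(_ k^-1); rewrite invr_ge0 (le_trans ler01 k1) => /(_ isT).
    set A := _ *: _; set B := _ - _ *: y; rewrite (_ : A = B) // /A /B /p /strip.
    by vfield; lra.
  rewrite qE; have [st|/ltW ts] := leP s t.
    (* The factor that [growth] costs in one gauge is regained in the other one from the
       displacement along the axis. *)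
    rewrite [X in X <= _](_ : _ = 2^-1 * ln (expR (rho - 2 * (t - s)) * expR (2 * (t - s)))); last first.
      by rewrite -expRD expRK subrK.
    apply: (hd_ge KC) => //; rewrite ?expR_gt0 //; first exact: Cs.
      move=> k Kk; have := main _ Kk => h1; have h2 := growth _ _ st.
      have k1 := half_triangle_gauge_ge1 Kk.
      rewrite expRD expRN ler_pdivrMr ?expR_gt0 // -(ler_pM2l (h0 s)).
      apply: le_trans h1 _; rewrite mulrCA; apply: ler_wpM2l; first lra.
      by rewrite mulrC.
    by move=> k; exact: (strip_gauge_ge KC ch ht).
  rewrite [X in X <= _](_ : _ = 2^-1 * ln (expR rho * 1)); last by rewrite mulr1 expRK.
  apply: (hd_ge KC) => //; rewrite ?expR_gt0 //; first exact: Cs.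
    move=> k Kk; have := main _ Kk => h1; have h2 := mono _ _ ts.
    have k1 := half_triangle_gauge_ge1 Kk.
    rewrite -(ler_pM2l (h0 s)); apply: le_trans h1 _; rewrite mulrC.
    by rewrite ler_wpM2r //; lra.
  by move=> k; exact: half_triangle_gauge_ge1.
- move=> s rho; rewrite qE -[X in ln X]mulr1; have [_ hs _] := hP s.
  apply: (hd_le KC) => //; first exact: Cs.
    have := cone_scale KC (expR_ge0 rho) hs.
    by set A := _ *: _; set B := _ - _; rewrite (_ : A = B) // /A /B /p /strip; vring.
  rewrite (_ : _ - _ = (h s * expR rho) *: y); last by rewrite /p /strip; vring.
  by apply: (cone_scale KC) => //; exact: ltW.
Qed.

End HalfTriangleStrip.

(** * Eigenvalues of extreme modulus *)

Section ComplexModulus.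
Context {R : realType}.
Implicit Types (z w : R[i]).

(** The order of [R[i]] is partial; a modulus with values in [R] gives access to total order and
    real arithmetic. *)
Definition cmod z : R := complex.Re `|z|.

Lemma cmodE z : `|z| = real_complex R (cmod z).
Proof. by rewrite /cmod RRe_real // normr_real. Qed.

Lemma cmod_le z w : (`|z| <= `|w|) = (cmod z <= cmod w).
Proof. by rewrite !cmodE lecR. Qed.

Lemma cmod_lt z w : (`|z| < `|w|) = (cmod z < cmod w).
Proof. by rewrite !cmodE ltcR. Qed.

Lemma cmod_ge0 z : 0 <= cmod z.
Proof. by rewrite -ler0c -cmodE normr_ge0. Qed.

Lemma cmodM z w : cmod (z * w) = cmod z * cmod w.
Proof. by apply: complexI; rewrite rmorphM /= -!cmodE normrM. Qed.

Lemma cmodX z n : cmod (z ^+ n) = cmod z ^+ n.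
Proof. by apply: complexI; rewrite rmorphXn /= -!cmodE normrX. Qed.

Lemma cmodV z : cmod z^-1 = (cmod z)^-1.
Proof. by apply: complexI; rewrite fmorphV /= -!cmodE normfV. Qed.

Lemma cmodD z w : cmod (z + w) <= cmod z + cmod w.
Proof. by rewrite -lecR rmorphD /= -!cmodE ler_normD. Qed.

Lemma cmod0 : cmod 0 = 0.
Proof. by apply: complexI; rewrite -cmodE normr0. Qed.

Lemma cmod_real (r : R) : cmod (real_complex R r) = `|r|.
Proof.
apply: complexI; rewrite -cmodE; have [r0|r0] := leP 0 r.
  by rewrite !ger0_norm // ler0c.
by rewrite !ltr0_norm ?rmorphN // ltcR.
Qed.

Lemma cmod_eq0 z : cmod z = 0 -> z = 0.
Proof. by move=> z0; apply/eqP; rewrite -normr_eq0 cmodE z0. Qed.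

Lemma cmod_sum (I : Type) (r : seq I) (F : I -> R[i]) :
  cmod (\sum_(i <- r) F i) <= \sum_(i <- r) cmod (F i).
Proof.
elim/big_ind2 : _ => [|x y x' y' h h'|//]; first by rewrite cmod0.
by apply: le_trans (cmodD _ _) _; exact: lerD.
Qed.

Definition cnorm m n (M : 'M[R[i]]_(m, n)) : R := \sum_i \sum_j cmod (M i j).

Lemma cnorm_ge0 m n (M : 'M[R[i]]_(m, n)) : 0 <= cnorm M.
Proof. by apply: sumr_ge0 => i _; apply: sumr_ge0 => j _; exact: cmod_ge0. Qed.

Lemma cnormD m n (M N : 'M[R[i]]_(m, n)) : cnorm (M + N) <= cnorm M + cnorm N.
Proof.
rewrite -big_split; apply: ler_sum => i _; rewrite -big_split; apply: ler_sum => j _.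
by rewrite mxE; exact: cmodD.
Qed.

Lemma cnormZ m n a (M : 'M[R[i]]_(m, n)) : cnorm (a *: M) = cmod a * cnorm M.
Proof.
rewrite mulr_sumr; apply: eq_bigr => i _; rewrite mulr_sumr; apply: eq_bigr => j _.
by rewrite mxE cmodM.
Qed.

Lemma cnorm_entry m n (M : 'M[R[i]]_(m, n)) i j : cmod (M i j) <= cnorm M.
Proof.
rewrite /cnorm (bigD1 i) //= (bigD1 j) //= -addrA lerDl addr_ge0 // sumr_ge0 // => *.
  exact: cmod_ge0.
by apply: sumr_ge0 => *; exact: cmod_ge0.
Qed.

Lemma cnorm_eq0 m n (M : 'M[R[i]]_(m, n)) : cnorm M = 0 -> M = 0.
Proof.
move=> M0; apply/matrixP => i j; rewrite mxE; apply/cmod_eq0/le_anti.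
by rewrite cmod_ge0 -M0 cnorm_entry.
Qed.

Lemma cnorm_gt0 m n (M : 'M[R[i]]_(m, n)) : M != 0 -> 0 < cnorm M.
Proof.
move=> M0; rewrite lt_neqAle cnorm_ge0 andbT eq_sym; apply/eqP => /cnorm_eq0/eqP.
exact/negP.
Qed.

Lemma cnorm_mul_real d (v : 'rV[R[i]]_d) (N : 'M[R]_d) (e : R) : `|N| <= e ->
  cnorm (v *m map_mx (real_complex R) N) <= d%:R * e * cnorm v.
Proof.
move=> Ne; rewrite /cnorm !big_ord1.
apply: (@le_trans _ _ (\sum_(j < d) \sum_(i < d) cmod (v 0 i) * e)).
  apply: ler_sum => j _; rewrite mxE; apply: le_trans (cmod_sum _ _) _.
  apply: ler_sum => i _; rewrite cmodM mxE cmod_real ler_wpM2l ?cmod_ge0 //.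
  exact: le_trans (mx_norm_entry _ _ _) Ne.
by rewrite sumr_const card_ord -mulr_suml -[leLHS]mulr_natl; lra.
Qed.

End ComplexModulus.

(** The errors e' add up to at most e' / (1 - r) = e / 2, and the initial value decays
    geometrically. *)
Lemma contraction_to0 (R : realType) (b : nat -> R) (r : R) : 0 <= r < 1 ->
  (forall n, 0 <= b n) ->
  (forall e, 0 < e -> exists N, forall n, (N <= n)%N -> b n.+1 <= r * b n + e) ->
  forall e, 0 < e -> exists N, forall n, (N <= n)%N -> b n < e.
Proof.
move=> /andP[r0 r1] b0 h e e0.
pose e' := e * (1 - r) / 2; have e'0 : 0 < e' by rewrite divr_gt0 // mulr_gt0 // subr_gt0.
have [N Nb] := h _ e'0.
have geo k : b (N + k)%N <= r ^+ k * b N + e / 2.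
  elim: k => [|k IH]; first by rewrite addn0 expr0 mul1r lerDl divr_ge0 // ltW.
  rewrite addnS; apply: le_trans (Nb _ (leq_addr _ _)) _.
  have : r * b (N + k)%N <= r * (r ^+ k * b N + e / 2) by rewrite ler_wpM2l.
  rewrite exprS /e'; lra.
have [||k _ kb] := @expr_small _ r (e / 2 / (b N + 1)) 0%N; first by rewrite r0.
  by rewrite !divr_gt0 // ltr_wpDl.
exists (N + k)%N => n Nkn; rewrite -(subnKC (leq_trans (leq_addr k N) Nkn)).
apply: le_lt_trans (geo _) _.
have kn : (k <= n - N)%N by rewrite leq_subRL // (leq_trans (leq_addr k N) Nkn).
have : r ^+ (n - N) * b N <= r ^+ k * b N.
  by rewrite ler_wpM2r // ler_wiXn2l // ltW.
move: kb; rewrite ltr_pdivlMr ?ltr_wpDl // mulrDr mulr1.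
by have := exprn_ge0 k r0; lra.
Qed.

Section Criterion.
Context {R : realType} {n' : nat}.
Local Notation d := n'.+1.
Local Notation toC := (real_complex R).
Implicit Types (A T : 'M[R]_d) (x v : 'cV[R]_d) (l : R).

(** The determinant of a rank one perturbation, multiplied out so that [c] need not be invertible:
    it is applied with [c] the indeterminate. Two block factorisations of [M1] are compared. *)
Lemma det_sub_rank1 (S : comNzRingType) (u : 'cV[S]_d) (v : 'rV[S]_d) (c : S) :
  \det (c%:M - u *m v) * c = (c - (v *m u) 0 0) * c ^+ d.
Proof.
pose M1 := block_mx (1%:M : 'M[S]_1) v u (c%:M : 'M[S]_d).
pose M2 := block_mx (c%:M : 'M[S]_1) 0 (- u) (1%:M : 'M[S]_d).
pose M3 := block_mx (1%:M : 'M[S]_1) 0 (- u) (1%:M : 'M[S]_d).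
have E1 : M1 *m M2 = block_mx (c%:M - v *m u) v (0 : 'M[S]_(d, 1)) (c%:M).
  rewrite mulmx_block !mul1mx !mulmx1 !mulmx0 mulmxN add0r.
  by rewrite add0r mul_mx_scalar mul_scalar_mx scalerN subrr.
have E2 : M3 *m M1 = block_mx (1%:M) v (0 : 'M[S]_(d, 1)) (c%:M - u *m v).
  rewrite mulmx_block !mul1mx !mul0mx !addr0 mulmx1 addNr mulNmx.
  by rewrite [_ + c%:M]addrC.
have := congr1 determinant E1; have := congr1 determinant E2.
rewrite !det_mulmx det_lblock !det1 mul1r mul1r det_ublock det1 mul1r => ->.
rewrite det_lblock det_scalar1 det1 mulr1 det_ublock det_scalar => ->; congr (_ * _).
by rewrite [c%:M - _]mx11_scalar det_scalar1 !mxE eqxx mulr1n.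
Qed.

(** Deflation: B = A - l x phi has the eigenvalue 0 in place of [l]. As B x = 0, one has (X - B) (X
    - l x phi) = X (X - A), and the rank one factor has a known determinant. *)
Lemma char_poly_deflate A x (phi : 'rV[R]_d) l : A *m x = l *: x -> pair phi x = 1 ->
  'X * char_poly A = ('X - l%:P) * char_poly (A - l *: (x *m phi)).
Proof.
move=> Ax px; pose B := A - l *: (x *m phi).
have Bx : B *m x = 0 by rewrite mulmxBl -scalemxAl mulmx_pair px scale1r Ax subrr.
pose u := map_mx polyC (l *: x); pose v := map_mx polyC phi.
have E : char_poly_mx B *m ('X%:M - u *m v) = 'X *: char_poly_mx A.
  rewrite mulmxBr mul_mx_scalar /char_poly_mx mulmxA mulmxBl mul_scalar_mx.
  rewrite -(map_mxM polyC B) -scalemxAr Bx scaler0 map_mx0 subr0 -scalemxAl -scalerBr.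
  congr (_ *: _); rewrite -addrA -opprD -map_mxM -map_mxD; congr (_ - map_mx _ _).
  by rewrite /B -scalemxAl subrK.
have := congr1 determinant E; rewrite det_mulmx detZ -/(char_poly B) -/(char_poly A) => D.
have vu : (v *m u) 0 0 = l%:P.
  rewrite /u /v -map_mxM [LHS]mxE -[(phi *m _) 0 0]/(pair phi (l *: x)).
  by rewrite pairZ px mulr1.
have := det_sub_rank1 u v 'X; rewrite vu => D2.
apply: (mulfI (_ : 'X ^+ d != 0 :> {poly R})); first by rewrite expf_neq0 // polyX_eq0.
transitivity ('X * ('X ^+ d * char_poly A)); first by rewrite mulrCA.
suff aux (S : comNzRingType) (y b e p q : S) : e * y = p * q -> y * (b * e) = q * (p * b).
  by rewrite -D -/B; exact: aux D2.
by move=> h; rewrite mulrCA [y * e]mulrC h; ring.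
Qed.

(** Algebraic simplicity of the eigenvalue [l], without polynomials: c = 0 excludes a second
    eigenvector, c <> 0 a Jordan block above [x]. See [mup_simple]. *)
Definition simple_at A l x := forall v c, A *m v = l *: v + c *: x -> exists k, v = k *: x.

Lemma root_char_polyP A l :
  reflect (exists2 v : 'cV[R]_d, v != 0 & A *m v = l *: v) (root (char_poly A) l).
Proof.
have E : char_poly A^T = char_poly A.
  rewrite /char_poly /char_poly_mx -det_tr; congr (\det _).
  by rewrite linearB /= tr_scalar_mx map_trmx trmxK.
rewrite -E -eigenvalue_root_char; apply: (iffP eigenvalueP) => [[v Av v0]|[v v0 Av]].
  exists v^T; first by rewrite -(inj_eq trmx_inj) trmxK trmx0.
  by rewrite -[A]trmxK -trmx_mul Av linearZ.
exists v^T; first by rewrite -trmx_mul Av linearZ.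
by rewrite -(inj_eq trmx_inj) trmxK trmx0.
Qed.

Lemma deflate_simple A x (phi : 'rV[R]_d) l : A *m x = l *: x -> pair phi x = 1 -> l != 0 ->
  ~~ root (char_poly (A - l *: (x *m phi))) l <-> simple_at A l x.
Proof.
move=> Ax px l0; have x0 : x != 0.
  by apply/eqP => x0; move/eqP: px; rewrite x0 pair0 eq_sym oner_eq0.
have Bv v : (A - l *: (x *m phi)) *m v = A *m v - (l * pair phi v) *: x.
  by rewrite mulmxBl -scalemxAl mulmx_pair scalerA.
split => [/root_char_polyP nr v c Av|sA].
  apply: contrapT => nk; apply: nr; exists (v + (c / l - pair phi v) *: x).
    apply/eqP => h; apply: nk; exists (- (c / l - pair phi v)).
    by apply/eqP; rewrite scaleNr -addr_eq0 h.
  rewrite Bv mulmxDr -scalemxAr Ax Av pairD pairZ px mulr1.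
  by vfield.
apply/root_char_polyP => -[v v0]; rewrite Bv => h.
have [|k vk] := sA v (l * pair phi v); first by rewrite -h subrK.
move: h; rewrite vk -scalemxAr Ax pairZ px mulr1 (scalerA k l x) [k * l]mulrC subrr => /esym/eqP.
by rewrite scaler_eq0 (negbTE l0) /= -vk (negbTE v0).
Qed.

(** By deflation the multiplicity of [l] for [A] is one more than for the deflated matrix, and
    [deflate_simple] says when the latter is 0. *)
Lemma mup_simple A x l : A *m x = l *: x -> x != 0 -> l != 0 ->
  mup (toC l) (char_poly (complex_mx A)) = 1%N <-> simple_at A l x.
Proof.
move=> Ax x0 l0; have [phi px] := exists_pair1 x0.
have sE := deflate_simple Ax px l0; have D := char_poly_deflate Ax px.
move: sE D; set B := A - _ => sE D.
have lC : toC l != 0 by rewrite fmorph_eq0.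
have nz (M : 'M[R]_d) : map_poly toC (char_poly M) != 0 :> {poly R[i]}.
  by rewrite map_poly_eq0 monic_neq0 // char_poly_monic.
have : mup (toC l) (map_poly toC ('X * char_poly A)) =
    mup (toC l) (map_poly toC (('X - l%:P) * char_poly B)) by rewrite D.
rewrite !rmorphM /= map_polyX rmorphB /= map_polyX map_polyC /=.
rewrite mupMr; last by rewrite rootX.
rewrite mupM ?polyXsubC_eq0 // -['X - _]expr1 mup_XsubCX eqxx.
rewrite /complex_mx -map_char_poly => ->; rewrite -sE; split.
  move=> /eqP; rewrite add1n eqSS => /eqP h; rewrite -(fmorph_root (real_complex R)); apply/negP => r.
  by have := XsubC_dvd (toC l) (nz B); rewrite h dvdp_XsubCl /= r.
by move=> nr; rewrite mupNroot // fmorph_root.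
Qed.

Lemma simple_inv A x l : A \in unitmx -> A *m x = l *: x -> l != 0 ->
  simple_at A l x -> simple_at (invmx A) l^-1 x.
Proof.
move=> uA Ax l0 sA v c Av; apply: (sA v (- c * l ^+ 2)).
have : A *m (invmx A *m v) = v by rewrite mulKVmx.
rewrite Av mulmxDr -!scalemxAr Ax => E.
by rewrite -[in X in l *: X]E; vfield.
Qed.

Lemma prox_simple A x l phi : l != 0 -> prox (l^-1 *: A) x phi -> simple_at A l x.
Proof.
move=> l0 [px pT pl] v c Av; set T := l^-1 *: A in pT pl.
have Tv : T *m v = v + (c / l) *: x.
  by rewrite -scalemxAl Av; vfield.
have c0 : c / l = 0.
  have := congr1 (pair phi) Tv; rewrite pairM pT pairD pairZ px mulr1.
  by move=> h; lra.
have Tvv : T *m v = v by rewrite Tv c0 scale0r addr0.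
exists (pair phi v); apply/subr0_eq/mx_eq0_norm => e e0.
have [|n nb] := pl (e / (d%:R * `|v| + 1)).
  by rewrite divr_gt0 // ltr_wpDl // mulr_ge0.
by rewrite -{1}(mulmx_pow_fix n Tvv) -mulmx_pair -mulmxBl mulmx_norm_lt.
Qed.

Lemma row_pow (S : comNzRingType) (M : 'M[S]_d) (v : 'rV[S]_d) a n :
  v *m M = a *: v -> v *m M ^+ n = a ^+ n *: v.
Proof.
move=> vM; elim: n => [|n IH]; first by rewrite !expr0 mulmx1 scale1r.
by rewrite exprS -mulmxE mulmxA vM -scalemxAl IH scalerA exprS.
Qed.

Lemma eig_scale A l (v : 'rV[R[i]]_d) mu : l != 0 -> v *m complex_mx A = mu *: v ->
  v *m complex_mx (l^-1 *: A) = (mu / toC l) *: v.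
Proof.
move=> l0 vA; rewrite /complex_mx map_mxZ -scalemxAr [v *m _]vA scalerA.
by rewrite fmorphV mulrC.
Qed.

(** A left eigenvector [v] for [mu] kills [x], so v T^n = v (T^n - x phi). Once the difference is
    below 1 / (2 d), the n-th power of |mu / l| is at most 1/2. *)
Lemma prox_bound A x l phi : l != 0 -> A *m x = l *: x -> prox (l^-1 *: A) x phi ->
  forall mu, eigenvalue (complex_mx A) mu -> mu != toC l -> `|mu| < `|toC l|.
Proof.
move=> l0 Ax [px pT pl] mu /eigenvalueP[v vA v0] mul; set T := l^-1 *: A in pT pl.
have lC : toC l != 0 by rewrite fmorph_eq0.
have vT := eig_scale l0 vA; rewrite -/T in vT; set nu := mu / toC l in vT.
have nu1 : nu != 1 by apply: contra_neq mul => /(congr1 ( *%R^~ (toC l))); rewrite divfK // mul1r.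
have Tx : T *m x = x by rewrite -scalemxAl Ax scalerA mulVf // scale1r.
have vx : v *m map_mx toC x = 0.
  have : v *m complex_mx T *m map_mx toC x = v *m map_mx toC x.
    by rewrite -mulmxA -map_mxM Tx.
  rewrite vT -scalemxAl => /eqP; rewrite -subr_eq0 -{2}[v *m _]scale1r -scalerBl.
  by rewrite scaler_eq0 subr_eq0 (negbTE nu1) => /eqP.
have d0 : 0 < d%:R :> R by rewrite ltr0Sn.
have [|n nb] := pl (2 * d%:R)^-1; first by rewrite invr_gt0 mulr_gt0.
have := cnorm_mul_real v (ltW nb).
rewrite map_mxB map_mxM mulmxBr mulmxA vx mul0mx subr0 rmorphXn /= (row_pow _ vT) cnormZ cmodX.
rewrite (_ : d%:R * _ = 2^-1); last by field; rewrite gt_eqF.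
rewrite ler_pM2r ?cnorm_gt0 // => h.
have : cmod nu < 1.
  rewrite ltNge; apply/negP => h1; have := exprn_ege1 n h1; lra.
rewrite cmodM cmodV ltr_pdivrMr ?mul1r -?cmod_lt //.
rewrite lt_neqAle cmod_ge0 andbT eq_sym; apply/eqP => /cmod_eq0/eqP; exact/negP.
Qed.

Lemma prox_unique_max A x l phi : l != 0 -> x != 0 -> A *m x = l *: x ->
  prox (l^-1 *: A) x phi -> unique_max_modulus A.
Proof.
move=> l0 x0 Ax pA; exists (toC l); last exact: prox_bound pA.
by apply/(mup_simple Ax x0 l0); exact: prox_simple pA.
Qed.

Lemma power_bounded_eig A l (B : R) : l != 0 -> (forall n, `|(l^-1 *: A) ^+ n| <= B) ->
  forall mu, eigenvalue (complex_mx A) mu -> `|mu| <= `|toC l|.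
Proof.
move=> l0 Bb mu /eigenvalueP[v vA v0]; rewrite cmod_le.
have vT := eig_scale l0 vA; set nu := mu / toC l in vT.
have l0' : 0 < cmod (toC l).
  rewrite lt_neqAle cmod_ge0 andbT eq_sym; apply/eqP => /cmod_eq0/eqP.
  by rewrite fmorph_eq0; exact/negP.
rewrite -[leRHS]mul1r -ler_pdivrMr // -cmodV -cmodM -/nu leNgt; apply/negP => nu1.
have B0 : 0 <= d%:R * B by rewrite mulr_ge0 // (le_trans _ (Bb 0%N)).
have [||k _ kb] := @expr_small _ (cmod nu)^-1 (d%:R * B + 1)^-1 0%N.
- by rewrite invr_ge0 cmod_ge0 invf_lt1 // (lt_trans ltr01).
- by rewrite invr_gt0 ltr_wpDl.
have := cnorm_mul_real v (Bb k).
rewrite rmorphXn /= (row_pow _ vT) cnormZ cmodX ler_pM2r ?cnorm_gt0 // => h.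
move: kb; rewrite exprVn ltf_pV2 ?posrE ?ltr_wpDl // ?exprn_gt0 ?(lt_trans ltr01) //; lra.
Qed.

Lemma horner_eigen A x l (q : {poly R}) : A *m x = l *: x -> horner_mx A q *m x = q.[l] *: x.
Proof.
move=> Ax; elim/poly_ind: q => [|q c IH]; first by rewrite rmorph0 mul0mx horner0 scale0r.
rewrite rmorphD rmorphM /= horner_mx_X horner_mx_C mulmxDl -mulmxE -mulmxA Ax -scalemxAr IH.
by rewrite mul_scalar_mx !hornerE scalerA scalerDl mulrC.
Qed.

(** Induction on the roots: the induction hypothesis applies to (M - mu) u, so the scaled norms
    satisfy [b n.+1 <= |mu / l| * b n] up to a vanishing error. *)
Lemma factor_decay (M : 'M[R[i]]_d) (l : R[i]) (s : seq R[i]) (u : 'cV[R[i]]_d) : l != 0 ->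
  (forall mu, mu \in s -> `|mu| < `|l|) ->
  horner_mx M (\prod_(mu <- s) ('X - mu%:P)) *m u = 0 ->
  forall e : R, 0 < e -> exists N, forall n, (N <= n)%N -> cnorm (l ^- n *: (M ^+ n *m u)) < e.
Proof.
move=> l0; elim: s u => [|mu s IH] u small.
  rewrite big_nil rmorph1 mul1mx => -> e e0; exists 0%N => n _.
  by rewrite mulmx0 scaler0 /cnorm big1 // => i _; rewrite big1 // => j _; rewrite mxE cmod0.
rewrite big_cons mulrC rmorphM /= -mulmxE -mulmxA => h.
have cl : 0 < cmod l.
  by rewrite lt_neqAle cmod_ge0 andbT eq_sym; apply/eqP => /cmod_eq0/eqP; exact/negP.
have {}IH := IH _ (fun m ms => small m (mem_behead (s := mu :: s) ms)) h.
apply: (contraction_to0 (r := cmod (mu / l))).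
- rewrite cmod_ge0 cmodM cmodV ltr_pdivrMr // mul1r -cmod_lt; apply: small.
  exact: mem_head.
- by move=> n; exact: cnorm_ge0.
- move=> e e0; have [|N Nb] := IH (e * cmod l); first by rewrite mulr_gt0.
  exists N => n Nn; have := Nb _ Nn.
  rewrite rmorphB /= horner_mx_X horner_mx_C mulmxBl mul_scalar_mx.
  set a := M ^+ n *m u; rewrite mulmxBr -scalemxAr -/a mulmxA mulmxE -exprSr => hn.
  rewrite (_ : l ^- n.+1 *: _ = (mu / l) *: (l ^- n *: a)
      + l^-1 *: (l ^- n *: (M ^+ n.+1 *m u - mu *: a))); last first.
    apply/matrixP => i j; rewrite !linmxE [l ^+ n.+1]exprS; field.
    by rewrite l0 expf_neq0.
  apply: le_trans (cnormD _ _) _; rewrite cnormZ lerD2l cnormZ cmodV ltW //.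
  by rewrite mulrC ltr_pdivrMr.
Qed.

(** Let q be the characteristic polynomial divided by X - l. By Cayley-Hamilton q(A) maps into the
    eigenline of [x], so q(A) / q(l) is the spectral projection x phi. It kills v - phi(v) x, on
    which [factor_decay] applies because all roots of q have smaller modulus. *)
Lemma prox_of_dominant A x l : l != 0 -> x != 0 -> A *m x = l *: x -> simple_at A l x ->
  (forall mu, eigenvalue (complex_mx A) mu -> mu != toC l -> `|mu| < `|toC l|) ->
  exists phi, prox (l^-1 *: A) x phi.
Proof.
move=> l0 x0 Ax sA dom; have lC : toC l != 0 by rewrite fmorph_eq0.
have mup1 := (mup_simple Ax x0 l0).2 sA.
have r1 : root (char_poly A) l by apply/root_char_polyP; exists x.
have [q qE] := factor_theorem _ _ r1; rewrite mulrC in qE.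
have pE : char_poly (complex_mx A) = ('X - (toC l)%:P) * map_poly toC q.
  by rewrite /complex_mx -map_char_poly qE rmorphM rmorphB /= map_polyX map_polyC.
have qn0 : map_poly toC q != 0.
  by apply/eqP => q0; have := char_poly_monic (complex_mx A);
     rewrite pE q0 mulr0 monicE lead_coef0 eq_sym oner_eq0.
have ql : q.[l] != 0.
  move: mup1; rewrite pE mupM ?polyXsubC_eq0 // -['X - _]expr1 mup_XsubCX eqxx => /eqP; rewrite add1n eqSS => /eqP h.
  apply/negP => /eqP ql; have := XsubC_dvd (toC l) qn0.
  by rewrite h dvdp_XsubCl fmorph_root /root ql eqxx.
have CH v : A *m (horner_mx A q *m v) = l *: (horner_mx A q *m v).
  have := Cayley_Hamilton A; rewrite qE rmorphM rmorphB /= horner_mx_X horner_mx_C => /eqP.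
  rewrite -mulmxE mulmxBl subr_eq0 => /eqP E.
  by rewrite mulmxA E -mulmxA mul_scalar_mx.
have CH' v : horner_mx A q *m (A *m v) = l *: (horner_mx A q *m v).
  rewrite -CH !mulmxA; congr (_ *m _).
  by apply: comm_horner_mx.
have [phi0 px] := exists_pair1 x0.
pose phi := (q.[l])^-1 *: (phi0 *m horner_mx A q).
have Qv v : horner_mx A q *m v = (q.[l] * pair phi v) *: x.
  have [|k kE] := sA (horner_mx A q *m v) 0; first by rewrite CH scale0r addr0.
  by rewrite /phi pairZl -pairM kE pairZ px mulr1 mulrA divff // mul1r.
have phix : pair phi x = 1.
  by rewrite pairZl -pairM (horner_eigen _ Ax) pairZ px mulr1 mulVf.
exists phi; split => //.
  apply/rowP => j; have := CH' (delta_mx j 0); have E (g : 'rV[R]_d) : g 0 j = pair g (delta_mx j 0).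
    by rewrite /pair -colE mxE.
  rewrite !Qv scalerA => /eqP; rewrite -subr_eq0 -scalerBl scaler_eq0 (negbTE x0) orbF.
  rewrite mulrCA -mulrBr mulf_eq0 (negbTE ql) /= subr_eq0 => /eqP h.
  rewrite !E -pairM -scalemxAl pairZ h mulrA mulVf ?mul1r //.
have [s sE] := closed_field_poly_normal (map_poly toC q).
have qs mu : mu \in s -> `|mu| < `|toC l|.
  move=> mus; have rmu : root (map_poly toC q) mu.
    by rewrite sE rootZ ?lead_coef_eq0 // root_prod_XsubC.
  apply: dom; first by rewrite eigenvalue_root_char pE rootM rmu orbT.
  by apply/eqP => E; move: rmu ql; rewrite E fmorph_root /root => ->.
have colb (j : 'I_d) (e : R) : 0 < e -> exists N, forall n, (N <= n)%N ->
    `|((l^-1 *: A) ^+ n - x *m phi) *m (delta_mx j 0 : 'cV[R]_d)| <= e.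
  move=> e0; set v : 'cV[R]_d := delta_mx j 0; pose u := v - pair phi v *: x.
  have qu : horner_mx A q *m u = 0.
    by rewrite mulmxBr -scalemxAr (horner_eigen _ Ax) Qv scalerA mulrC subrr.
  have h : horner_mx (complex_mx A) (\prod_(mu <- s) ('X - mu%:P)) *m map_mx toC u = 0.
    have : horner_mx (complex_mx A) (map_poly toC q) *m map_mx toC u = 0.
      by rewrite /complex_mx -map_horner_mx -map_mxM qu map_mx0.
    rewrite sE linearZ /= -scalemxAl => /eqP; rewrite scaler_eq0 lead_coef_eq0 (negbTE qn0).
    by move=> /eqP.
  have [N Nb] := factor_decay lC qs h e0; exists N => n /Nb.
  have -> : (toC l) ^- n *: (complex_mx A ^+ n *m map_mx toC u) =
      map_mx toC (((l^-1 *: A) ^+ n - x *m phi) *m v).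
    rewrite exprZn exprVn mulmxBl mulmx_pair -scalemxAl.
    rewrite -(_ : l ^- n *: (A ^+ n *m (pair phi v *: x)) = pair phi v *: x); last first.
      by rewrite -scalemxAr (mulmx_pow_eigen _ Ax) !scalerA mulrAC mulVf ?mul1r // expf_neq0.
    by rewrite -scalerBr -mulmxBr map_mxZ map_mxM rmorphXn /= fmorphV rmorphXn.
  move=> h1; apply: mx_norm_le => [|i i']; first exact: ltW.
  apply: ltW; apply: le_lt_trans h1.
  by have := cnorm_entry (map_mx toC (((l^-1 *: A) ^+ n - x *m phi) *m v)) i i'; rewrite mxE cmod_real.
move=> e e0; have e2 : 0 < e / 2 by rewrite divr_gt0.
have /choice[N Nb] : forall j, exists N, forall n, (N <= n)%N ->
    `|((l^-1 *: A) ^+ n - x *m phi) *m (delta_mx j 0 : 'cV[R]_d)| <= e / 2 by move=> j; exact: colb.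
exists (\max_j N j); apply: le_lt_trans (_ : _ <= e / 2) _; last lra.
by apply: mx_norm_le_col => [|j]; [exact: ltW|exact: Nb (leq_bigmax j)].
Qed.

(** The dominant eigenvalue has to be [l]: otherwise it would exceed [l] in modulus, against the
    bounded powers. *)
Lemma unique_max_prox A x l (B : R) : l != 0 -> x != 0 -> A *m x = l *: x ->
  (forall n, `|(l^-1 *: A) ^+ n| <= B) -> unique_max_modulus A ->
  exists phi, prox (l^-1 *: A) x phi.
Proof.
move=> l0 x0 Ax Bb [lam mup1 dom].
have r1 : eigenvalue (complex_mx A) (toC l).
  rewrite eigenvalue_root_char /complex_mx -map_char_poly fmorph_root.
  by apply/root_char_polyP; exists x.
have elam : eigenvalue (complex_mx A) lam.
  rewrite eigenvalue_root_char -dvdp_XsubCl XsubC_dvd ?mup1 //.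
  by rewrite monic_neq0 // char_poly_monic.
have lE : toC l = lam.
  apply/eqP/negP => /negP /(dom _ r1) h; have := power_bounded_eig l0 Bb elam.
  by rewrite (lt_geF h).
apply: prox_of_dominant => //; last by move=> mu /dom; rewrite lE.
by apply/(mup_simple Ax x0 l0); rewrite lE.
Qed.

Lemma eigenvalue_inv A (mu : R[i]) : A \in unitmx ->
  eigenvalue (complex_mx A) mu -> mu != 0 /\ eigenvalue (complex_mx (invmx A)) mu^-1.
Proof.
move=> uA /eigenvalueP[v vA v0].
have uC : complex_mx A \in unitmx by rewrite map_unitmx.
have mu0 : mu != 0.
  apply: contra_neq v0 => mu0; rewrite -(mulmxK uC v) vA mu0 scale0r mul0mx //.
split => //; apply/eigenvalueP; exists v => //.
rewrite /complex_mx map_invmx -[in RHS](mulmxK uC v) vA -scalemxAl scalerA mulVf //.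
by rewrite scale1r.
Qed.

Lemma cmodr_inv (a b : R[i]) : a != 0 -> b != 0 -> (`|a^-1| < `|b^-1|) = (`|b| < `|a|).
Proof. by move=> a0 b0; rewrite !normfV ltf_pV2 // posrE normr_gt0. Qed.

Lemma prox_unique_min A z l psi : A \in unitmx -> l != 0 -> z != 0 -> A *m z = l *: z ->
  prox (l *: invmx A) z psi -> unique_min_modulus A.
Proof.
move=> uA l0 z0 Az pA; have Az' := invmx_eigen uA Az l0; have li : l^-1 != 0 by rewrite invr_neq0.
have pA' : prox (l^-1^-1 *: invmx A) z psi by rewrite invrK.
exists (toC l).
  apply/(mup_simple Az z0 l0); rewrite -[A]invmxK -[l]invrK.
  by apply: simple_inv; rewrite ?unitmx_inv //; exact: prox_simple pA'.
move=> mu /(eigenvalue_inv uA)[mu0 /(prox_bound li Az' pA')].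
rewrite fmorphV (inj_eq invr_inj) => h /h.
by rewrite cmodr_inv // fmorph_eq0.
Qed.

Lemma unique_min_prox A z l (B : R) : A \in unitmx -> l != 0 -> z != 0 -> A *m z = l *: z ->
  (forall n, `|(l *: invmx A) ^+ n| <= B) -> unique_min_modulus A ->
  exists psi, prox (l *: invmx A) z psi.
Proof.
move=> uA l0 z0 Az Bb [lam mup1 dom].
have Az' := invmx_eigen uA Az l0; have li : l^-1 != 0 by rewrite invr_neq0.
have lC : toC l != 0 by rewrite fmorph_eq0.
have r1 : eigenvalue (complex_mx A) (toC l).
  rewrite eigenvalue_root_char /complex_mx -map_char_poly fmorph_root.
  by apply/root_char_polyP; exists z.
have elam : eigenvalue (complex_mx A) lam.
  rewrite eigenvalue_root_char -dvdp_XsubCl XsubC_dvd ?mup1 //.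
  by rewrite monic_neq0 // char_poly_monic.
have lE : toC l = lam.
  apply/eqP/negP => /negP /(dom _ r1); have [lam0 /power_bounded_eig h] := eigenvalue_inv uA elam.
  have := h l^-1 B li; rewrite invrK => /(_ Bb); rewrite fmorphV => h1.
  by rewrite -cmodr_inv // => h2; move: h1; rewrite (lt_geF h2).
rewrite -[l]invrK; apply: prox_of_dominant => //.
  by apply: simple_inv => //; apply/(mup_simple Az z0 l0); rewrite lE.
move=> mu e1 mul; have uA' : invmx A \in unitmx by rewrite unitmx_inv.
have [mu0] := eigenvalue_inv uA' e1; rewrite invmxK => e2.
have : `|lam| < `|mu^-1|.
  apply: dom e2 _; apply: contra_neq mul => E.
  by rewrite -[LHS]invrK E -lE; symmetry; exact: fmorphV.
have -> : toC l^-1 = lam^-1 by rewrite -lE; exact: fmorphV.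
by rewrite -{1}[lam]invrK cmodr_inv // invr_neq0 // -lE.
Qed.

End Criterion.

(** * From projective space to cones *)

Section ConeTopology.
Context {R : realType} {d : nat}.
Implicit Types (S : set (pspace R d)) (p q : pspace R d) (u v w : 'cV[R]_d).

Lemma lifts_scale p v (a : R) : a != 0 -> lifts p v -> lifts p (a *: v).
Proof. by move=> a0 [v0 pv]; split; [rewrite scaler_eq0 negb_or a0|exact: memvZ]. Qed.

Lemma lifts_proportional p u v : lifts p u -> lifts p v -> exists2 a : R, a != 0 & v = a *: u.
Proof.
move=> pu [v0]; rewrite (lifts_val pu) => /vlineP[a va]; exists a => //.
by apply: contra_neq v0 => a0; rewrite va a0 scale0r.
Qed.

Lemma cone_neq0 S v : cone S v -> v != 0.
Proof. by move=> [p _ []]. Qed.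

Lemma cone_homog S v (a : R) : a != 0 -> cone S v -> cone S (a *: v).
Proof. by move=> a0 [p Sp pv]; exists p => //; exact: lifts_scale. Qed.

Lemma cone_lifts S p v : lifts p v -> (S p <-> cone S v).
Proof.
move=> pv; split => [Sp|[q Sq qv]]; first by exists p.
by rewrite (lifts_inj pv qv).
Qed.

Lemma open_ball_cone S v : open (cone S) -> cone S v ->
  exists2 e : R, 0 < e & forall u, `|u - v| < e -> cone S u.
Proof.
move=> oS Sv; have := oS _ Sv; rewrite -nbhs_ballE => -[e e0 eS].
exists e => // u uv; apply: eS; rewrite mx_norm_ball /ball_ /=.
by rewrite distrC.
Qed.

Lemma closure_approx S v (e : R) : cone (closure S) v -> 0 < e ->
  exists2 u, cone S u & `|u - v| < e.
Proof.
move=> [p Sp pv] e0; pose U := [set q | exists2 u : 'cV[R]_d, `|u - v| < e & lifts q u].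
have oU : open (cone U).
  rewrite openE => w [q [u uv qu] qw]; have [a a0 wE] := lifts_proportional qu qw.
  have w0 := qw.1.
  (* The first bound keeps the rescaled vector within [e] of [v], the second keeps [w'] nonzero. *)
  pose r := Num.min (`|a| * (e - `|u - v|)) `|w|.
  have r0 : 0 < r by rewrite lt_min mulr_gt0 ?normr_gt0 ?subr_gt0.
  apply/nbhs_ballP; exists r => // w'; rewrite mx_norm_ball /ball_ /= lt_min.
  move=> /andP[h1 h2]; have w'0 : w' != 0.
    by apply/eqP => w'0; move: h2; rewrite w'0 subr0 ltxx.
  have [q' q'w'] := lifts_line w'0; exists q' => //.
  exists (a^-1 *: w'); last by apply: lifts_scale; rewrite ?invr_neq0.
  rewrite (_ : _ - v = (u - v) - a^-1 *: (w - w')); last first.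
    by rewrite wE scalerBr scalerA mulVf // scale1r; vring.
  apply: le_lt_trans (ler_normB _ _) _; rewrite normrZ normfV.
  by rewrite -ltrBrDl mulrC ltr_pdivrMr ?normr_gt0 // mulrC.
have [|q [Sq [u uv qu]]] := Sp U; last by exists u => //; exists q.
exists U; split => //; exists v => //.
by rewrite subrr normr0.
Qed.

Lemma closure_cone S v : v != 0 ->
  (forall e : R, 0 < e -> exists2 u, cone S u & `|u - v| < e) -> cone (closure S) v.
Proof.
move=> v0 h; have [p pv] := lifts_line v0; exists p => // B [U [oU Up UB]].
have Uv : cone U v by exists p.
have [e e0 eU] := open_ball_cone oU Uv; have [u [q Sq qu] uv] := h e e0.
by exists q; split => //; apply: UB; apply/(cone_lifts _ qu)/eU.
Qed.

Lemma inducesZ A (g : pspace R d -> pspace R d) (k : R) :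
  k != 0 -> induces A g -> induces (k *: A) g.
Proof.
move=> k0 [uA gA]; split; first by rewrite unitmxZ ?unitfE.
by move=> p v vp; rewrite -scalemxAl; apply: memvZ; exact: gA.
Qed.

End ConeTopology.

(** [cone] contains both signs of every lift; [f] selects one half, and 0 is added to obtain a
    closed convex cone. *)
Definition closed_lift (R : realType) (d : nat) (Om : set (pspace R d)) (f : 'rV[R]_d) :=
  [set v | v = 0 \/ cone (closure Om) v /\ 0 < pair f v].
Definition open_lift (R : realType) (d : nat) (Om : set (pspace R d)) (f : 'rV[R]_d) :=
  [set v | cone Om v /\ 0 < pair f v].

Lemma properly_convex_cone (R : realType) (d : nat) (Om : set (pspace R d)) :
  properly_convex Om -> exists f : 'rV[R]_d, in_chart f (closure Om) /\
    proper_cone (closed_lift Om f) (open_lift Om f) f.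
Proof.
move=> [_ oOm [f [fc cO cC bC]]]; exists f; split => //.
(* Scaled to f = 1, the sum is a convex combination of two points of the trace. *)
have add S (cS : convex_set (trace f S)) u v : cone S u -> 0 < pair f u ->
    cone S v -> 0 < pair f v -> cone S (u + v).
  move=> Su fu Sv fv; have fuv : 0 < pair f u + pair f v by rewrite addr_gt0.
  have tr w : cone S w -> 0 < pair f w -> trace f S ((pair f w)^-1 *: w).
    move=> Sw fw; split; first by apply: cone_homog; rewrite // invr_neq0 // gt_eqF.
    by rewrite /= -/(pair f _) pairZ mulVf // gt_eqF.
  have l0 : 0 <= pair f u / (pair f u + pair f v) by rewrite divr_ge0 // ltW.
  have l1 : pair f u / (pair f u + pair f v) <= 1 by rewrite ler_pdivrMr // mul1r lerDl ltW.
  have := cS _ _ (Itv01 l0 l1) (mem_set (tr _ Su fu)) (mem_set (tr _ Sv fv)).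
  rewrite inE => -[h _]; have := cone_homog (lt0r_neq0 fuv) h.
  rewrite (_ : _ *: _ = u + v) //.
  pose a := pair f u / (pair f u + pair f v).
  rewrite -[conv _ _ _]/(a *: ((pair f u)^-1 *: u) + (1 - a) *: ((pair f v)^-1 *: v)) /a.
  by apply/matrixP => i j; rewrite !linmxE; field; rewrite !gt_eqF.
have CO u v : open_lift Om f u -> open_lift Om f v -> open_lift Om f (u + v).
  by move=> [Ou fu] [Ov fv]; split; [exact: add|rewrite pairD addr_gt0].
have sub v : cone Om v -> cone (closure Om) v.
  by move=> [p Op pv]; exists p => //; exact: subset_closure.
have fC v : cone (closure Om) v -> pair f v != 0 by exact: fc.
have L0 : 0 <= d%:R * `|f| :> R by rewrite mulr_ge0.
have near v (e : R) : 0 < e -> exists2 r : R, 0 < r &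
    forall u, `|u - v| < r -> `|pair f u - pair f v| < e.
  move=> e0; exists (e / (d%:R * `|f| + 1)); first by rewrite divr_gt0 // ltr_wpDl.
  move=> u; rewrite ltr_pdivlMr ?ltr_wpDl // -pairB => h.
  apply: le_lt_trans (pair_norm _ _) _; apply: le_lt_trans h.
  by rewrite mulrDr mulr1 mulrC lerDl.
have approx v (e : R) : cone (closure Om) v -> 0 < pair f v -> 0 < e ->
    exists2 u, open_lift Om f u & `|u - v| < e.
  move=> Cv fv e0; have [r r0 rb] := near v _ fv.
  have [|u Ou uv] := closure_approx Cv (_ : 0 < Num.min e r); first by rewrite lt_min e0.
  move: uv; rewrite lt_min => /andP[ue /rb ur]; exists u => //; split => //.
  by move: ur; rewrite ltr_norml; lra.
have COo u : open_lift Om f u -> exists2 e : R, 0 < e &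
    forall v, `|v| < e -> open_lift Om f (u + v).
  move=> [Ou fu]; have [e e0 eb] := open_ball_cone oOm Ou; have [r r0 rb] := near u _ fu.
  exists (Num.min e r); first by rewrite lt_min e0.
  move=> v; rewrite lt_min => /andP[ve vr].
  have E : u + v - u = v by rewrite addrC addKr.
  split; first by apply: eb; rewrite E.
  by have := rb (u + v); rewrite E => /(_ vr); rewrite ltr_norml; lra.
split.
- by left.
- move=> u v [->|[Cu fu]]; first by rewrite add0r.
  move=> [->|[Cv fv]]; first by rewrite addr0; right.
  by right; split; [exact: add|rewrite pairD addr_gt0].
- move=> a v a0; have [->|aN0] := eqVneq a 0; first by rewrite scale0r; left.
  move=> [->|[Cv fv]]; first by rewrite scaler0; left.
  right; split; first exact: cone_homog.
  by rewrite pairZ mulr_gt0 // lt_neqAle eq_sym aN0.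
- by move=> v [Ov fv]; right; split => //; exact: sub.
- move=> u v Ou [->|[Cv fv]]; first by rewrite addr0.
  (* [v] is replaced by a nearby point [w] of the open cone, and the ball around [u] absorbs the
     error. *)
  have [e e0 eb] := COo _ Ou; have [w Ow wv] := approx _ _ Cv fv e0.
  rewrite (_ : u + v = (u + (v - w)) + w); last vring.
  by apply: CO => //; apply: eb; rewrite distrC.
- move=> a v a0 [Ov fv]; split; last by rewrite pairZ mulr_gt0.
  by apply: cone_homog; rewrite // gt_eqF.
- exact: COo.
- move=> v h; have [->|v0] := eqVneq v 0; first by left.
  have nv : 0 < `|v| by rewrite normr_gt0.
  have fv0 : 0 <= pair f v.
    rewrite leNgt; apply/negP => fv; have [|r r0 rb] := near v (- pair f v); first lra.
    have [u [->|[_ fu]] /rb] := h r r0; first by rewrite pair0 ltr_norml; lra.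
    by rewrite ltr_norml; lra.
  have Cv : cone (closure Om) v.
    apply: closure_cone => // e e0; have e2 : 0 < e / 2 by rewrite divr_gt0.
    have [|u Ku uv] := h (Num.min (e / 2) `|v|); first by rewrite lt_min e2.
    move: uv; rewrite lt_min => /andP[ue uv].
    case: Ku => [u0|[Cu fu]]; first by move: uv; rewrite u0 sub0r normrN ltxx.
    have [w [Ow _] wu] := approx _ _ Cu fu e2; exists w => //.
    by have := ler_distD u w v; lra.
  by right; split => //; rewrite lt_neqAle eq_sym fC.
- have [M [_ Mb]] := bC; exists (`|M| + 1); first by rewrite ltr_wpDl.
  move=> v [->|[Cv fv]]; first by rewrite normr0 pair0 mulr0.
  have := Mb (`|M| + 1); rewrite (le_lt_trans (ler_norm M)) ?ltrDl // => /(_ isT).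
  move=> /(_ ((pair f v)^-1 *: v)); rewrite /= normrZ gtr0_norm ?invr_gt0 //.
  rewrite mulrC ler_pdivrMr //; apply; split.
    by apply: cone_homog; rewrite // invr_neq0 // gt_eqF.
  by rewrite /= -/(pair f _) pairZ mulVf // gt_eqF.
- by move=> [/cone_neq0]; rewrite eqxx.
Qed.

Section Lifts.
Context {R : realType} {d : nat} (Om : set (pspace R d)) (f : 'rV[R]_d).
Hypothesis oOm : open Om.
Hypothesis fc : in_chart f (closure Om).
Local Notation K := (closed_lift Om f).
Local Notation C := (open_lift Om f).
Hypothesis KC : proper_cone K C f.
Implicit Types (p q r x y z : pspace R d) (u v w : 'cV[R]_d) (g : PGL R d).

Lemma closed_lift_sign v : cone (closure Om) v -> K v \/ K (- v).
Proof.
move=> cv; have := fc cv; rewrite neq_lt => /orP[fv|fv]; [right|left]; right.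
  split; last by rewrite pairN oppr_gt0.
  by rewrite -scaleN1r; apply: cone_homog; rewrite // oppr_eq0 oner_eq0.
by split.
Qed.

Lemma open_lift_sign v : cone Om v -> C v \/ C (- v).
Proof.
move=> cv; have cv' : cone (closure Om) v.
  by case: cv => p Op pv; exists p => //; exact: subset_closure.
have := fc cv'; rewrite neq_lt => /orP[fv|fv]; [right|left]; last by split.
split; last by rewrite pairN oppr_gt0.
by rewrite -scaleN1r; apply: cone_homog; rewrite // oppr_eq0 oner_eq0.
Qed.

Lemma lifts_opp p v : lifts p (- v) -> lifts p v.
Proof. by rewrite -[v in X in _ -> X]opprK -[- - v]scaleN1r; apply: lifts_scale; rewrite oppr_eq0 oner_eq0. Qed.

Lemma exists_open_lift p : Om p -> exists2 u, C u & lifts p u.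
Proof.
move=> Op; have [v pv] := lifts_ex p.
have [Cv|Cv] : C v \/ C (- v) by apply: open_lift_sign; exists p.
  by exists v.
by exists (- v) => //; apply: lifts_opp; rewrite opprK.
Qed.

Lemma exists_closed_lift p : closure Om p -> exists2 u, K u & lifts p u.
Proof.
move=> Op; have [v pv] := lifts_ex p.
have [Cv|Cv] : K v \/ K (- v) by apply: closed_lift_sign; exists p.
  by exists v.
by exists (- v) => //; apply: lifts_opp; rewrite opprK.
Qed.

Lemma open_lift_mem p u : lifts p u -> C u -> Om p.
Proof. by move=> pu [Ou _]; apply/(cone_lifts _ pu). Qed.

Lemma closed_lift_mem p u : lifts p u -> K u -> closure Om p.
Proof.
move=> pu [u0|[Ou _]]; last exact/(cone_lifts _ pu).
by case: pu; rewrite u0 eqxx.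
Qed.

Lemma open_lift_of_closed p u : lifts p u -> K u -> Om p -> C u.
Proof.
move=> pu [u0|[_ fu]] Op; first by case: pu; rewrite u0 eqxx.
by split => //; exists p.
Qed.

Lemma closed_lift_cone u : K u -> u != 0 -> cone (closure Om) u.
Proof. by move=> [->|[]//]; rewrite eqxx. Qed.

Lemma boundaryE p : boundary Om p <-> closure Om p /\ ~ Om p.
Proof. by rewrite /boundary; have /interior_id -> := oOm. Qed.

(** [is_hilbert_dist] allows any chart. A form of such a chart cannot change sign on [K], since a
    positive combination of two points of opposite signs would be a zero of it. *)
Lemma chart_sign (f' : 'rV[R]_d) u v : in_chart f' (closure Om) ->
  K u -> u != 0 -> K v -> v != 0 -> pair f' u < 0 -> pair f' v < 0.
Proof.
move=> f'c Ku u0 Kv v0 fu; rewrite ltNge le_eqVlt; apply/negP => /orP[/eqP fv0|fv].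
  by have := f'c _ (closed_lift_cone Kv v0); rewrite -/(pair f' v) -fv0 eqxx.
pose w := pair f' v *: u + (- pair f' u) *: v.
have Kw : K w by apply: (cone_add KC); apply: (cone_scale KC) => //; lra.
have fw : 0 < pair f w.
  rewrite pairD !pairZ addr_gt0 // mulr_gt0 ?oppr_gt0 //; exact: (cone_pair_gt0 KC).
have w0 : w != 0 by apply/eqP => w0; move: fw; rewrite w0 pair0 ltxx.
have := f'c _ (closed_lift_cone Kw w0); rewrite -/(pair f' w) pairD !pairZ.
by rewrite mulNr [pair f' u * _]mulrC subrr eqxx.
Qed.

Lemma closed_segmentE p q r u v : lifts p u -> lifts q v -> K u -> K v ->
  closed_segment Om p q r <->
  exists a b, [/\ 0 <= a, 0 <= b & lifts r (a *: u + b *: v)].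
Proof.
move=> pu qv Ku Kv; have fu := cone_pair_gt0 KC Ku pu.1.
have fv := cone_pair_gt0 KC Kv qv.1; split.
  move=> [u' [v' [pu' qv' seg [t /andP[t0 t1] rt]]]].
  have [a a0 u'E] := lifts_proportional pu pu'; have [b b0 v'E] := lifts_proportional qv qv'.
  have ab : 0 < a * b.
    rewrite lt_neqAle eq_sym mulf_neq0 //= leNgt; apply/negP => ab.
    (* Lifts of opposite signs are impossible: the segment would meet f = 0 at the parameter
       [a * pair f u / D] of the unit interval and leave the chart. *)
    pose D := a * pair f u - b * pair f v.
    have D0 : D * (a * pair f u) > 0.
      rewrite /D mulrBl subr_gt0; apply: (@lt_trans _ _ 0).
        rewrite mulrACA mulrC pmulr_rlt0 ?mulr_gt0 //; nra.
      by rewrite -expr2 exprn_even_gt0 // mulf_neq0 // gt_eqF.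
    have Dn0 : D != 0 by apply/eqP => DE; move: D0; rewrite DE mul0r ltxx.
    have := seg (a * pair f u / D) _.
    have s0 : 0 <= a * pair f u / D.
      by rewrite -(pmulr_lge0 _ (_ : 0 < D ^+ 2)) ?exprn_even_gt0 // expr2 mulrA divfK // mulrC ltW.
    have s1 : a * pair f u / D <= 1.
      rewrite -subr_ge0 -(pmulr_lge0 _ (_ : 0 < D ^+ 2)) ?exprn_even_gt0 //.
      rewrite expr2 mulrA mulrBl divfK // mul1r {1}/D addrAC subrr add0r.
      rewrite mulNr oppr_ge0 /D mulrBr subr_le0; apply: (@le_trans _ _ 0).
        rewrite mulrACA [b * a]mulrC; apply/ltW; rewrite pmulr_llt0 ?mulr_gt0 //; nra.
      by rewrite -expr2 sqr_ge0.
    rewrite s0 s1 => /(_ isT)/fc; rewrite -/(pair f _) u'E v'E !scalerA pairD !pairZ.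
    move=> /eqP; apply; rewrite /D; field; exact: Dn0.
  have [ap|an] : 0 < a \/ a < 0 by move: a0; rewrite neq_lt => /orP[]; [right|left].
    have bp : 0 < b by move: ab; rewrite pmulr_rgt0.
    exists ((1 - t) * a), (t * b); split; try by rewrite mulr_ge0 ?subr_ge0 // ltW.
    by rewrite -!scalerA -u'E -v'E.
  have bn : b < 0 by move: ab; rewrite nmulr_rgt0.
  exists ((1 - t) * - a), (t * - b); split; try by rewrite mulr_ge0 ?subr_ge0 // oppr_ge0 ltW.
  by apply: lifts_opp; rewrite !mulrN !scaleNr -opprD opprK -!scalerA -u'E -v'E.
move=> [a [b [a0 b0 rab]]].
have ab : 0 < a + b.
  rewrite lt_neqAle addr_ge0 // andbT eq_sym; apply/eqP => ab0.
  have [aE bE] : a = 0 /\ b = 0 by split; lra.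
  by case: rab; rewrite aE bE !scale0r addr0 eqxx.
exists u, v; split => //.
  move=> s /andP[s0 s1]; apply: closed_lift_cone.
    by apply: (cone_add KC); apply: (cone_scale KC); rewrite ?subr_ge0.
  apply/eqP => E; have : pair f ((1 - s) *: u + s *: v) = 0 by rewrite E pair0.
  rewrite pairD !pairZ; have [->|s0'] := eqVneq s 0; first by rewrite subr0; lra.
  have : 0 < s * pair f v by rewrite mulr_gt0 // lt_neqAle eq_sym s0'.
  have : 0 <= (1 - s) * pair f u by rewrite mulr_ge0 ?subr_ge0 // ltW.
  lra.
exists (b / (a + b)).
  by rewrite divr_ge0 ?(ltW ab) //= ler_pdivrMr // mul1r lerDr.
rewrite (_ : _ + _ = (a + b)^-1 *: (a *: u + b *: v)); last by vfield.
by apply: lifts_scale; rewrite // invr_neq0 // gt_eqF.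
Qed.

Lemma in_half_triangleE x z u v : lifts x u -> lifts z v -> chord K C u v ->
  in_half_triangle Om x z <-> exists w, half_triangle K C u v w.
Proof.
move=> xu zv [Ku Kv Cu Cv Cuv]; split.
  move=> [y /boundaryE[cy _] seg]; have [w Kw yw] := exists_closed_lift cy.
  have main p t : lifts p t -> K t -> (closed_segment Om p y `<=` boundary Om \/
      closed_segment Om y p `<=` boundary Om) -> ~ C (t + w).
    move=> pt Kt sb Ctw; have [r rE] := lifts_line (int_neq0 KC Ctw).
    suff /boundaryE[_] : boundary Om r by apply; exact: open_lift_mem Ctw.
    case: sb; apply.
      by apply/(closed_segmentE _ pt yw Kt Kw); exists 1, 1; rewrite !scale1r; split.
    apply/(closed_segmentE _ yw pt Kw Kt); exists 1, 1; rewrite !scale1r addrC.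
    by split.
  exists w; split => //.
  - by apply/eqP; case: yw.
  - by apply: (main _ _ xu Ku); left => r xr; apply: seg; left.
  - by apply: (main _ _ zv Kv); right => r xr; apply: seg; right.
move=> [w [Kw /eqP w0 nuw nvw]]; have [y yw] := lifts_line w0.
have nCw : ~ C w by move=> Cw; apply: nuw; exact: (int_addl KC).
exists y.
  apply/boundaryE; split; first exact: closed_lift_mem Kw.
  by move=> Oy; apply: nCw; exact: open_lift_of_closed Oy.
have main a b t : 0 <= a -> 0 <= b -> K t -> ~ C (t + w) ->
    forall r, lifts r (a *: t + b *: w) -> boundary Om r.
  move=> a0 b0 Kt nC r rE; have Kr : K (a *: t + b *: w).
    by apply: (cone_add KC); apply: (cone_scale KC).
  apply/boundaryE; split; first exact: closed_lift_mem Kr.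
  move=> Or; apply: nC; apply: (int_comb KC a0 b0) => //.
  exact: open_lift_of_closed Or.
move=> r [/(closed_segmentE _ xu yw Ku Kw)|/(closed_segmentE _ yw zv Kw Kv)] [a [b [a0 b0 rE]]].
  exact: (main a b u).
by apply: (main b a v) => //; rewrite addrC.
Qed.

Lemma open_segmentE x z u v r : lifts x u -> lifts z v -> chord K C u v ->
  open_segment Om x z r <-> exists t, lifts r (u + expR (2 * t) *: v).
Proof.
move=> xu zv ch; have [Ku Kv Cu Cv Cuv] := ch; split.
  move=> [/(closed_segmentE _ xu zv Ku Kv)[a [b [a0 b0 rE]]] nr].
  have ap : 0 < a.
    rewrite lt_neqAle a0 andbT; apply/eqP => aE; apply: nr; right.
    move: rE; rewrite -aE scale0r add0r => rE; apply: (lifts_inj rE).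
    by apply: lifts_scale => //; apply/eqP => bE; case: rE; rewrite bE scale0r eqxx.
  have bp : 0 < b.
    rewrite lt_neqAle b0 andbT; apply/eqP => bE; apply: nr; left.
    move: rE; rewrite -bE scale0r addr0 => rE; apply: (lifts_inj rE).
    by apply: lifts_scale => //; apply/eqP => aE; case: rE; rewrite aE scale0r eqxx.
  exists (2^-1 * ln (b / a)); rewrite mulrA divff // mul1r lnK ?posrE ?divr_gt0 //.
  rewrite (_ : _ + _ = a^-1 *: (a *: u + b *: v)); last by vfield.
  by apply: lifts_scale; rewrite // invr_neq0 // gt_eqF.
move=> [t rE]; have Cr : C (u + expR (2 * t) *: v).
  by rewrite -[u]scale1r; apply: (chord_int KC ch); rewrite ?expR_gt0.
have Or := open_lift_mem rE Cr; split.
  by apply/(closed_segmentE _ xu zv Ku Kv); exists 1, (expR (2 * t)); rewrite scale1r expR_ge0.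
by case=> rx; [apply/Cu/(open_lift_of_closed xu Ku)|apply/Cv/(open_lift_of_closed zv Kv)]; rewrite -rx.
Qed.

Lemma geodesic_chord x z : projective_geodesic Om x z ->
  exists u v, [/\ lifts x u, lifts z v & chord K C u v].
Proof.
move=> [/boundaryE[cx nx] /boundaryE[cz nz] xz seg].
have [u Ku xu] := exists_closed_lift cx; have [v Kv zv] := exists_closed_lift cz.
exists u, v; split => //; split => //.
- by move=> Cu; apply: nx; exact: open_lift_mem Cu.
- by move=> Cu; apply: nz; exact: open_lift_mem Cu.
have Kuv : K (u + v) by exact: (cone_add KC).
have fuv : 0 < pair f (u + v).
  by rewrite pairD addr_gt0 // (cone_pair_gt0 KC) //; [case: xu|case: zv].
have uv0 : u + v != 0 by apply/eqP => E; move: fuv; rewrite E pair0 ltxx.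
have [r rE] := lifts_line uv0; apply: (open_lift_of_closed rE) => //; apply: seg; split.
  by apply/(closed_segmentE _ xu zv Ku Kv); exists 1, 1; rewrite !scale1r.
move=> rxz; apply: xz; case: rxz => rE'.
  have [a _ aE] := lifts_proportional xu (eq_ind _ (fun q => lifts q _) rE _ rE').
  have vE : v = (a - 1) *: u by rewrite scalerBl scale1r -aE addrC addKr.
  apply: (lifts_inj (v := v) _ zv); rewrite vE; apply: lifts_scale => //.
  by apply/eqP => E; case: zv; rewrite vE E scale0r eqxx.
have [a _ aE] := lifts_proportional zv (eq_ind _ (fun q => lifts q _) rE _ rE').
have uE : u = (a - 1) *: v by rewrite scalerBl scale1r -aE addrK.
apply: (lifts_inj (v := u) xu); rewrite uE; apply: lifts_scale => //.
by apply/eqP => E; case: xu; rewrite uE E scale0r eqxx.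
Qed.

Lemma gauge_scale a b u v : 0 < a -> 0 < b -> C u -> C v ->
  gauge K (a *: u) (b *: v) = a / b * gauge K u v.
Proof.
move=> a0 b0 Cu Cv.
suff main a' b' u' v' : 0 < a' -> 0 < b' -> C u' -> C v' ->
    gauge K (a' *: u') (b' *: v') <= a' / b' * gauge K u' v'.
  apply/eqP; rewrite eq_le main //=.
  have := main a^-1 b^-1 (a *: u) (b *: v); rewrite !invr_gt0 => /(_ a0 b0).
  move=> /(_ (cone_scaleint KC a0 Cu) (cone_scaleint KC b0 Cv)).
  rewrite !scalerA !mulVf ?gt_eqF // !scale1r => h.
  by rewrite -invfM ler_pdivlMl ?divr_gt0 // in h.
move=> {}a0 {}b0 {}Cu {}Cv; apply: (gauge_le KC).
- by apply: (cone_int KC); exact: (cone_scaleint KC).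
- exact: (cone_scaleint KC).
rewrite scalerA mulrAC divfK ?gt_eqF // -scalerA -scalerBr.
by apply: (cone_scale KC); [exact: ltW|apply: (gauge_mem KC) => //; exact: cone_int KC _ Cu].
Qed.

Lemma hd_scale a b u v : 0 < a -> 0 < b -> C u -> C v -> hd K (a *: u) (b *: v) = hd K u v.
Proof.
move=> a0 b0 Cu Cv; rewrite /hd !gauge_scale //; congr (_ * ln _).
by field; rewrite !gt_eqF.
Qed.

Lemma hd_lifts p q u v u' v' : C u -> C v -> C u' -> C v' ->
  lifts p u -> lifts q v -> lifts p u' -> lifts q v' -> hd K u v = hd K u' v'.
Proof.
have pos w w' (a : R) : C w -> C w' -> w' = a *: w -> 0 < a.
  move=> [_ fw] [_ fw'] E; move: fw'; rewrite E pairZ pmulr_lgt0 //.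
move=> Cu Cv Cu' Cv' pu qv pu' qv'.
have [a _ aE] := lifts_proportional pu pu'; have [b _ bE] := lifts_proportional qv qv'.
by rewrite aE bE hd_scale //; [exact: pos aE|exact: pos bE].
Qed.

Lemma is_hilbert_dist_unique p q u v rho : C u -> C v -> lifts p u -> lifts q v ->
  is_hilbert_dist Om p q rho -> rho = hd K u v.
Proof.
move=> Cu Cv pu qv [f' [a [b [u' [v' [f'c [[ba fa] [bb fb]] [pu' qv'] [s [t [s0 st t1 u'E v'E]]] ->]]]]]].
have bcl w : cone (boundary Om) w -> cone (closure Om) w /\ ~ cone Om w.
  move=> [y /boundaryE[cy ny] yw]; split; first by exists y.
  by move=> [y' Oy' y'w]; apply: ny; rewrite (lifts_inj yw y'w).
have [[ca na] [cb nb]] := (bcl _ ba, bcl _ bb).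
(* The chart may place the endpoints in - K; by [chart_sign] a common sign [e] brings both into
   [K]. *)
pose e : R := if `[< K a >] then 1 else -1.
have ee : e * e = 1 by rewrite /e; case: asboolP => _; rewrite ?mulr1 // mulrNN mulr1.
have Ka : K (e *: a).
  rewrite /e; case: asboolP => [|nK]; first by rewrite scale1r.
  by have [//|] := closed_lift_sign ca; rewrite scaleN1r.
have Kb : K (e *: b).
  have [a0 b0] := (cone_neq0 ca, cone_neq0 cb).
  rewrite /e; case: asboolP => Ka'; rewrite ?scale1r ?scaleN1r.
    have [//|Kb] := closed_lift_sign cb; have nb0 : - b != 0 by rewrite oppr_eq0.
    have := chart_sign f'c Kb nb0 Ka' a0; rewrite pairN /pair fa fb; lra.
  have [Kb|//] := closed_lift_sign cb.
  have Kna : K (- a) by have [] := closed_lift_sign ca.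
  have na0 : - a != 0 by rewrite oppr_eq0.
  have := chart_sign f'c Kna na0 Kb b0; rewrite pairN /pair fa fb; lra.
have e0 : e != 0 by apply/eqP => E; move: ee; rewrite E mul0r => /eqP; rewrite eq_sym oner_eq0.
have Cab w y' c c' : C w -> lifts y' w -> lifts y' (c *: a + c' *: b) -> 0 <= c -> 0 <= c' ->
    C (c *: (e *: a) + c' *: (e *: b)).
  move=> Cw yw yw' c0 c0'; apply: (@open_lift_of_closed y').
  - rewrite !scalerA ![_ * e]mulrC -!scalerA -scalerDr; exact: lifts_scale.
  - by apply: (cone_add KC); apply: (cone_scale KC).
  - exact: open_lift_mem Cw.
have [s0' t0] : 0 <= s /\ 0 < t by split; lra.
have Cu' : C ((1 - s) *: (e *: a) + s *: (e *: b)).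
  by apply: (Cab _ _ _ _ Cu pu) => //; rewrite -?u'E //; lra.
have Cv' : C ((1 - t) *: (e *: a) + t *: (e *: b)).
  by apply: (Cab _ _ _ _ Cv qv) => //; rewrite -?v'E //; lra.
have ch : chord K C (e *: a) (e *: b).
  split => //.
  - by move=> [/(cone_homog e0) + _]; rewrite scalerA ee scale1r.
  - by move=> [/(cone_homog e0) + _]; rewrite scalerA ee scale1r.
  - by apply: (int_comb KC _ _ _ _ Cu') => //; lra.
have sw w y' c c' : w = c *: a + c' *: b -> lifts y' w -> lifts y' (c *: (e *: a) + c' *: (e *: b)).
  move=> -> yw; rewrite !scalerA ![_ * e]mulrC -!scalerA -scalerDr; exact: lifts_scale.
rewrite (hd_lifts Cu Cv Cu' Cv' pu qv (sw _ _ _ _ u'E pu') (sw _ _ _ _ v'E qv')).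
have [s1 t1'] : 0 < 1 - s /\ 0 < 1 - t by split; lra.
rewrite (chord_hd_le KC ch) //; last first.
  rewrite ler_ln ?posrE ?divr_gt0 // ler_pdivrMr // mulrAC ler_pdivlMr //; lra.
rewrite -ln_div ?posrE ?divr_gt0 //; congr (_ * ln _).
have ab : `|a - b| != 0.
  rewrite normr_eq0 subr_eq0; apply/eqP => ab; apply: na; case: Cu => Ou _.
  move: pu'; rewrite u'E -ab -scalerDl subrK scale1r => pa.
  exact: (cone_lifts _ pa).1 ((cone_lifts _ pu).2 Ou).
rewrite (_ : a - v' = t *: (a - b)); last by rewrite v'E; vring.
rewrite (_ : b - u' = (1 - s) *: (b - a)); last by rewrite u'E; vring.
rewrite (_ : a - u' = s *: (a - b)); last by rewrite u'E; vring.
rewrite (_ : b - v' = (1 - t) *: (b - a)); last by rewrite v'E; vring.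
rewrite !normrZ !gtr0_norm // [`|b - a|]distrC.
by field; rewrite ab !gt_eqF.
Qed.

Lemma is_hilbert_dist_exists p q u v (x z : 'cV[R]_d) : C u -> C v -> lifts p u -> lifts q v ->
  chord K C x z -> exists rho, is_hilbert_dist Om p q rho.
Proof.
move=> Cu0 Cv0 pu0 qv0 ch; have [Kx Kz nCx nCz Cxz] := ch.
pose u' := (pair f u)^-1 *: u; pose v' := (pair f v)^-1 *: v.
have [fu0 fv0] : 0 < pair f u /\ 0 < pair f v by case: Cu0 => _ ->; case: Cv0 => _ ->.
have Cu : C u' by apply: (cone_scaleint KC); rewrite ?invr_gt0.
have Cv : C v' by apply: (cone_scaleint KC); rewrite ?invr_gt0.
have pu : lifts p u' by apply: lifts_scale; rewrite // invr_neq0 // gt_eqF.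
have qv : lifts q v' by apply: lifts_scale; rewrite // invr_neq0 // gt_eqF.
have fu : pair f u' = 1 by rewrite pairZ mulVf // gt_eqF.
have fv : pair f v' = 1 by rewrite pairZ mulVf // gt_eqF.
(* The direction of the line through the two points. If they coincide, any direction with f = 0
   serves, and the chord supplies one. *)
have [w [k [w0 fw k0 vE]]] : exists w (k : R), [/\ w != 0, pair f w = 0, 0 <= k & v' = u' + k *: w].
  have [uv|uv] := eqVneq u' v'; last first.
    exists (v' - u'), 1; split => //.
    - by rewrite subr_eq0 eq_sym.
    - by rewrite pairB fu fv subrr.
    - by rewrite scale1r addrC subrK.
  have x0 : x != 0 by apply/eqP => x0; apply: nCz; rewrite -[z]add0r -x0.
  have z0 : z != 0 by apply/eqP => z0; apply: nCx; rewrite -[x]addr0 -z0.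
  have [fx fz] := (cone_pair_gt0 KC Kx x0, cone_pair_gt0 KC Kz z0).
  exists (pair f z *: x - pair f x *: z), 0; split => //.
  - apply/eqP => E; apply: nCx.
    have -> : x = (pair f x / (pair f x + pair f z)) *: (x + z).
      apply/matrixP => i j; have := congr1 (fun M : 'cV_d => M i j) E; rewrite !linmxE => h.
      have S0 : pair f x + pair f z != 0 by rewrite gt_eqF // addr_gt0.
      by apply: (mulfI S0); rewrite mulrA [_ * (_ / _)]mulrC divfK // mulrDl mulrDr; lra.
    by apply: (cone_scaleint KC); rewrite ?divr_gt0 ?addr_gt0.
  - by rewrite pairB !pairZ mulrC subrr.
  - by rewrite scale0r addr0.
have nK (e : R) : e != 0 -> ~ K (e *: w).
  move=> e0 Kw; have := cone_pair_gt0 KC Kw; rewrite scaler_eq0 negb_or e0 w0 pairZ fw mulr0.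
  by rewrite ltxx => /(_ isT).
have ray (e : R) : e != 0 -> exists t : R, [/\ 0 < t, K (u' + t *: (e *: w)) & ~ C (u' + t *: (e *: w))].
  move=> e0; have [t [t0 Kt tm]] := cone_ray_max KC (cone_int KC Cu) (nK _ e0).
  have [s s0 Cs] := int_line KC (e *: w) Cu.
  exists t; split => //.
    apply: lt_le_trans s0 _; rewrite leNgt; apply/negP => /tm; apply; exact: cone_int KC _ Cs.
  move=> Ct; have [r r0 Cr] := int_line KC (e *: w) Ct.
  apply: (tm (t + r)); first by rewrite ltrDl.
  by apply: (cone_int KC); rewrite scalerDl addrA.
have [t0 [t0p Kb nCb]] := ray 1 (oner_neq0 R).
have [|t1 [t1p Ka nCa]] := ray (-1); first by rewrite oppr_eq0 oner_eq0.
set b := u' + _ in Kb nCb; set a := u' + _ in Ka nCa.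
have [fa fb] : pair f a = 1 /\ pair f b = 1.
  by rewrite /a /b !pairD fu !pairZ fw !mulr0 addr0.
have kt : k < t0.
  have h : ~~ (t0 <= k).
    apply/negP; rewrite le_eqVlt => /orP[/eqP tk|tk].
      by apply: nCb; rewrite /b scale1r tk -vE.
    apply: nCb; rewrite /b scale1r.
    rewrite (_ : u' + t0 *: w = (1 - t0 / k) *: u' + (t0 / k) *: v'); last first.
      by rewrite vE; vfield; lra.
    have k0' : 0 < k by lra.
    apply: (cone_addint KC).
      by apply: (cone_scaleint KC) => //; rewrite subr_gt0 ltr_pdivrMr // mul1r.
    by apply: (cone_scale KC); [rewrite divr_ge0 // ltW|exact: cone_int KC _ Cv].
  by rewrite ltNge.
have bnd (y : 'cV[R]_d) : K y -> ~ C y -> pair f y = 1 -> trace f (boundary Om) y.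
  move=> Ky nCy fy; split => //; have y0 : y != 0.
    by apply/eqP => y0; move/eqP: fy; rewrite y0 pair0 eq_sym oner_eq0.
  have [py pyE] := lifts_line y0; exists py => //; apply/boundaryE; split.
    exact: closed_lift_mem Ky.
  by move=> Oy; apply: nCy; exact: open_lift_of_closed Oy.
eexists; exists f, a, b, u', v'; split => //.
- by split; exact: bnd.
- have tp : 0 < t0 + t1 by rewrite addr_gt0.
  exists (t1 / (t0 + t1)), ((t1 + k) / (t0 + t1)); split.
  + by rewrite divr_gt0.
  + by rewrite ler_pM2r ?invr_gt0 // lerDl.
  + by rewrite ltr_pdivrMr // mul1r; lra.
  + by rewrite /a /b; vfield.
  + by rewrite vE /a /b; vfield.
Qed.

Lemma hilbert_distE p q u v (x z : 'cV[R]_d) : C u -> C v -> lifts p u -> lifts q v ->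
  chord K C x z -> hilbert_dist Om p q = hd K u v.
Proof.
move=> Cu Cv pu qv ch; rewrite /hilbert_dist; case: xgetP => [rho _ h|nh].
  exact: is_hilbert_dist_unique h.
by have [rho h] := is_hilbert_dist_exists Cu Cv pu qv ch; case: (nh rho).
Qed.

(** The sign of the matrix is fixed at one point [e] and cannot change on the convex cone [C]: a
    positive combination of [e] and a point of the other sign would have its image in f = 0. *)
Lemma aut_matrix g : Om !=set0 -> Aut Om g -> exists A, [/\ induces A g,
  forall v, C v -> C (A *m v) & forall v, C v -> C (invmx A *m v)].
Proof.
move=> [p0 Op0] gOm; have [A gA] := pglP g; have uA := gA.1.
have gO p : Om p -> Om (g p) by move=> Op; rewrite -gOm; exists p.
have AO v : cone Om v -> cone Om (A *m v).
  by move=> [p Op pv]; exists (g p); [exact: gO|exact: induces_lifts].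
have [e Ce _] := exists_open_lift Op0.
pose s : R := if `[< C (A *m e) >] then 1 else -1.
have ss : s * s = 1 by rewrite /s; case: asboolP => _; rewrite ?mulr1 // mulrNN mulr1.
have s0 : s != 0 by apply/eqP => E; move: ss; rewrite E mul0r => /eqP; rewrite eq_sym oner_eq0.
have CE : C (s *: (A *m e)).
  rewrite /s; case: asboolP => [|nC]; first by rewrite scale1r.
  by rewrite scaleN1r; have [] := open_lift_sign (AO _ Ce.1).
have CA v : C v -> C (s *: (A *m v)).
  move=> Cv; have cAv : cone Om (s *: (A *m v)) by apply: cone_homog => //; apply: AO; case: Cv.
  have [//|Cn] := open_lift_sign cAv.
  have := CE.2; have := Cn.2; rewrite pairN !pairZ => fn fe.
  pose w := (- (s * pair f (A *m v))) *: e + (s * pair f (A *m e)) *: v.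
  have Cw : C w.
    apply: (cone_addint KC); first exact: (cone_scaleint KC).
    by apply: (cone_scale KC); [exact: ltW|exact: cone_int KC _ Cv].
  have Z : pair f (s *: (A *m w)) = 0.
    by rewrite /w mulmxDr -!scalemxAr pairZ pairD !pairZ; ring.
  have /open_lift_sign[[_]|[_]] : cone Om (s *: (A *m w)).
  - by apply: cone_homog => //; apply: AO; case: Cw.
  - by rewrite Z ltxx.
  - by rewrite pairN Z oppr0 ltxx.
have uA' : s *: A \in unitmx by rewrite unitmxZ ?unitfE.
exists (s *: A); split.
- exact: inducesZ.
- by move=> v Cv; rewrite -scalemxAl; exact: CA.
- move=> v Cv; have [p Op pv] := Cv.1.
  have : (g @` Om) p by rewrite gOm.
  move=> [p' Op' gp']; have [v' Cv' p'v'] := exists_open_lift Op'.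
  have := induces_lifts gA p'v'; rewrite gp' => /(lifts_proportional pv)[a a0 aE].
  have E : invmx (s *: A) *m v = (a^-1 * s) *: v'.
    apply: (can_inj (mulKmx uA')); rewrite mulKVmx // -scalemxAr -scalemxAl aE !scalerA.
    by rewrite -[_ * s * s]mulrA ss mulr1 mulVf // scale1r.
  have as0 : a^-1 * s != 0 by rewrite mulf_neq0 // invr_neq0.
  have [h|h] : 0 < a^-1 * s \/ a^-1 * s < 0 by move: as0; rewrite neq_lt => /orP[]; [right|left].
    by rewrite E; exact: (cone_scaleint KC).
  have : C (s *: (A *m ((- (a^-1 * s)) *: v'))).
    by apply: CA; apply: (cone_scaleint KC); rewrite ?oppr_gt0.
  rewrite scaleNr -E scalemxAl mulmxN mulKVmx // => Cn.
  exfalso; apply: (cone_int0 KC); rewrite -(subrr v); apply: (cone_addint KC) => //.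
  exact: cone_int KC _ Cn.
Qed.

End Lifts.

(** * Morse and contracting properties of a line through the domain *)

Section Line.
Context {R : realType} {d : nat} (Om : set (pspace R d)) (f : 'rV[R]_d).
Hypothesis oOm : open Om.
Hypothesis fc : in_chart f (closure Om).
Local Notation K := (closed_lift Om f).
Local Notation C := (open_lift Om f).
Hypothesis KC : proper_cone K C f.
Implicit Types (p q r : pspace R d) (u v w x z : 'cV[R]_d).

Definition line x z : set (pspace R d) := [set r | exists t, lifts r (x + expR (2 * t) *: z)].

Lemma line_sym x z : line x z = line z x.
Proof.
suff main u v r : line u v r -> line v u r by apply/seteqP; split; exact: main.
move=> [t rt]; exists (- t); rewrite mulrN expRN.
rewrite (_ : _ + _ = (expR (2 * t))^-1 *: (u + expR (2 * t) *: v)); last first.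
  by rewrite scalerDr scalerA mulVf ?scale1r 1?addrC // gt_eqF // expR_gt0.
by apply: lifts_scale; rewrite // invr_neq0 // gt_eqF // expR_gt0.
Qed.

Lemma hd_ge0 u v : C u -> C v -> 0 <= hd K u v.
Proof.
by move=> Cu Cv; have := hd_tri KC Cu Cv Cu; rewrite (hdxx KC) // [hd K v u]hdC; lra.
Qed.

Variables (x z : 'cV[R]_d).
Hypothesis ch : chord K C x z.
Local Notation l := (line x z).

Lemma line_int t : C (x + expR (2 * t) *: z).
Proof. by rewrite -[x]scale1r; apply: (chord_int KC ch); rewrite ?expR_gt0. Qed.

Lemma line_sub : l `<=` Om.
Proof. by move=> r [t rt]; apply: open_lift_mem rt _; exact: line_int. Qed.

Lemma hilbert_dist_lift p q u v : C u -> C v -> lifts p u -> lifts q v ->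
  hilbert_dist Om p q = hd K u v.
Proof. by move=> Cu Cv pu qv; exact: (hilbert_distE oOm fc KC Cu Cv pu qv ch). Qed.

Lemma hilbert_dist_ge0 p q : Om p -> Om q -> 0 <= hilbert_dist Om p q.
Proof.
move=> /(exists_open_lift fc)[u Cu pu] /(exists_open_lift fc)[v Cv qv].
by rewrite (hilbert_dist_lift Cu Cv pu qv) hd_ge0.
Qed.

Lemma hilbert_dist_set_le p q : Om p -> l q ->
  hilbert_dist_set Om p l <= hilbert_dist Om p q.
Proof.
move=> Op lq; apply: ge_inf; last by exists q.
by exists 0 => _ [r lr <-]; apply: hilbert_dist_ge0 => //; exact: line_sub.
Qed.

Lemma hilbert_dist_set_ge p (m : R) : (forall q, l q -> m <= hilbert_dist Om p q) ->
  m <= hilbert_dist_set Om p l.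
Proof.
move=> h; apply: lb_le_inf => [|_ [q lq <-]]; last exact: h.
have [r rE] := lifts_line (int_neq0 KC (line_int 0)).
by exists (hilbert_dist Om p r); exists r => //; exists 0.
Qed.

Lemma exists_lift_fun : exists lf : pspace R d -> 'cV[R]_d,
  forall p, Om p -> C (lf p) /\ lifts p (lf p).
Proof.
suff /choice[lf lfP] : forall p, exists u, Om p -> C u /\ lifts p u by exists lf.
move=> p; have [/(exists_open_lift fc)[u Cu pu]|nO] := pselect (Om p); first by exists u.
by exists 0.
Qed.

Lemma exists_point_fun : exists pt : 'cV[R]_d -> pspace R d, forall u, C u -> lifts (pt u) u.
Proof.
suff /choice[pt ptP] : forall u, exists p, C u -> lifts p u by exists pt.
move=> u; have [Cu|nC] := pselect (C u).
  by have [p pu] := lifts_line (int_neq0 KC Cu); exists p.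
by have [p pu] := lifts_line (int_neq0 KC (line_int 0)); exists p.
Qed.

Lemma lift_line p u : l p -> C u -> lifts p u ->
  exists a b, [/\ 0 < a, 0 < b & u = a *: x + b *: z].
Proof.
move=> [t pt] Cu pu; have [a a0 aE] := lifts_proportional pt pu.
have ap : 0 < a.
  have := int_pair_gt0 KC Cu; rewrite aE pairZ pmulr_lgt0 //.
  exact: (int_pair_gt0 KC (line_int t)).
exists a, (a * expR (2 * t)); split => //; first by rewrite mulr_gt0 ?expR_gt0.
by rewrite aE scalerDr scalerA.
Qed.

Lemma line_lift p a b : 0 < a -> 0 < b -> lifts p (a *: x + b *: z) -> l p.
Proof.
move=> a0 b0 pE; exists (2^-1 * ln (b / a)).
rewrite mulrA divff // mul1r lnK ?posrE ?divr_gt0 //.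
rewrite (_ : _ + _ = a^-1 *: (a *: x + b *: z)); last by vfield.
by apply: lifts_scale; rewrite // invr_neq0 // gt_eqF.
Qed.

Section NoHalfTriangle.
Variables (T : 'M[R]_d) (mu : R) (phi psi : 'rV[R]_d).
Hypothesis bT : biprox K C T x z mu phi psi.
Hypothesis nht : forall y, ~ half_triangle K C x z y.

Lemma line_axis_metric : exists A, axis_metric C
  [set u | exists a b, [/\ 0 < a, 0 < b & u = a *: x + b *: z]] (hd K)
  (axis_depth K x z phi psi) (axis_coord phi psi) (axproj x z phi psi) A.
Proof.
have [axT pT pT'] := bT; have axT' := axis_sym KC axT.
have p0 u := prox_gt0 KC axT pT (v := u); have s0 u := prox_gt0 KC axT' pT' (v := u).
have [phix _ _] := pT; have [psiz _ _] := pT'.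
have phiz := prox_eig axT pT; have psix := prox_eig axT' pT'.
have [A [A0 far pr dep low]] := axis_estimates KC bT nht.
have pE a b : pair phi (a *: x + b *: z) = a by rewrite pairD !pairZ phix phiz mulr1 mulr0 addr0.
have sE a b : pair psi (a *: x + b *: z) = b by rewrite pairD !pairZ psiz psix mulr1 mulr0 add0r.
exists A; split => //.
- by move=> _ [a [b [a0 b0 ->]]]; exact: (chord_int KC ch).
- exact: hdC.
- exact: (hd_tri KC).
- move=> u Cu; exists (pair phi u), (pair psi u).
  by split => //; [exact: p0|exact: s0].
- by move=> u Cu; rewrite /axis_coord /axproj pE sE.
- by move=> u q Cu [a [b [a0 b0 ->]]]; exact: low.
- move=> _ [a [b [a0 b0 ->]]]; rewrite /axis_depth /axproj pE sE (gaugexx KC) ?ln1 ?mulr0 //.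
  exact: (chord_int KC ch).
- move=> _ _ [a [b [a0 b0 ->]]] [a' [b' [a0' b0' ->]]].
  by rewrite /axis_coord !pE !sE (chord_hd KC).
Qed.

Lemma morse_of_no_half_triangle : morse Om l.
Proof.
have [A am] := line_axis_metric; have [lf lfP] := exists_lift_fun.
have [pt ptP] := exists_point_fun.
have bound (lambda e : {nonneg R}) : exists M : {nonneg R},
    forall (a b : R) (c : R -> pspace R d),
    quasi_geodesic Om lambda%:num e%:num a b c -> l (c a) -> l (c b) ->
    forall t, a <= t <= b -> hilbert_dist_set Om (c t) l < M%:num.
  have [l1|l1] := leP 1 lambda%:num; last first.
    (* No quasi-geodesic has such a [lambda], so any value will do. *)
    by exists 0%:nng => a b c [h]; move: l1; rewrite ltNge h.
  have [M M0 Mb] := axis_metric_morse am l1 (ge0 e).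
  exists (NngNum (ltW M0)) => a b c [_ _ ab Oc qg] la lb t tab.
  have Lc s : a <= s <= b -> C (lf (c s)) /\ lifts (c s) (lf (c s)).
    by move=> /Oc/lfP.
  have aab : a <= a <= b by rewrite lexx. have bab : a <= b <= b by rewrite lexx andbT.
  have [Cva va] := Lc _ aab; have [Cvb vb] := Lc _ bab; have [Ct vt] := Lc _ tab.
  have := Mb a b (fun s => lf (c s)) ab.
  move=> /(_ (fun s sab => (Lc s sab).1)) h.
  have CP := am_sub am (am_projL am Ct).
  have {}h := h _ (lift_line la Cva va) (lift_line lb Cvb vb) t tab.
  apply: le_lt_trans (h _); last first.
    move=> s s' sab sab'; have [Cs vs] := Lc _ sab; have [Cs' vs'] := Lc _ sab'.
    by rewrite -(hilbert_dist_lift Cs Cs' vs vs'); exact: qg.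
  rewrite -(hilbert_dist_lift Ct CP vt (ptP _ CP)).
  apply: hilbert_dist_set_le; first exact: Oc.
  have [a' [b' [a0 b0 E]]] := am_projL am Ct.
  by apply: (line_lift a0 b0); rewrite -E; exact: ptP.
have /choice[M MP] : forall le : {nonneg R} * {nonneg R}, exists M : {nonneg R},
    forall (a b : R) (c : R -> pspace R d),
    quasi_geodesic Om le.1%:num le.2%:num a b c -> l (c a) -> l (c b) ->
    forall t, a <= t <= b -> hilbert_dist_set Om (c t) l < M%:num.
  by move=> [la e]; exact: bound.
by exists (fun la e => M (la, e)) => la e; exact: (MP (la, e)).
Qed.

Lemma contracting_of_no_half_triangle : contracting Om l.
Proof.
have [A am] := line_axis_metric; have [pt ptP] := exists_point_fun.
have [B B0 Bb] := axis_metric_contracting am; exists B => //.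
move=> p0 rad Op0 rad0 /= Bl q q' [p [Op pr] [lq qm]] [p' [Op' pr'] [lq' qm']].
have lift := exists_open_lift fc.
have [[u0 C0 p0E] [u Cu pu]] := (lift _ Op0, lift _ Op).
have [[u' Cu' pu'] [v Cv qv]] := (lift _ Op', lift _ (line_sub lq)).
have [v' Cv' qv'] := lift _ (line_sub lq').
have onL w : (exists a b, [/\ 0 < a, 0 < b & w = a *: x + b *: z]) -> C w /\ l (pt w).
  move=> [a [b [a0 b0 ->]]]; have Cw := chord_int KC ch a0 b0; split => //.
  by apply: (line_lift a0 b0); exact: ptP.
rewrite (hilbert_dist_lift Cv Cv' qv qv').
apply: (Bb u0 rad C0 _ u u' v v') => //.
- move=> w /onL[Cw lw]; rewrite -(hilbert_dist_lift C0 Cw p0E (ptP _ Cw)).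
  rewrite leNgt; apply/negP => lt; suff : set0 (pt w) by [].
  by rewrite -Bl; split => //; split => //; exact: line_sub.
- by rewrite -(hilbert_dist_lift C0 Cu p0E pu).
- by rewrite -(hilbert_dist_lift C0 Cu' p0E pu').
- exact: lift_line qv.
- exact: lift_line qv'.
- move=> w /onL[Cw lw]; rewrite -(hilbert_dist_lift Cu Cv pu qv) qm.
  by rewrite -(hilbert_dist_lift Cu Cw pu (ptP _ Cw)) hilbert_dist_set_le.
- move=> w /onL[Cw lw]; rewrite -(hilbert_dist_lift Cu' Cv' pu' qv') qm'.
  by rewrite -(hilbert_dist_lift Cu' Cw pu' (ptP _ Cw)) hilbert_dist_set_le.
Qed.

End NoHalfTriangle.

Section WithHalfTriangle.
Variable y : 'cV[R]_d.
Hypothesis ht : half_triangle K C x z y.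

Lemma half_triangle_not_morse : ~ morse Om l.
Proof.
have [p hs] := half_triangle_strip KC ch ht; have [pt ptP] := exists_point_fun.
move=> [M Mb]; have [lam0 e0] : 0 <= 3 :> R /\ 0 <= 1 :> R by split.
pose lam : {nonneg R} := NngNum lam0; pose e : {nonneg R} := NngNum e0.
have [a [b [c [ab Cc qg [La Lb] [t tab far]]]]] := half_strip_not_morse hs (M lam e)%:num.
have onl s : range (fun s : R => x + expR (2 * s) *: z) (c s) -> l (pt (c s)).
  move=> [s' _ E]; exists s'; rewrite E; apply: ptP; rewrite -E; exact: line_int.
have q : quasi_geodesic Om lam%:num e%:num a b (pt \o c).
  split => //=.
  - by rewrite ler1n.
  - by move=> s /Cc Cs; apply: open_lift_mem (ptP _ Cs) Cs.
  - move=> s s' sab sab'; have [Cs Cs'] := (Cc _ sab, Cc _ sab').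
    by rewrite (hilbert_dist_lift Cs Cs' (ptP _ Cs) (ptP _ Cs')); exact: qg.
have := Mb lam e a b (pt \o c) q (onl _ La) (onl _ Lb) t tab.
rewrite ltNge => /negP; apply; apply: hilbert_dist_set_ge => r [s rs].
have Cs := line_int s; rewrite /= (hilbert_dist_lift (Cc _ tab) Cs (ptP _ (Cc _ tab)) rs).
by apply: far; exists s.
Qed.

Lemma half_triangle_not_contracting : ~ contracting Om l.
Proof.
have [p hs] := half_triangle_strip KC ch ht; have [pt ptP] := exists_point_fun.
move=> [B B0 Bb].
have [u0 [rad [C0 rad0 far [u [u' [v [v' [[Cu Cu'] [ur ur'] [[s _ vE] [s' _ vE']] [vm vm'] big]]]]]]]] :=
  half_strip_not_contracting hs B0.
have Cv : C v by rewrite -vE; exact: line_int.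
have Cv' : C v' by rewrite -vE'; exact: line_int.
have O w (Cw : C w) : Om (pt w) := open_lift_mem (ptP _ Cw) Cw.
have E w w' (Cw : C w) (Cw' : C w') := hilbert_dist_lift Cw Cw' (ptP _ Cw) (ptP _ Cw').
have lv : l (pt v) by exists s; rewrite vE; exact: ptP.
have lv' : l (pt v') by exists s'; rewrite vE'; exact: ptP.
have near w w' : C w -> C w' -> l (pt w') ->
    (forall w'', range (fun s : R => x + expR (2 * s) *: z) w'' -> hd K w w' <= hd K w w'') ->
    nearest_points Om (pt w) l (pt w').
  move=> Cw Cw' lw' h; split => //; apply/le_anti/andP; split.
    apply: hilbert_dist_set_ge => r [t rt]; have Ct := line_int t.
    rewrite (E _ _ Cw Cw') (hilbert_dist_lift Cw Ct (ptP _ Cw) rt).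
    by apply: h; exists t.
  by apply: hilbert_dist_set_le => //; exact: O.
have := Bb (pt u0) rad (O _ C0) rad0; rewrite /= => /(_ _ (pt v) (pt v')) h.
suff : hilbert_dist Om (pt v) (pt v') <= B by rewrite (E _ _ Cv Cv') leNgt big.
apply: h.
- apply/seteqP; split => // r [[Or rr] [t rt]]; have Ct := line_int t.
  move: rr; rewrite (hilbert_dist_lift C0 Ct (ptP _ C0) rt) ltNge => /negP; apply.
  by apply: far; exists t.
- exists (pt u); last exact: near.
  by split; [exact: O|rewrite (E _ _ C0 Cu)].
- exists (pt u'); last exact: near.
  by split; [exact: O|rewrite (E _ _ C0 Cu')].
Qed.

End WithHalfTriangle.
End Line.

(** * Matrices of translations and uniqueness of axes *)

Lemma real_isometry (R : realType) (h : R -> R) : (forall s t, `|h s - h t| = `|s - t|) ->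
  exists e : R, (e = 1 \/ e = -1) /\ forall s, h s = h 0 + e * s.
Proof.
move=> iso.
have sq s t : (h s - h t) ^+ 2 = (s - t) ^+ 2 by rewrite -real_normK ?num_real // iso real_normK ?num_real.
exists (h 1 - h 0); split.
  have := sq 1 0; rewrite subr0 expr1n => /eqP; rewrite sqrf_eq1 => /orP[] /eqP ->; by [left|right].
move=> s; have := sq 1 0; have := sq s 0; have := sq s 1.
rewrite !subr0 expr1n; set a := h s - h 0; set e := h 1 - h 0.
have -> : h s - h 1 = a - e by rewrite /a /e; ring.
move=> h1 h2 h3; have : a * e = s.
  have : a ^+ 2 - 2 * (a * e) + e ^+ 2 = s ^+ 2 - 2 * s + 1.
    have := h1; rewrite (_ : (a - e) ^+ 2 = a ^+ 2 - 2 * (a * e) + e ^+ 2); last by ring.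
    by move=> ->; ring.
  by rewrite h2 h3; lra.
move=> ae; have -> : e * s = a by rewrite -[in LHS]ae mulrCA -expr2 h3 mulr1.
by rewrite /a; ring.
Qed.

Section Translation.
Context {R : realType} {d : nat} (Om : set (pspace R d)) (f : 'rV[R]_d).
Hypothesis oOm : open Om.
Hypothesis fc : in_chart f (closure Om).
Local Notation K := (closed_lift Om f).
Local Notation C := (open_lift Om f).
Hypothesis KC : proper_cone K C f.
Implicit Types (p q r : pspace R d) (u v w x z : 'cV[R]_d) (g : PGL R d).

Lemma chord_indep x z a b : chord K C x z -> a *: x + b *: z = 0 -> a = 0 /\ b = 0.
Proof.
move=> ch E; have K0 := cone0 KC; have chs := chord_sym ch.
have h c c' : c *: x + c' *: z = 0 -> 0 <= c /\ 0 <= c'.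
  move=> E'; split; first by apply: (chord_coef_ge0 KC ch (b := c')); rewrite E'.
  by apply: (chord_coef_ge0 KC chs (b := c)); rewrite addrC E'.
have [a0 b0] := h _ _ E.
have [|a1 b1] := h (- a) (- b); first by rewrite !scaleNr -opprD E oppr0.
by split; lra.
Qed.

(** Both parametrisations of the line are by arc length, so they differ by an isometry of the reals,
    of unknown sign [eps]. Hence [A] multiplies the ratio of the two coordinates by a constant
    [e]. *)
Lemma translation_eigen g A x z : induces A g -> (forall v, C v -> C (A *m v)) ->
  chord K C x z -> acts_by_translation Om g (line x z) ->
  exists l e : R, [/\ 0 < l, 0 < e, e != 1, A *m x = l *: x & A *m z = (l * e) *: z].
Proof.
move=> gA AC ch [gl [c [tau [tau0 cl iso gc]]]].
have Cq t := line_int KC ch t.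
have /choice[h hP] : forall s, exists t, lifts (c s) (x + expR (2 * t) *: z).
  by move=> s; have : line x z (c s) by rewrite -cl; exists s.
have hiso s t : `|h s - h t| = `|s - t|.
  rewrite -iso (hilbert_dist_lift oOm fc KC ch (Cq _) (Cq _) (hP s) (hP t)).
  by rewrite -(scale1r x) (chord_hd KC) ?expR_gt0 // !divr1 !expRK; congr `|_|; field.
have [eps [eps1 hE]] := real_isometry hiso.
pose tau' := eps * tau; have tau'0 : tau' != 0.
  by rewrite /tau'; case: eps1 => ->; rewrite ?mulN1r ?oppr_eq0 ?mul1r gt_eqF.
pose e := expR (2 * tau'); have e0 : 0 < e by exact: expR_gt0.
have e1 : e != 1.
  apply/eqP => /(congr1 (@ln R)); rewrite expRK ln1 => /eqP.
  by rewrite mulf_eq0 (negbTE tau'0) pnatr_eq0.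
have act t : exists k : R, A *m (x + expR (2 * t) *: z) = k *: (x + (expR (2 * t) * e) *: z).
  pose s := eps * (t - h 0).
  have ht : h s = t.
    rewrite hE /s mulrA; have -> : eps * eps = 1 by case: eps1 => ->; ring.
    by rewrite mul1r addrC subrK.
  have hst : h (s + tau) = t + tau' by rewrite -ht hE [h s]hE /tau'; ring.
  have := induces_lifts gA (hP s); rewrite ht gc => h1.
  have := hP (s + tau); rewrite hst => h2.
  have [k _ kE] := lifts_proportional h2 h1; exists k; rewrite kE.
  by rewrite mulrDr expRD.
have act' E : 0 < E -> exists k : R, A *m x + E *: (A *m z) = k *: (x + (E * e) *: z).
  move=> E0; have [k] := act (2^-1 * ln E); rewrite mulrA divff // mul1r lnK ?posrE // => kE.
  by exists k; rewrite scalemxAr -mulmxDr kE.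
(* The ratios 1 and 2 determine [A *m x] and [A *m z]; the ratio 3 then forces [k1 = k2], so that
   [A] is diagonal on this plane. *)
have [k1 h1] := act' 1 ltr01; have [k2 h2] := act' 2 (ltr0Sn R 1).
have [k3 h3] := act' 3 (ltr0Sn R 2).
have Az : A *m z = (k2 - k1) *: x + ((2 * k2 - k1) * e) *: z.
  rewrite [LHS](_ : _ = (A *m x + 2 *: (A *m z)) - (A *m x + 1 *: (A *m z))); last vring.
  by rewrite h1 h2; vring.
have Ax : A *m x = (2 * k1 - k2) *: x + ((2 * k1 - 2 * k2) * e) *: z.
  rewrite [LHS](_ : _ = (A *m x + 1 *: (A *m z)) - 1 *: (A *m z)); last vring.
  by rewrite h1 Az; vring.
have k12 : k1 = k2.
  have [] := @chord_indep x z (2 * k2 - k1 - k3) ((4 * k2 - k1 - 3 * k3) * e) ch.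
    have : A *m x + 3 *: (A *m z) - k3 *: (x + (3 * e) *: z) = 0 by rewrite h3 subrr.
    by rewrite Ax Az => <-; vring.
  move=> i1 /eqP; rewrite mulf_eq0 (gt_eqF e0) orbF => /eqP i2; lra.
have Axz : A *m (x + z) = k1 *: (x + e *: z).
  by rewrite mulmxDr -[A *m z]scale1r h1 mul1r.
exists k1, e; split => //.
- have := int_pair_gt0 KC (AC _ (chord_C ch)); rewrite Axz pairZ pmulr_lgt0 //.
  apply: (int_pair_gt0 KC); rewrite -[x]scale1r; exact: (chord_int KC ch).
- by rewrite Ax -k12; vring.
- by rewrite Az -k12; vring.
Qed.

Lemma axis_of_eigen A x z (l e : R) : A \in unitmx -> (forall v, C v -> C (A *m v)) ->
  (forall v, C v -> C (invmx A *m v)) -> chord K C x z -> 0 < l -> 0 < e < 1 ->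
  A *m x = l *: x -> A *m z = (l * e) *: z -> axis K C (l^-1 *: A) x z e.
Proof.
move=> uA AC AC' [Kx Kz nx nz Cxz] l0 e01 Ax Az; have li : l^-1 \is a GRing.unit.
  by rewrite unitfE invr_neq0 // gt_eqF.
split => //.
- by rewrite unitmxZ.
- by move=> v Cv; rewrite -scalemxAl; apply: (cone_scaleint KC); rewrite ?invr_gt0 //; exact: AC.
- move=> v Cv; rewrite invmxZ ?unitmxZ // invrK -scalemxAl.
  by apply: (cone_scaleint KC) => //; exact: AC'.
- by rewrite -scalemxAl Ax scalerA mulVf ?scale1r // gt_eqF.
- by rewrite -scalemxAl Az scalerA mulrA mulVf ?mul1r // gt_eqF.
Qed.

(** A translation may move towards either end; the attracting one is put first. *)
Lemma translation_axis g A x z : induces A g -> (forall v, C v -> C (A *m v)) ->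
  (forall v, C v -> C (invmx A *m v)) -> chord K C x z ->
  acts_by_translation Om g (line x z) ->
  exists l mu : R, 0 < l /\ (axis K C (l^-1 *: A) x z mu \/ axis K C (l^-1 *: A) z x mu).
Proof.
move=> gA AC AC' ch tr; have [l [e [l0 e0 e1 Ax Az]]] := translation_eigen gA AC ch tr.
have uA := gA.1; move: e1; rewrite neq_lt => /orP[e1|e1].
  by exists l, e; split => //; left; apply: axis_of_eigen; rewrite ?e0.
exists (l * e), e^-1; split; first exact: mulr_gt0.
right; apply: axis_of_eigen => //.
- exact: chord_sym.
- exact: mulr_gt0.
- by rewrite invr_gt0 e0 invf_lt1.
- by rewrite Ax mulfK // gt_eqF.
Qed.

End Translation.

Section AxisUniqueness.
Context {R : realType} {d : nat} (K C : set 'cV[R]_d) (f : 'rV[R]_d).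
Hypothesis KC : proper_cone K C f.
Implicit Types (u v w x z : 'cV[R]_d) (A T : 'M[R]_d).

Lemma axis_eigen A l u v mu : l != 0 -> axis K C (l^-1 *: A) u v mu ->
  A *m u = l *: u /\ A *m v = (l * mu) *: v.
Proof.
move=> l0 ax; have := axis_fix ax; have := axis_eig ax; rewrite -!scalemxAl => h1 h2.
by split; [rewrite -[in RHS]h2|rewrite -scalerA -h1]; rewrite scalerA divff ?scale1r.
Qed.

Lemma scale_invmxZ A l (mu : R) : l != 0 -> A \in unitmx ->
  mu *: invmx (l^-1 *: A) = (l * mu) *: invmx A.
Proof.
move=> l0 uA; rewrite invmxZ ?unitmxZ ?unitfE ?invr_neq0 //.
by rewrite invrK scalerA mulrC.
Qed.

(** An eigenvalue above [l] would make the powers of [l^-1 *: A] unbounded on [u]. *)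
Lemma axis_eigen_le A x z mu (l k : R) u : axis K C (l^-1 *: A) x z mu -> 0 < l -> 0 < k ->
  u != 0 -> A *m u = k *: u -> k <= l.
Proof.
move=> ax l0 k0 u0 Au; have [B B0 Bb] := axis_power_bounded KC ax.
have Tu : (l^-1 *: A) *m u = (k / l) *: u by rewrite -scalemxAl Au scalerA mulrC.
rewrite leNgt; apply/negP => lk.
have [||n _ nb] := @expr_small _ (l / k) B^-1 0%N.
- by rewrite divr_ge0 ?ltW //= ltr_pdivrMr // mul1r.
- by rewrite invr_gt0.
have := Bb n u; rewrite (mulmx_pow_eigen _ Tu) normrZ ler_pM2r ?normr_gt0 //.
have -> : (k / l) ^+ n = ((l / k) ^+ n)^-1 by rewrite -exprVn invf_div.
move: nb; have : 0 < (l / k) ^+ n by rewrite exprn_gt0 // divr_gt0.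
move: (_ ^+ n) => w w0 wB; rewrite gtr0_norm ?invr_gt0 // leNgt.
by rewrite -[B]invrK ltf_pV2 ?posrE ?invr_gt0 // wB.
Qed.

Lemma prox_fixed T x z mu phi u : axis K C T x z mu -> prox T x phi -> T *m u = u ->
  K u -> K x -> u != 0 -> exists2 a : R, 0 < a & u = a *: x.
Proof.
move=> ax pT Tu Ku Kx u0.
have E : u = pair phi u *: x.
  apply/eqP; rewrite -subr_eq0; apply/eqP/mx_eq0_norm => e e0.
  by have [n] := prox_approx pT u e0; rewrite (mulmx_pow_fix _ Tu).
exists (pair phi u) => //; rewrite lt_neqAle (prox_ge0 KC ax pT Ku) andbT eq_sym.
by apply: contra_neq u0 => h; rewrite E h scale0r.
Qed.

(* The axis of a proximal element is spanned by its eigenlines for the extreme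
   eigenvalues, which are simple. *)
Lemma axis_unique A x z mu (l : R) x' z' mu' (l' : R) phi psi :
  0 < l -> 0 < l' ->
  axis K C (l^-1 *: A) x z mu -> biprox K C (l'^-1 *: A) x' z' mu' phi psi ->
  (exists2 a : R, 0 < a & x = a *: x') /\ (exists2 b : R, 0 < b & z = b *: z').
Proof.
move=> l0 l0' ax [ax' pT pT'].
have [ln0 ln0'] : l != 0 /\ l' != 0 by split; rewrite gt_eqF.
have [Ax Az] := axis_eigen ln0 ax; have [Ax' Az'] := axis_eigen ln0' ax'.
have uA : A \in unitmx by have := axis_unit ax; rewrite unitmxZ ?unitfE ?invr_neq0.
have ll : l = l'.
  apply/le_anti; rewrite (axis_eigen_le ax' l0' l0 (axis_neq0 ax) Ax).
  by rewrite (axis_eigen_le ax l0 l0' (axis_neq0 ax') Ax').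
have /andP[mu0 _] := axis_mu ax; have /andP[mu0' _] := axis_mu ax'.
have sx := axis_sym KC ax; have sx' := axis_sym KC ax'.
have inv (k : R) (m : R) : k != 0 -> m *: invmx (k^-1 *: A) = (k * m)^-1^-1 *: invmx A.
  by move=> k0; rewrite invrK scale_invmxZ.
rewrite !inv // in sx sx'.
have lm : 0 < l * mu by rewrite mulr_gt0.
have lm' : 0 < l' * mu' by rewrite mulr_gt0.
have mm : l * mu = l' * mu'.
  apply: invr_inj; apply/le_anti.
  rewrite (axis_eigen_le sx' _ _ (axis_neq0 sx) (invmx_eigen uA Az _)) ?invr_gt0 ?gt_eqF //.
  by rewrite (axis_eigen_le sx _ _ (axis_neq0 sx') (invmx_eigen uA Az' _)) ?invr_gt0 ?gt_eqF.
split.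
  apply: (prox_fixed ax' pT); rewrite -?ll ?(axis_fix ax) ?(axis_neq0 ax) //.
  - exact: axis_K1 ax.
  - exact: axis_K1 ax'.
apply: (prox_fixed (axis_sym KC ax') pT'); rewrite ?(axis_neq0 sx) //.
- by rewrite inv // -mm (axis_fix sx).
- exact: axis_K2 ax.
- exact: axis_K2 ax'.
Qed.

Lemma half_triangle_scale x z w (a b : R) : 0 < a -> 0 < b -> K x -> K z ->
  half_triangle K C (a *: x) (b *: z) w -> half_triangle K C x z w.
Proof.
move=> a0 b0 Kx Kz [Kw w0 n1 n2]; split => // Cw.
  apply: n1; apply: (int_comb KC (a := a^-1) (b := 1)) => //; rewrite ?invr_ge0 ?ltW //.
    by apply: (cone_scale KC) => //; exact: ltW.
  by rewrite scalerA mulVf ?gt_eqF // !scale1r.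
apply: n2; apply: (int_comb KC (a := b^-1) (b := 1)) => //; rewrite ?invr_ge0 ?ltW //.
  by apply: (cone_scale KC) => //; exact: ltW.
by rewrite scalerA mulVf ?gt_eqF // !scale1r.
Qed.

End AxisUniqueness.

(** * Cocompact actions *)

Section ProxCommute.
Context {R : realType} {d : nat} (K C : set 'cV[R]_d) (f : 'rV[R]_d).
Hypothesis KC : proper_cone K C f.
Implicit Types (u v w x z : 'cV[R]_d) (T : 'M[R]_d).

(** If phi(y) > 0, some T^n y is so close to phi(y) x that adding phi(y) z gives an interior point;
    applying T^-n shows that [y] plus a multiple of [z] is interior. *)
Lemma prox_half_triangle T x z mu phi y : axis K C T x z mu -> prox T x phi ->
  half_triangle K C x z y -> pair phi y = 0.
Proof.
move=> axT pT [Ky y0 nx nz]; have axT' := axis_sym KC axT.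
apply/eqP; rewrite eq_le (prox_ge0 KC axT pT Ky) andbT leNgt; apply/negP => py.
have [r r0 rb] := cone_open KC (cone_scaleint KC py (axis_C axT)).
have [n nb] := prox_approx pT y r0.
have := rb _ nb; rewrite scalerDr addrC addrA subrK.
move=> /(int_pow (axis_intV axT) n).
have TTn : invmx T ^+ n *m (T ^+ n *m y) = y.
  elim: n {nb} => [|n IH]; first by rewrite !mulmx_pow0.
  by rewrite [LHS]mulmx_powSr (mulmx_powS T) mulKmx ?IH ?(axis_unit axT).
have /andP[mu0 _] := axis_mu axT.
have Tz : invmx T *m z = mu^-1 *: z.
  by apply: invmx_eigen (axis_unit axT) (axis_eig axT) _; rewrite gt_eqF.
rewrite mulmxDr -scalemxAr TTn (mulmx_pow_eigen _ Tz) scalerA addrC => h.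
apply/nz/(int_comb KC (a := pair phi y * mu^-1 ^+ n) (b := 1) _ _ (axis_K2 axT) Ky) => //.
  by rewrite mulr_ge0 ?exprn_ge0 ?invr_ge0 ?ltW.
by rewrite scale1r.
Qed.

Lemma prox_commute T x phi (B : 'M[R]_d) : prox T x phi -> T *m B = B *m T ->
  B *m (x *m phi) = x *m phi *m B.
Proof.
move=> [_ _ pl] TB; apply/subr0_eq/mx_eq0_norm => e e0.
have L0 : 0 < 2 * (d%:R * `|B|) + 1 by rewrite ltr_wpDl // !mulr_ge0.
have [n nb] := pl (e / (2 * (d%:R * `|B|) + 1)) (divr_gt0 e0 L0).
have TnB : T ^+ n *m B = B *m T ^+ n.
  elim: n {nb} => [|n IH]; first by rewrite !expr0 mul1mx mulmx1.
  by rewrite exprS -mulmxE -mulmxA IH mulmxA TB -mulmxA.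
set P := x *m phi in nb *; set D := T ^+ n - P in nb.
rewrite (_ : _ - _ = D *m B - B *m D); last first.
  by rewrite mulmxBl mulmxBr TnB opprB [RHS]addrC addrA subrK.
apply: le_lt_trans (ler_normB _ _) _.
have h1 := mulmx_norm D B; have h2 := mulmx_norm B D.
move: nb; rewrite ltr_pdivlMr //; move: h1 h2 (normr_ge0 D).
move: `|D| `|B| `|D *m B| `|B *m D| => a b c c' h1 h2 a0 nb; nra.
Qed.

Lemma commute_scale_le1 T x z mu (B : 'M[R]_d) (k : R) : axis K C T x z mu ->
  B \in unitmx -> (forall v, K v -> K (B *m v)) -> T *m B = k *: (B *m T) -> k <= 1.
Proof.
move=> axT uB BK TB; have TBx : T *m (B *m x) = k *: (B *m x).
  by rewrite mulmxA TB -scalemxAl -mulmxA (axis_fix axT).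
have Bx0 : B *m x != 0.
  by apply: contra_neq (axis_neq0 axT) => h; rewrite -(mulKmx uB x) h mulmx0.
have [k0|k0] := leP k 0; first by apply: le_trans k0 _.
have ax1 : axis K C (1^-1 *: T) x z mu by rewrite invr1 scale1r.
exact: (axis_eigen_le KC ax1 ltr01 k0 Bx0 TBx).
Qed.

(** Equality of transformations only yields proportional matrices. B x is an eigenvector of [T] for
    [k], so k <= 1; the reversed axis gives k^-1 <= 1, and k > 0 because B x and T B x are both in
    [K]. *)
Lemma commute_of_scale T x z mu (B : 'M[R]_d) (k : R) : axis K C T x z mu ->
  B \in unitmx -> (forall v, K v -> K (B *m v)) -> k != 0 -> T *m B = k *: (B *m T) ->
  T *m B = B *m T.
Proof.
move=> axT uB BK k0 TB; have uT := axis_unit axT.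
have k1 := commute_scale_le1 axT uB BK TB.
have TB' : (mu *: invmx T) *m B = k^-1 *: (B *m (mu *: invmx T)).
  rewrite -scalemxAl -scalemxAr scalerA mulrC -scalerA; congr (_ *: _).
  apply: (can_inj (mulKmx uT)); rewrite mulKVmx // -scalemxAr.
  by rewrite !mulmxA TB -scalemxAl scalerA mulVf // scale1r mulmxK.
have k1' := commute_scale_le1 (axis_sym KC axT) uB BK TB'.
have kp : 0 < k.
  rewrite lt_neqAle eq_sym k0 /= leNgt; apply/negP => kn.
  have KBx := BK _ (axis_K1 axT).
  have : K (- (B *m x)).
    have := axis_K KC axT KBx; rewrite mulmxA TB -scalemxAl -mulmxA (axis_fix axT).
    move=> /(cone_scale KC (_ : 0 <= - k^-1)); rewrite scalerA mulNr mulVf // scaleN1r.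
    by apply; rewrite oppr_ge0 invr_le0 ltW.
  move=> /(cone_salient KC KBx) h; have /eqP := axis_neq0 axT; apply.
  by rewrite -(mulKmx uB x) h mulmx0.
have kE : k = 1.
  by apply/le_anti; rewrite k1 -[leLHS]invr1 -[leRHS]invrK lef_pV2 ?posrE ?invr_gt0.
by rewrite TB kE scale1r.
Qed.

(** A cone map is controlled by its value at one point: H e <= m H w, which is bounded through H w
    <= c w, and every vector lies between multiples of the order unit [e]. *)
Lemma cone_map_bounded e (m : R) : C e -> exists2 B : R, 0 < B &
  forall (H : 'M[R]_d) w (c : R), (forall v, K v -> K (H *m v)) -> K w -> pair f w = 1 ->
    K (m *: w - e) -> 0 <= c -> K (c *: w - H *m w) -> `|H| <= B * c.
Proof.
move=> Ce; have [k k0 kb] := int_unit KC Ce; have [N N0 Nb] := cone_normal KC.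
have [b b0 bb] := cone_bound KC; have N21 : 0 < 2 * N + 1 by lra.
exists ((2 * N + 1) * k * (N * ((`|m| + 1) * b))).
  by rewrite !mulr_gt0 // ltr_wpDl.
move=> H w c HK Kw fw Kmw c0 Kc.
have He : `|H *m e| <= N * ((`|m| + 1) * b * c).
  apply: le_trans (_ : N * `|((`|m| + 1) * c) *: w| <= _).
    apply: Nb; first exact/HK/(cone_int KC).
    apply: (cone_le_trans KC (v := m *: (H *m w))).
      by have := HK _ Kmw; rewrite mulmxBr -scalemxAr.
    rewrite (_ : _ - _ = (`|m| + 1) *: (c *: w - H *m w) + (`|m| + 1 - m) *: (H *m w)); last vring.
    have mm := ler_norm m.
    apply: (cone_add KC); apply: (cone_scale KC) => //; first lra.
    exact: HK.
  rewrite ler_pM2l // normrZ ger0_norm ?mulr_ge0 //.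
  rewrite mulrAC ler_wpM2r // ler_pM2l ?ltr_wpDl //.
  by have := bb _ Kw; rewrite fw mulr1.
have colb v : `|v| <= 1 -> `|H *m v| <= (2 * N + 1) * k * `|H *m e|.
  move=> v1; have Kev (s : R) : `|s| = 1 -> K (k *: (H *m e) - s *: (H *m v)).
    move=> s1; rewrite !scalemxAr -mulmxBr; apply: HK.
    apply: (cone_le_trans KC (v := (k * `|s *: v|) *: e)); first exact: kb.
    rewrite -scalerBl; apply: (cone_scale KC); last exact: (cone_int KC).
    by rewrite subr_ge0 normrZ s1 mul1r ler_piMr // ltW.
  have h1 := Kev 1 (normr1 R); have h2 := Kev (-1) (normrN1 R).
  rewrite scale1r in h1; rewrite scaleN1r opprK in h2.
  have := Nb _ ((2 * k) *: (H *m e)) h2; rewrite (_ : _ - _ = k *: (H *m e) - H *m v); last vring.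
  move=> /(_ h1) h3.
  have : `|H *m v| <= `|k *: (H *m e) + H *m v| + `|k *: (H *m e)|.
    by rewrite -[X in `|X| <= _](addKr (k *: (H *m e))) addrC; exact: ler_normB.
  move: h3; rewrite !normrZ !ger0_norm ?mulr_ge0 ?(ltW k0) //; lra.
have He0 : `|H *m e| <= N * ((`|m| + 1) * b) * c by rewrite -mulrA.
have Nk0 : 0 <= (2 * N + 1) * k by rewrite mulr_ge0 ?ltW.
rewrite -mulrA; apply: mx_norm_le_col => [|j].
  exact: mulr_ge0 Nk0 (le_trans (normr_ge0 _) He0).
exact: le_trans (colb _ (delta_norm_le1 j)) (ler_wpM2l Nk0 He0).
Qed.

End ProxCommute.

Section DominatedOrbit.
Context {R : realType} {n : nat} (K C : set 'cV[R]_n.+1) (f : 'rV[R]_n.+1).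
Hypothesis KC : proper_cone K C f.
Implicit Types (y : 'cV[R]_n.+1) (M N : 'M[R]_n.+1).

(** For y' the sum of M^i y with i <= n, only M^(n + 1) y is new in M y', and Cayley-Hamilton
    expresses it by the previous terms. The last clause allows a second application, to the inverse
    matrix, without losing the domination obtained first. *)
Lemma dominated_orbit M y : (forall v, K v -> K (M *m v)) -> K y -> y != 0 ->
  exists y', [/\ K y', y' != 0, exists c : R, K (c *: y' - M *m y'),
    forall (r : 'rV[R]_n.+1) (k : R), r *m M = k *: r -> pair r y = 0 -> pair r y' = 0 &
    forall N (c : R), N *m M = M *m N -> K (c *: y - N *m y) -> K (c *: y' - N *m y')].
Proof.
move=> MK Ky y0; have Kpow i : K (M ^+ i *m y) by exact: (cone_pow MK).
have Ksum (I : finType) (F : I -> 'cV[R]_n.+1) : (forall i, K (F i)) -> K (\sum_i F i).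
  move=> KF; elim/big_ind: _ => //; [exact: cone0 KC|exact: cone_add KC].
pose y' := \sum_(i < n.+1) M ^+ i *m y.
have yE : M *m y' = y' + M ^+ n.+1 *m y - y.
  have <- : \sum_(i < n.+2) M ^+ i *m y = y' + M ^+ n.+1 *m y by rewrite big_ord_recr.
  rewrite big_ord_recl mulmx_pow0 [y + _]addrC addrK mulmx_sumr.
  by apply: eq_bigr => i _; rewrite mulmx_powS.
exists y'; split.
- exact: Ksum.
- apply/eqP => y'0; have /eqP := y0; apply; apply: (cone_salient KC Ky).
  have : K (y' - y).
    by rewrite /y' big_ord_recl mulmx_pow0 [y + _]addrC addrK; exact: Ksum.
  by rewrite y'0 sub0r.
- pose p := char_poly M.
  have pE : p = \sum_(i < n.+1) p`_i *: 'X^i + 'X^(n.+1).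
    rewrite -[LHS]coefK poly_def size_char_poly big_ord_recr /=; congr (_ + _).
    have := char_poly_monic M; rewrite monicE lead_coefE size_char_poly /= => /eqP ->.
    by rewrite scale1r.
  have CH : M ^+ n.+1 *m y = - \sum_(i < n.+1) p`_i *: (M ^+ i *m y).
    apply/eqP; rewrite -addr_eq0 addrC; apply/eqP.
    have := congr1 (fun A => A *m y) (Cayley_Hamilton M).
    rewrite mul0mx -/p {1}pE raddfD /= raddf_sum /= mulmxDl mulmx_suml rmorphXn /= horner_mx_X.
    move=> E; rewrite -[RHS]E; congr (_ + _); apply: eq_bigr => i _.
    by rewrite linearZ /= rmorphXn /= horner_mx_X scalemxAl.
  exists (1 + \sum_(i < n.+1) `|p`_i|); rewrite yE CH.
  rewrite (_ : _ - _ = y + \sum_(i < n.+1) (\sum_(j < n.+1) `|p`_j| + p`_i) *: (M ^+ i *m y)).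
    apply: (cone_add KC) => //; apply: Ksum => i; apply: (cone_scale KC) => //.
    rewrite (bigD1 i) //= addrAC addr_ge0 ?sumr_ge0 //.
    by have := ler_norm (- p`_i); rewrite normrN; lra.
  rewrite scalerDl scale1r; under [in RHS]eq_bigr do rewrite scalerDl.
  rewrite big_split /= -scaler_sumr -/y'; set a := \sum_(i < n.+1) p`_i *: _.
  move: (_ *: y') a => b a; rewrite !opprD !opprK !addrA [y' + b]addrC addrK.
  by rewrite addrAC [b + y]addrC.
- move=> r k rM ry; rewrite /pair mulmx_sumr summxE; apply: big1 => i _.
  rewrite -/(pair r _); elim: (i : nat) => [|j IH]; first by rewrite mulmx_pow0.
  by rewrite mulmx_powS pairM rM pairZl IH mulr0.
- move=> N c NM KN; rewrite (_ : _ - _ = \sum_(i < n.+1) M ^+ i *m (c *: y - N *m y)).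
    by apply: Ksum => i; exact: (cone_pow MK).
  rewrite scaler_sumr mulmx_sumr -sumrB; apply: eq_bigr => i _.
  rewrite mulmxBr -scalemxAr; congr (_ - _); rewrite !mulmxA; congr (_ *m _).
  elim: (i : nat) => [|j IH]; first by rewrite !expr0 mulmx1 mul1mx.
  by rewrite exprS -mulmxE mulmxA NM -mulmxA IH mulmxA.
Qed.

End DominatedOrbit.

Section DiscreteAction.
Context {R : realType} {n : nat}.
Local Notation d := n.+1.
Implicit Types (p q : pspace R d) (v w : 'cV[R]_d) (A B : 'M[R]_d) (g h : PGL R d).

(** Every nonzero vector is an eigenvector of A^-1 B; comparing the basis vectors with the vector of
    all ones shows that the eigenvalues agree. *)
Lemma induces_proportional A B (g : pspace R d -> pspace R d) :
  induces A g -> induces B g -> exists2 k : R, k != 0 & B = k *: A.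
Proof.
move=> gA gB; have uA := gA.1.
have eig v : exists k, v != 0 -> k != 0 /\ B *m v = k *: (A *m v).
  have [->|v0] := eqVneq v 0; first by exists 0; rewrite eqxx.
  have [p pv] := lifts_line v0.
  have [k k0 kE] := lifts_proportional (induces_lifts gA pv) (induces_lifts gB pv).
  by exists k.
have {eig}/choice[k kP] := eig.
pose Q := invmx A *m B.
have QE v : v != 0 -> Q *m v = k v *: v.
  by move=> /kP[_ Bv]; rewrite -mulmxA Bv -scalemxAr mulKmx.
have dj (j : 'I_d) : (delta_mx j 0 : 'cV[R]_d) != 0.
  by apply/eqP => /matrixP/(_ j 0); rewrite !mxE !eqxx; apply/eqP; rewrite oner_eq0.
have c1 : (const_mx 1 : 'cV[R]_d) != 0.
  by apply/eqP => /matrixP/(_ 0 0); rewrite !mxE; apply/eqP; rewrite oner_eq0.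
have Qd i j : Q i j = k (delta_mx j 0) *+ (i == j).
  have := congr1 (fun u : 'cV[R]_d => u i 0) (QE _ (dj j)); rewrite -colE !mxE => ->.
  by rewrite eqxx andbT mulr_natr.
exists (k (const_mx 1)); first by have [] := kP _ c1.
apply: (can_inj (mulKmx (_ : invmx A \in unitmx))); first by rewrite unitmx_inv.
rewrite -scalemxAr mulVmx //; apply/matrixP => i j; rewrite [LHS]Qd !mxE.
have := congr1 (fun u : 'cV[R]_d => u j 0) (QE _ c1); rewrite !mxE mulr1 => <-.
rewrite (bigD1 j) //= big1 => [|l lj]; last by rewrite Qd eq_sym (negbTE lj) mul0r.
by rewrite Qd mxE eqxx mulr1 addr0 mulr_natr.
Qed.

Lemma discrete_near1 (Gamma : set (PGL R d)) : discrete_subgroup Gamma ->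
  exists2 e : R, 0 < e & forall h A, Gamma h -> induces A h -> `|A - 1%:M| < e -> h = 1%g.
Proof.
move=> [gcl iso]; have G1 : Gamma 1%g by apply: set_mem; case: gcl.
have [_ [V [U [oU U1 UV]] VG]] := iso _ G1.
have oM : open [set A : 'M[R]_d | exists2 g, U g & induces A g] := oU.
have /oM : [set A : 'M[R]_d | exists2 g, U g & induces A g] 1%:M.
  by exists 1%g => //; exact: induces1.
rewrite -nbhs_ballE => -[e e0 eU]; exists e => // h A Gh hA Ae.
have [h' Uh' h'A] : exists2 g, U g & induces A g.
  by apply: eU; rewrite mx_norm_ball /ball_ /= distrC.
have -> : h = h' by apply/pgl_ext/(induces_inj hA h'A).
suff : [set 1%g] h' by [].
rewrite -VG; split; first exact: UV.
by have <- : h = h' by apply/pgl_ext/(induces_inj hA h'A).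
Qed.

Lemma induces_invg A g : induces A g -> induces (invmx A) (g^-1)%g.
Proof.
move=> gA; have [h [hA _ gh]] := inducesV gA.
suff <- : h = pgl_fun (g^-1)%g by [].
apply/funext => p; have := congr1 (fun k : PGL R d => pgl_fun k (h p)) (mulVg g).
by move=> /= <-; congr (pgl_fun _ _); rewrite -[LHS]/((pgl_fun g \o h) p) gh.
Qed.

End DiscreteAction.

Section Cocompact.
Context {R : realType} {n : nat}.
Local Notation d := n.+1.
Variables (Om : set (pspace R d)) (f : 'rV[R]_d).
Hypothesis oOm : open Om.
Hypothesis fc : in_chart f (closure Om).
Local Notation K := (closed_lift Om f).
Local Notation C := (open_lift Om f).
Hypothesis KC : proper_cone K C f.
Implicit Types (p q : pspace R d) (v w x z y : 'cV[R]_d) (M N A B T : 'M[R]_d) (g h : PGL R d).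

(** Each point has its own constant, and a strictly larger one makes the domination an open
    condition, valid near the point; compactness then gives one constant, here through a cluster
    point of counterexamples. *)
Lemma compact_dominated (Q : set (pspace R d)) M N : compact Q -> Q `<=` Om ->
  (forall w, C w -> C (M *m w)) ->
  exists k : R, forall p w, Q p -> lifts p w -> C w -> K (k *: (M *m w) - N *m w).
Proof.
move=> cQ QO MC; apply: contrapT => nk.
have /choice[s sP] : forall k : nat, exists pw : pspace R d * 'cV[R]_d,
    [/\ Q pw.1, lifts pw.1 pw.2, C pw.2 & ~ K (k%:R *: (M *m pw.2) - N *m pw.2)].
  move=> k; apply: contrapT => nh; apply: nk; exists k%:R => p w Qp pw Cw.
  by apply: contrapT => nK; apply: nh; exists (p, w).
have [|p [Qp clp]] := cQ ((fst \o s) @ \oo) _.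
  by apply: (@filterE _ \oo) => k /=; have [] := sP k.
have [w Cw pw] := exists_open_lift fc (QO _ Qp).
have [k0 k00 Kk0] := int_unit1 KC (N *m w) (MC _ Cw).
pose m := (Num.Def.archi_bound k0).+1.
have mk : k0 < m%:R.
  by apply: lt_trans (archi_boundP (ltW k00)) _; rewrite ltr_nat.
have CL : C ((m%:R *: M - N) *m w).
  rewrite mulmxBl -scalemxAl (_ : _ - _ = (m%:R - k0) *: (M *m w) + (k0 *: (M *m w) - N *m w)); last vring.
  by apply: (cone_addint KC) => //; apply: (cone_scaleint KC); [rewrite subr_gt0|exact: MC].
pose U := [set q | exists w', [/\ lifts q w', C w' & C ((m%:R *: M - N) *m w')]].
have oU : open (cone U).
  rewrite openE => v [q [w' [qw' Cw' CLw']] qv]; have [a a0 vE] := lifts_proportional qw' qv.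
  have [e1 e10 h1] := cone_open KC Cw'; have [e2 e20 h2] := cone_open KC CLw'.
  have L0 : 0 < d%:R * `|m%:R *: M - N| + 1 by rewrite ltr_wpDl // mulr_ge0.
  pose r := Num.min (`|a| * e1) (`|a| * (e2 / (d%:R * `|m%:R *: M - N| + 1))).
  have r0 : 0 < r by rewrite lt_min !mulr_gt0 ?normr_gt0 ?invr_gt0.
  apply/nbhs_ballP; exists r => // v'; rewrite mx_norm_ball /ball_ /= lt_min.
  have E : a^-1 *: v' = w' + a^-1 *: (v' - v).
    by rewrite scalerBr [in RHS]vE scalerA mulVf // scale1r addrC subrK.
  have lt_scaled (c : R) : `|v - v'| < `|a| * c -> `|a^-1 *: (v' - v)| < c.
    by rewrite normrZ normfV distrC -ltr_pdivrMl ?normr_gt0.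
  move=> /andP[/lt_scaled/h1 C1 /lt_scaled b2].
  have C2 : C ((m%:R *: M - N) *m (a^-1 *: v')).
    rewrite E mulmxDr; apply: h2; apply: le_lt_trans (mulmx_norm _ _) _.
    move: b2; rewrite ltr_pdivlMr //; apply: le_lt_trans.
    by rewrite mulrC ler_wpM2l // lerDl.
  rewrite -E in C1; have av0 := int_neq0 KC C1.
  have [q' q'v'] := lifts_line av0.
  exists q'; first by exists (a^-1 *: v').
  by rewrite -[v'](scalerKV a0); exact: lifts_scale.
have [||q [[k mk' <-] [w' [qw' Cw' CLw']]]] := clp [set (s k).1 | k in [set k | (m <= k)%N]] U.
- by exists m => // k /= mk'; exists k.
- by exists U; split => //; exists w.
have [_ sw Csw] := sP k; apply.
have [a a0 aE] := lifts_proportional qw' sw.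
have ap : 0 < a.
  have := int_pair_gt0 KC Csw; rewrite aE pairZ pmulr_lgt0 //; exact: int_pair_gt0 KC _ Cw'.
rewrite aE -!scalemxAr (_ : _ - _ = (a * (k%:R - m%:R)) *: (M *m w') + a *: ((m%:R *: M - N) *m w')).
  apply: (cone_add KC); apply: (cone_scale KC); rewrite ?(ltW ap) //.
  - by rewrite mulr_ge0 ?(ltW ap) // subr_ge0 ler_nat.
  - exact/(cone_int KC)/MC.
  - exact: cone_int KC _ CLw'.
by rewrite mulmxBl -scalemxAl; vring.
Qed.

(** All data moving [v] into the compact set are packed into one tuple, so that a single use of
    [choice] serves a whole sequence of points. *)
Lemma cocompact_lift (Gamma : set (PGL R d)) (Q : set (pspace R d)) v :
  Gamma `<=` Aut Om -> Q `<=` Om -> Om `<=` \bigcup_(g in Gamma) (g @` Q) -> C v ->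
  exists s : ('M[R]_d * PGL R d) * (pspace R d * 'cV[R]_d * R), [/\ Gamma s.1.2,
    induces s.1.1 s.1.2, forall u, C u -> C (s.1.1 *m u), forall u, C u -> C (invmx s.1.1 *m u) &
    [/\ Q s.2.1.1, lifts s.2.1.1 s.2.1.2, C s.2.1.2, pair f s.2.1.2 = 1 &
     0 < s.2.2 /\ s.1.1 *m s.2.1.2 = s.2.2 *: v]].
Proof.
move=> GA QO cov Cv; have [r rv] := lifts_line (int_neq0 KC Cv).
have Or := open_lift_mem rv Cv.
have [g Gg [q Qq gq]] := cov _ Or.
have [G [gG CG CG']] := aut_matrix fc KC (ex_intro _ _ Or) (GA _ Gg).
have [u Cu qu] := exists_open_lift fc (QO _ Qq); have fu := int_pair_gt0 KC Cu.
pose w := (pair f u)^-1 *: u.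
have Cw : C w by apply: (cone_scaleint KC); rewrite ?invr_gt0.
have qw : lifts q w by apply: lifts_scale => //; rewrite invr_neq0 // gt_eqF.
have := induces_lifts gG qw; rewrite gq => /(lifts_proportional rv)[a a0 aE].
have ap : 0 < a.
  have := int_pair_gt0 KC (CG _ Cw); rewrite aE pairZ pmulr_lgt0 //; exact: int_pair_gt0 KC _ Cv.
exists ((G, g), ((q, w), a)); split => //; split => //=.
by rewrite pairZ mulVf // gt_eqF.
Qed.

(* The conjugates of [T] by the group elements moving [p i] into the compact set are
   bounded, so discreteness makes infinitely many of them equal, and the quotients
   of the corresponding group elements commute with [T]. *)
Lemma cocompact_dominated (Gamma : set (PGL R d)) g T x z mu phi psi (p : nat -> 'cV[R]_d) (c : R) :
  discrete_subgroup Gamma -> Gamma `<=` Aut Om -> divides Gamma Om -> Gamma g ->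
  induces T g -> biprox K C T x z mu phi psi -> 0 <= c -> (forall i, C (p i)) ->
  (forall i, K (c *: p i - T *m p i)) -> (forall i, K (c *: p i - invmx T *m p i)) ->
  exists k : R, forall j : nat, exists2 i, (j <= i)%N & K (k *: axproj x z phi psi (p i) - p i).
Proof.
move=> disc GA [Q [cQ QO cov]] Gg gT bT c0 Cp KT KT'; have [axT pT pT'] := bT.
have /choice[s sP] : forall i, _ := fun i => cocompact_lift GA QO cov (Cp i).
pose G i := (s i).1.1; pose ga i := (s i).1.2; pose w i := (s i).2.1.2; pose a i := (s i).2.2.
have Gga i : Gamma (ga i) by have [] := sP i.
have gaG i : induces (G i) (ga i) by have [] := sP i.
have GC i u : C u -> C (G i *m u) by have [_ _ h _ _] := sP i; exact: h.
have GC' i u : C u -> C (invmx (G i) *m u) by have [_ _ _ h _] := sP i; exact: h.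
have uG i : G i \in unitmx by have [] := gaG i.
have [Cw fw a0 Gw] : [/\ forall i, C (w i), forall i, pair f (w i) = 1, forall i, 0 < a i &
    forall i, G i *m w i = a i *: p i].
  by split => i; have [_ _ _ _ [_ _ h1 h2 [h3 h4]]] := sP i.
have Qw M N := @compact_dominated Q M N cQ QO.
have uT := axis_unit axT.
have e0C := axis_C axT; have GK i := cone_map KC e0C (GC i); have GK' i := cone_map KC e0C (GC' i).
have [|m0 m0P] := Qw 1%:M ((x + z) *m f); first by move=> v; rewrite mul1mx.
have Km i : K (m0 *: w i - (x + z)).
  have [_ _ _ _ [h1 h2 h3 h4 _]] := sP i.
  by have := m0P _ _ h1 h2 h3; rewrite mul1mx mulmx_pair h4 scale1r.
have [B B0 Bb] := cone_map_bounded KC m0 e0C.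
have bdd S i : (forall v, K v -> K (S *m v)) -> K (c *: p i - S *m p i) ->
    `|invmx (G i) *m S *m G i| <= B * c.
  move=> SK KS; apply: Bb (Km i) c0 _ => //.
  - by move=> v Kv; rewrite -!mulmxA; apply/GK'/SK/GK.
  - exact: cone_int KC _ (Cw i).
  rewrite -!mulmxA Gw -!scalemxAr -[w i](mulKmx (uG i)) Gw -!scalemxAr scalerA mulrC -scalerA -scalerBr.
  apply: (cone_scale KC); first exact: ltW.
  by rewrite scalemxAr -mulmxBr; exact: GK'.
pose H i := invmx (G i) *m T *m G i; pose H' i := invmx (G i) *m invmx T *m G i.
have HB i : `|H i| <= B * c by apply: bdd => //; exact: (axis_K KC axT).
have HB' i : `|H' i| <= B * c.
  by apply: bdd => //; exact: (cone_map KC e0C (axis_intV axT)).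
have HH i : H i *m H' i = 1%:M.
  by rewrite /H /H' !mulmxA mulmxK // mulmxK // mulVmx.
have [S Scl] := bounded_seq_cluster HB; have [e e0 eP] := discrete_near1 disc.
have L0 : 0 < 2 * (d%:R * (B * c)) + 1 by rewrite ltr_wpDl // !mulr_ge0 // ltW.
(* Two conjugates within this distance of [S] have a quotient within [e] of the identity, since
   [B * c] bounds the inverses [H']. *)
have d0 : 0 < e / (2 * (d%:R * (B * c)) + 1) by rewrite divr_gt0.
have [i0 _ i0b] := Scl _ 0%N d0.
pose E := x *m phi + z *m psi.
have EE v : E *m v = axproj x z phi psi v by rewrite mulmxDl !mulmx_pair.
(* [k] depends on the fixed index [i0] only; [b] below, which commutes with the projection [E],
   carries the bound from [G i0] to [G i]. *)
have [|k kP] := Qw (E *m G i0) (G i0).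
  by move=> u Cu; rewrite -mulmxA EE; apply: (axproj_int KC bT); exact: GC.
exists k => j; have [i ji ib] := Scl _ j d0; exists i => //.
have gcl : group_closed [in Gamma] by case: disc.
have GI h : Gamma h -> Gamma (h^-1)%g.
  by move=> Gh; apply/set_mem/(group_closedV gcl)/mem_set.
have GM h h' : Gamma h -> Gamma h' -> Gamma (h * h')%g.
  by move=> Gh Gh'; apply/set_mem/(group_closedM gcl); exact/mem_set.
pose h := (((ga i)^-1 * g * ga i) * ((ga i0)^-1 * g^-1 * ga i0))%g.
have Gh : Gamma h.
  have Gc g' l : Gamma g' -> Gamma ((ga l)^-1 * g' * ga l)%g by move=> Gg'; exact: GM (GM _ _ (GI _ (Gga l)) Gg') (Gga l).
  exact: GM (Gc _ _ Gg) (Gc _ _ (GI _ Gg)).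
have hH : induces (H i *m H' i0) h.
  have conj A g' l : induces A g' ->
      induces (invmx (G l) *m A *m G l) ((ga l)^-1 * g' * ga l)%g.
    move=> Ag'; apply: (@inducesM _ _ _ _ ((ga l)^-1 * g')%g (ga l)) => //.
    exact: (@inducesM _ _ _ _ ((ga l)^-1)%g g' (induces_invg (gaG l))).
  apply: (@inducesM _ _ _ _ ((ga i)^-1 * g * ga i)%g ((ga i0)^-1 * g^-1 * ga i0)%g).
    exact: conj.
  exact/conj/induces_invg.
have h1 : h = 1%g.
  apply: (eP _ _ Gh hH); rewrite -(HH i0) -mulmxBl.
  apply: le_lt_trans (mulmx_norm _ _) _.
  have n1 : `|H i - H i0| < 2 * (e / (2 * (d%:R * (B * c)) + 1)).
    by have := ler_distD S (H i) (H i0); rewrite [`|S - H i0|]distrC; lra.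
  apply: le_lt_trans (_ : d%:R * (2 * (e / (2 * (d%:R * (B * c)) + 1))) * (B * c) < e).
    by apply: ler_pM => //; rewrite ler_wpM2l // ltW.
  rewrite (_ : _ * _ = e * (2 * (d%:R * (B * c))) / (2 * (d%:R * (B * c)) + 1)); last by ring.
  by rewrite ltr_pdivrMr // mulrDr mulr1 ltrDl.
have [kap kap0 kapE] : exists2 kap : R, kap != 0 & H i = kap *: H i0.
  have id1 : induces 1%:M (1%g : PGL R d) by exact: induces1.
  rewrite h1 in hH; have [kap kap0 kE] := induces_proportional id1 hH; exists kap => //.
  by rewrite -[LHS]mulmx1 -(mulmx1C (HH i0)) mulmxA kE -scalemxAl mul1mx.
(* Equality of the two conjugates means that [b] commutes with [T] up to the scalar [kap]. *)
pose b := G i *m invmx (G i0).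
have ub : b \in unitmx by rewrite unitmx_mul unitmx_inv !uG.
have bC v : C v -> C (b *m v) by move=> Cv; rewrite -mulmxA; apply/GC/GC'.
have bK := cone_map KC e0C bC.
have Tb : T *m b = b *m T.
  apply: (commute_of_scale KC axT ub bK kap0).
  have : G i *m H i *m invmx (G i0) = kap *: (b *m T).
    rewrite kapE -scalemxAr -scalemxAl; congr (_ *: _).
    by rewrite /H /b !mulmxA mulmxK.
  by move=> <-; rewrite /H /b !mulmxA mulmxV // mul1mx.
have Tb' : mu *: invmx T *m b = b *m (mu *: invmx T).
  rewrite -scalemxAl -scalemxAr; congr (_ *: _).
  by apply: (can_inj (mulKmx uT)); rewrite mulKVmx // mulmxA Tb mulmxK.
have Eb : E *m b = b *m E.
  by rewrite mulmxDl mulmxDr (prox_commute pT Tb) (prox_commute pT' Tb').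
have [_ _ _ _ [q1 q2 q3 _ _]] := sP i.
have := bK _ (kP _ _ q1 q2 q3); rewrite -/(w i) mulmxBr -scalemxAr !mulmxA -Eb -!mulmxA.
rewrite mulKmx // Gw -!scalemxAr EE scalerA mulrC -scalerA -scalerBr.
move=> /(cone_scale KC (_ : 0 <= (a i)^-1)); rewrite scalerA mulVf ?gt_eqF // scale1r.
by apply; rewrite invr_ge0 ltW.
Qed.

(* After replacing a half triangle vertex [y] by one with [T y] and [T^-1 y] dominated by
   [y], the points [x + z + i y] escape from the axis at bounded cost for [T], against
   the previous lemma. *)
Lemma divides_no_half_triangle (Gamma : set (PGL R d)) g T x z mu phi psi :
  discrete_subgroup Gamma -> Gamma `<=` Aut Om -> divides Gamma Om -> Gamma g ->
  induces T g -> biprox K C T x z mu phi psi -> forall y, ~ half_triangle K C x z y.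
Proof.
move=> disc GA div Gg gT bT y0 ht; have [axT pT pT'] := bT.
have axT' := axis_sym KC axT; have uT := axis_unit axT; have /andP[mu0 mu1] := axis_mu axT.
have py0 := prox_half_triangle KC axT pT ht.
have sy0 := prox_half_triangle KC axT' pT' (half_triangle_sym ht).
have [Ky0 /eqP y0n _ _] := ht; have [phix phiT _] := pT; have [psiz psiT' _] := pT'.
have TK := axis_K KC axT; have SK := cone_map KC (axis_C axT) (axis_intV axT).
have psiT : psi *m T = mu *: psi.
  by rewrite -{1}psiT' -scalemxAr -scalemxAl -mulmxA mulVmx // mulmx1.
have psiS : psi *m invmx T = mu^-1 *: psi.
  by rewrite -[in RHS]psiT' -scalemxAr scalerA mulVf ?scale1r // gt_eqF.
have phiS : phi *m invmx T = phi by rewrite -{1}phiT -mulmxA mulmxV // mulmx1.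
have [y1 [Ky1 y1n [c1 K1] r1 _]] := dominated_orbit KC TK Ky0 y0n.
have [y [Ky yn [c2 K2] r2 N2]] := dominated_orbit KC SK Ky1 y1n.
have K1' : K (c1 *: y - T *m y) by apply: N2 K1; rewrite mulmxV // mulVmx.
have py : pair phi y = 0.
  by apply: (r2 _ 1); rewrite ?phiS ?scale1r //; apply: (r1 _ 1); rewrite ?phiT ?scale1r.
have sy : pair psi y = 0.
  by apply: (r2 _ mu^-1) => //; apply: (r1 _ mu).
(* One constant for [T] and its inverse: 1 serves [x], [mu^-1] serves [z], and [c1], [c2] serve
   [y]. *)
pose c := 1 + `|c1| + `|c2| + mu^-1; pose p (i : nat) := x + z + i%:R *: y.
have mi : 0 < mu^-1 by rewrite invr_gt0.
have [h1 h2] := (ler_norm c1, ler_norm c2).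
have [n1 n2] := (normr_ge0 c1, normr_ge0 c2).
have Kc (M : 'M[R]_d) (b a : R) (i : nat) : M *m x = x -> M *m z = a *: z -> a <= c ->
    b <= c -> K (b *: y - M *m y) -> K (c *: p i - M *m p i).
  move=> Mx Mz ac bc KM; rewrite /p !mulmxDr -scalemxAr Mx Mz.
  rewrite (_ : _ - _ = (c - 1) *: x + (c - a) *: z + i%:R *: ((c - b) *: y + (b *: y - M *m y))); last vring.
  have cx : 1 <= c by rewrite /c; lra.
  have Ky' : K ((c - b) *: y + (b *: y - M *m y)).
    by apply: (cone_add KC) => //; apply: (cone_scale KC); rewrite ?subr_ge0.
  apply: (cone_add KC); last exact: (cone_scale KC).
  by apply: (cone_add KC); apply: (cone_scale KC); rewrite ?subr_ge0 //;
    [exact: axis_K1 axT|exact: axis_K2 axT].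
have Cp i : C (p i).
  by apply: (cone_addint KC); [exact: axis_C axT|exact: (cone_scale KC)].
have Tz := axis_eig axT; have Tx := axis_fix axT.
have [[c0 c1c] [c2c [muc mic]]] : (0 <= c /\ c1 <= c) /\ (c2 <= c /\ mu <= c /\ mu^-1 <= c).
  by rewrite /c; do ![split]; lra.
have [||k kP] := cocompact_dominated disc GA div Gg gT bT c0 Cp.
- by move=> i; apply: (Kc T c1 mu i).
- move=> i; apply: (Kc (invmx T) c2 mu^-1 i) => //.
  + by rewrite -[in LHS]Tx mulKmx.
  + by apply: invmx_eigen; rewrite // gt_eqF.
(* All [p i] project to x + z, so the bound p_i <= k (x + z) says that y <= ((k - 1) / i) (x + z),
   which for large [i] is below the gauge of [y]. *)
have ga0 := gauge_gt0 KC Ky yn (axis_C axT); set ga := gauge _ _ _ in ga0.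
have [i ji Ki] := kP (Num.Def.archi_bound (`|k| / ga)).+1.
have bi : `|k| / ga < i%:R.
  have := archi_boundP (_ : 0 <= `|k| / ga); rewrite divr_ge0 ?(ltW ga0) // => /(_ isT).
  by move=> /lt_le_trans; apply; rewrite ler_nat ltnW.
have ip : 0 < i%:R :> R by apply: le_lt_trans bi; rewrite divr_ge0 // (ltW ga0).
have : ga <= (k - 1) / i%:R.
  apply: (gauge_le KC Ky (axis_C axT)).
  move: Ki; rewrite /axproj /p !pairD !pairZ phix psiz py sy.
  rewrite (prox_eig axT pT) (prox_eig axT' pT') !mulr0 !addr0 add0r !scale1r => Ki.
  have := cone_scale KC (_ : 0 <= i%:R^-1) Ki; rewrite invr_ge0 (ltW ip) => /(_ isT).
  rewrite (_ : i%:R^-1 *: _ = ((k - 1) / i%:R) *: (x + z) - y) //.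
  by vfield.
rewrite ler_pdivlMr //; move: bi; rewrite ltr_pdivrMr // mulrC.
have := ler_norm k; lra.
Qed.

End Cocompact.

(** * Passage between group elements and normalised axes, and the theorem *)

Section Translations.
Context {R : realType} {n : nat}.
Local Notation d := n.+1.
Variables (Om : set (pspace R d)) (f : 'rV[R]_d).
Hypothesis oOm : open Om.
Hypothesis fc : in_chart f (closure Om).
Local Notation K := (closed_lift Om f).
Local Notation C := (open_lift Om f).
Hypothesis KC : proper_cone K C f.
Implicit Types (u v w : 'cV[R]_d) (A T : 'M[R]_d) (g : PGL R d).

Lemma translates_axis g A x z : induces A g -> (forall v, C v -> C (A *m v)) ->
  (forall v, C v -> C (invmx A *m v)) -> translates_along Om g x z ->
  exists u v (l mu : R), [/\ 0 < l, axis K C (l^-1 *: A) u v mu,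
    open_segment Om x z = line u v &
    in_half_triangle Om x z <-> exists w, half_triangle K C u v w].
Proof.
move=> gA CA CA' [geo tr]; have [u [v [xu zv ch]]] := geodesic_chord oOm fc KC geo.
have segE : open_segment Om x z = line u v.
  by apply/seteqP; split => r /(open_segmentE fc KC _ xu zv ch).
rewrite segE in tr *; have htE := in_half_triangleE oOm fc KC xu zv ch.
have [l [mu [l0 [ax|ax]]]] := translation_axis oOm fc KC gA CA CA' ch tr.
  by exists u, v, l, mu.
exists v, u, l, mu; split => //; first exact: line_sym.
by rewrite htE; split => -[w /half_triangle_sym]; exists w.
Qed.

Lemma biprox_of_no_half_triangle T u v mu : axis K C T u v mu ->
  (forall w, ~ half_triangle K C u v w) -> exists phi psi, biprox K C T u v mu phi psi.
Proof.
move=> ax nht; have [phi pT] := prox_of_no_half_triangle KC ax nht.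
have [w /half_triangle_sym/nht//|psi pT'] := prox_of_no_half_triangle KC (axis_sym KC ax).
by exists phi, psi.
Qed.

Lemma biproximal_of_biprox g A l u v mu phi psi : induces A g -> 0 < l ->
  biprox K C (l^-1 *: A) u v mu phi psi -> biproximal g.
Proof.
move=> gA l0 [ax pT pT']; have ln0 : l != 0 by rewrite gt_eqF.
have [Au Av] := axis_eigen ln0 ax; have /andP[mu0 _] := axis_mu ax.
exists A; split => //; first exact: prox_unique_max ln0 (axis_neq0 ax) Au pT.
rewrite scale_invmxZ ?gA.1 // in pT'.
apply: prox_unique_min gA.1 _ (axis_neq0 (axis_sym KC ax)) Av pT'.
by rewrite mulf_neq0 // gt_eqF.
Qed.

Lemma biprox_of_biproximal g A l u v mu : induces A g -> 0 < l ->
  axis K C (l^-1 *: A) u v mu -> biproximal g ->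
  exists phi psi, biprox K C (l^-1 *: A) u v mu phi psi.
Proof.
move=> gA l0 ax [A' [gA' umax umin]]; have ln0 : l != 0 by rewrite gt_eqF.
have [Au Av] := axis_eigen ln0 ax; have /andP[mu0 _] := axis_mu ax.
have [k k0 A'E] := induces_proportional gA gA'; have kl0 : k * l != 0 by rewrite mulf_neq0.
have TE : (k * l)^-1 *: A' = l^-1 *: A.
  by rewrite A'E scalerA invfM mulrAC mulVf // mul1r.
have TE' : (k * l * mu) *: invmx A' = mu *: invmx (l^-1 *: A).
  by rewrite -TE scale_invmxZ // gA'.1.
have [B _ Bb] := axis_power_bounded_mx KC ax.
have [B' _ Bb'] := axis_power_bounded_mx KC (axis_sym KC ax).
have klm0 : k * l * mu != 0 by rewrite mulf_neq0 // gt_eqF.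
have [phi pT] : exists phi, prox ((k * l)^-1 *: A') u phi.
  apply: (unique_max_prox (B := B) kl0 (axis_neq0 ax)) => //; last by rewrite TE.
  by rewrite A'E -scalemxAl Au scalerA.
have [psi pT'] : exists psi, prox ((k * l * mu) *: invmx A') v psi.
  apply: (unique_min_prox (B := B') gA'.1 klm0 (axis_neq0 (axis_sym KC ax))) => //; last by rewrite TE'.
  by rewrite A'E -scalemxAl Av scalerA mulrA.
by exists phi, psi; split=> //; [rewrite -TE|rewrite -TE'].
Qed.

(** The axis provided by [rank_one] carries no half triangle, hence is biproximal, and [axis_unique]
    identifies it with the given one up to positive scalars. *)
Lemma rank_one_axis g A l u v mu : Aut Om g -> induces A g -> (forall w, C w -> C (A *m w)) ->
  (forall w, C w -> C (invmx A *m w)) -> 0 < l -> axis K C (l^-1 *: A) u v mu ->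
  rank_one Om g -> forall w, ~ half_triangle K C u v w.
Proof.
move=> Ag gA CA CA' l0 ax [_ _ [x [z [tr nht]]]] w ht.
have [u' [v' [l' [mu' [l0' ax' _ htE]]]]] := translates_axis gA CA CA' tr.
have [|phi [psi bT]] := biprox_of_no_half_triangle ax'.
  by move=> w' ht'; apply: nht; apply/htE; exists w'.
have [[a a0 uE] [b b0 vE]] := axis_unique KC l0 l0' ax bT.
apply/nht/htE; exists w; move: ht; rewrite uE vE.
exact: (half_triangle_scale KC a0 b0 (axis_K1 ax') (axis_K2 ax')).
Qed.

End Translations.

Theorem proposition1p21 (R : realType) (d : nat) (Omega : set (pspace R d))
    (g : PGL R d) (x z : pspace R d) :
  properly_convex Omega ->
  Aut Omega g ->
  infinite_order g ->
  translates_along Omega g x z ->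
  let l := open_segment Omega x z in
  [/\ rank_one Omega g <-> morse Omega l,
      morse Omega l <-> contracting Omega l &
      (exists Gamma : set (PGL R d),
         [/\ discrete_subgroup Gamma, Gamma `<=` Aut Omega,
             divides Gamma Omega & Gamma g]) ->
      (rank_one Omega g <-> biproximal g) /\
      (morse Omega l <-> biproximal g)].
Proof.
move=> pc Ag og tr; have [Om0 oOm _] := pc; have [f [fc KC]] := properly_convex_cone pc.
have [A [gA CA CA']] := aut_matrix fc KC Om0 Ag.
(* Powers of matrices need a positive size; for [d = 0] the projective space is empty. *)
case: d => [|n] in Omega g x z pc Ag og tr Om0 oOm f fc KC A gA CA CA' *.
  by case: Om0 => p _; have [v [/eqP v0 _]] := lifts_ex p; case: v0; apply/matrixP => -[].
have [u [v [l [mu [l0 ax -> htE]]]]] := translates_axis oOm fc KC gA CA CA' tr.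
have ch := axis_chord ax; set L := line u v => /=.
(* This alternative decides everything: over a half triangle all conditions fail, biproximality
   thanks to the group, and otherwise all of them hold. *)
have [ht|nht] := pselect (exists w, half_triangle (closed_lift Omega f) (open_lift Omega f) u v w).
  have [w hw] := ht.
  have nm := half_triangle_not_morse oOm fc KC ch hw.
  have nc := half_triangle_not_contracting oOm fc KC ch hw.
  have nr : ~ rank_one Omega g.
    by move=> /(rank_one_axis oOm fc KC Ag gA CA CA' l0 ax)/(_ _ hw).
  split => // -[Gamma [disc GA div Gg]].
  suff nb : ~ biproximal g by split.
  move=> bg; have [phi [psi bT]] := biprox_of_biproximal KC gA l0 ax bg.
  have gT : induces (l^-1 *: A) g by apply: inducesZ; rewrite ?invr_neq0 ?gt_eqF.
  exact: (divides_no_half_triangle fc KC disc GA div Gg gT bT hw).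
have {}nht w : ~ half_triangle (closed_lift Omega f) (open_lift Omega f) u v w.
  by move=> hw; apply: nht; exists w.
have [phi [psi bT]] := biprox_of_no_half_triangle KC ax nht.
have m := morse_of_no_half_triangle oOm fc KC ch bT nht.
have c := contracting_of_no_half_triangle oOm fc KC ch bT nht.
have b := biproximal_of_biprox KC gA l0 bT.
have r : rank_one Omega g.
  by split => //; exists x, z; split => // /htE[w /nht].
by [].
Qed.
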